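(* Let $M$ be the Markov-modulated Ornstein-Uhlenbeck process $$M(t)=m_0+\int_0^t(\alpha_{X(s)}-\gamma_{X(s)}M(s))\,\mathrm ds+\int_0^t\sigma_{X(s)}\,\mathrm dB(s),\qquad t\ge0,$$ with $m_0\in\mathbb R$. For $\vartheta\in\mathbb R$ and $t\ge0$ let $\boldsymbol g(\vartheta,t)=(g_1(\vartheta,t),\dots,g_d(\vartheta,t))^{\rm T}$ with $g_i(\vartheta,t):=\mathbb E\left[e^{-\vartheta M(t)}\mathbf 1\{X(t)=i\}\right]$. Then $\boldsymbol g$ satisfies the system of partial differential equations $$\frac{\partial}{\partial t}\boldsymbol g(\vartheta,t)=Q^{\rm T}\boldsymbol g(\vartheta,t)-\left(\vartheta\,\mathrm{diag}\{\boldsymbol\alpha\}-\tfrac12\vartheta^2\,\mathrm{diag}\{\boldsymbol\sigma^2\}\right)\boldsymbol g(\vartheta,t)-\vartheta\,\mathrm{diag}\{\boldsymbol\gamma\}\,\frac{\partial}{\partial\vartheta}\boldsymbol g(\vartheta,t),$$ with conditions $\boldsymbol g(0,t)=\boldsymbol p_t$ and $\boldsymbol g(\vartheta,0)=e^{-\vartheta m_0}\boldsymbol p_0$.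
   Context: $X$ is a continuous-time Markov chain on $\{1,\dots,d\}$ with generator $Q$ (arbitrary initial law), $B$ is a standard Brownian motion independent of $X$; $\alpha_i\in\mathbb R$, $\gamma_i>0$, $\sigma_i\in\mathbb R$ for $i=1,\dots,d$ are collected in vectors $\boldsymbol\alpha,\boldsymbol\gamma,\boldsymbol\sigma$, and $\boldsymbol\sigma^2:=(\sigma_1^2,\dots,\sigma_d^2)^{\rm T}$. $\boldsymbol p_t:=(\mathbb P(X(t)=1),\dots,\mathbb P(X(t)=d))^{\rm T}$. *)

(* Defs.v *)
From HB Require Import structures.
From mathcomp Require Import all_boot all_order all_algebra.
From mathcomp Require Import all_classical all_reals all_analysis.
Import Order.TTheory GRing.Theory Num.Theory.
Import numFieldNormedType.Exports.

Set Implicit Arguments.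
Unset Strict Implicit.
Unset Printing Implicit Defensive.

Local Open Scope classical_set_scope.
Local Open Scope ring_scope.

(* Processes are indexed by the whole of [R], but only their values at times
   [0 <= t] are ever constrained or used. The states 1, ..., d are the elements
   of ['I_d]; there is no [0 < d] hypothesis because a process [R -> T -> 'I_d]
   on a probability space already forces it. *)

Section sigma_algebras.
Context {disp : measure_display} {T : measurableType disp} {R : realType}.
Variable P : probability T R.

(* The sigma-algebra generated by the [Y s], [s] in [J], where [E] is the
   sigma-algebra of the state space. *)
Definition sigma_process {S : Type} (E : set (set S)) (J : set R)
    (Y : R -> T -> S) : set (set T) :=
  <<s \bigcup_(s in J) preimage_set_system setT (Y s) E >>.

Definition measurable_wrt (G : set (set T)) (f : T -> R) : Prop :=
  preimage_set_system setT f measurable `<=` G.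

Definition independent (G H : set (set T)) : Prop :=
  forall A C, G A -> H C -> P (A `&` C) = (P A * P C)%E.

End sigma_algebras.

Section markov_chain.
Context {disp : measure_display} {T : measurableType disp} {R : realType}.
Variables (P : probability T R) (d : nat).

Definition expmx (A : 'M[R]_d) : 'M[R]_d :=
  limn (series (fun n => (n`!%:R)^-1 *: A ^+ n)).

Definition is_generator (Q : 'M[R]_d) : Prop :=
  (forall i j, i != j -> 0 <= Q i j) /\ (forall i, \sum_j Q i j = 0).

(* Right-continuous paths for the discrete topology, and finite-dimensional
   distributions given by the transition matrices [expmx (t *: Q)]; the law of
   [X 0] is left free. *)
Definition is_markov_chain (Q : 'M[R]_d) (X : R -> T -> 'I_d) : Prop :=
  [/\ forall t i, 0 <= t -> measurable (X t @^-1` [set i]),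
      forall w t, 0 <= t -> \forall s \near t^'+, X s w = X t w &
      forall (n : nat) (t : nat -> R) (x : nat -> 'I_d),
        0 <= t 0%N -> (forall k, (k < n)%N -> t k <= t k.+1) ->
        P (\bigcap_(k in `I_n.+1) (X (t k) @^-1` [set x k])) =
        (P (X (t 0%N) @^-1` [set x 0%N]) *
         (\prod_(k < n) expmx ((t k.+1 - t k) *: Q) (x k) (x k.+1))%:E)%E].

Definition prob_vec (X : R -> T -> 'I_d) (t : R) : 'cV[R]_d :=
  \col_i fine (P (X t @^-1` [set i])).

End markov_chain.

Section brownian_motion.
Context {disp : measure_display} {T : measurableType disp} {R : realType}.
Variable P : probability T R.

(* The second parameter of [normal_prob] is the standard deviation. *)
Definition is_brownian_motion (B : R -> T -> R) : Prop :=
  [/\ forall t, 0 <= t -> measurable_fun setT (B t),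
      {ae P, forall w, B 0 w = 0},
      {ae P, forall w, {within `[0, +oo[, continuous (B ^~ w)}},
      (forall s t, 0 <= s -> s < t -> forall A : set R, measurable A ->
        P ((fun w => B t w - B s w) @^-1` A) =
        normal_prob 0 (Num.sqrt (t - s)) A) &
      forall s t, 0 <= s -> s < t ->
        independent P (sigma_process measurable `[0, s] B)
          (preimage_set_system setT (fun w => B t w - B s w) measurable)].

End brownian_motion.

Section ito_integral.
Context {disp : measure_display} {T : measurableType disp} {R : realType}.
Variable P : probability T R.

(* The process equal to [sp_coef k] on ]sp_time k, sp_time k.+1], k < sp_size. *)
Record simple_process := SimpleProcess {
  sp_size : nat;
  sp_time : nat -> R;
  sp_coef : nat -> T -> R }.

Definition sp_adapted (F : R -> set (set T)) (t : R) (S : simple_process) :=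
  [/\ sp_time S 0%N = 0, sp_time S (sp_size S) = t,
      forall k, (k < sp_size S)%N -> sp_time S k <= sp_time S k.+1,
      forall k, (k < sp_size S)%N ->
        measurable_wrt (F (sp_time S k)) (sp_coef S k) &
      forall k, (k < sp_size S)%N ->
        exists c, forall w, `|sp_coef S k w| <= c].

Definition sp_val (S : simple_process) (s : R) (w : T) : R :=
  \sum_(k < sp_size S)
    sp_coef S k w * \1_(`]sp_time S k, sp_time S k.+1]%classic) s.

Definition sp_int (B : R -> T -> R) (S : simple_process) (w : T) : R :=
  \sum_(k < sp_size S)
    sp_coef S k w * (B (sp_time S k.+1) w - B (sp_time S k) w).

(* [I] is (a version of) the Ito integral of [H] against [B] over [0, t]: the
   L2(P) limit of the integrals of simple [F]-adapted processes which converge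
   to [H] in L2(P x Lebesgue). When [B] is an [F]-Brownian motion, the Ito
   isometry makes [I] almost surely independent of the approximation. *)
Definition is_ito_integral (F : R -> set (set T)) (B H : R -> T -> R) (t : R)
    (I : T -> R) : Prop :=
  [/\ measurable_fun (`[0, t]%classic `*` [set: T])
        (fun z : R * T => H z.1 z.2),
      measurable_fun [set: T] I &
      exists S : nat -> simple_process,
      [/\ forall n, sp_adapted F t (S n),
          (\int[P]_w \int[lebesgue_measure]_(s in `[0%R, t])
            ((sp_val (S n) s w - H s w) ^+ 2)%:E)%E @[n --> \oo] --> 0%E &
          (\int[P]_w ((sp_int B (S n) w - I w) ^+ 2)%:E)%E
            @[n --> \oo] --> 0%E]].

End ito_integral.

Section modulated_ou.
Context {disp : measure_display} {T : measurableType disp} {R : realType}.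
Variables (P : probability T R) (d : nat).

(* The filtration generated by the pair [(X, B)]. *)
Definition joint_filtration (X : R -> T -> 'I_d) (B : R -> T -> R) (t : R) :
    set (set T) :=
  <<s sigma_process setT `[0, t] X `|` sigma_process measurable `[0, t] B >>.

Definition is_mmou (alpha gamma sigma : 'cV[R]_d) (m0 : R)
    (X : R -> T -> 'I_d) (B M : R -> T -> R) : Prop :=
  (forall t, 0 <= t -> measurable_fun setT (M t)) /\
  exists I : R -> T -> R,
    (forall t, 0 <= t ->
      is_ito_integral P (joint_filtration X B) B
        (fun s w => sigma (X s w) 0) t (I t)) /\
    {ae P, forall w,
      {within `[0, +oo[, continuous (M ^~ w)} /\
      forall t, 0 <= t ->
        M t w = m0
          + \int[lebesgue_measure]_(s in `[0, t])
              (alpha (X s w) 0 - gamma (X s w) 0 * M s w)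
          + I t w}.

Definition laplace_integrand (X : R -> T -> 'I_d) (M : R -> T -> R)
    (theta t : R) (i : 'I_d) (w : T) : R :=
  expR (- (theta * M t w)) * \1_(X t @^-1` [set i]) w.

Definition laplace_vec (X : R -> T -> 'I_d) (M : R -> T -> R)
    (theta t : R) : 'cV[R]_d :=
  \col_i fine 'E_P[laplace_integrand X M theta t i].

End modulated_ou.

(* Derivative of [f] at [x] relative to [D]: for [D = `[0, +oo[] it is the
   usual derivative at [x > 0] and the right derivative at [x = 0]. *)
Definition is_derive_within {R : realType} {V : normedModType R} (D : set R)
    (f : R -> V) (x : R) (df : V) : Prop :=
  (y - x)^-1 *: (f y - f x) @[y --> within D x^'] --> df.

(* Main.v *)
(* The process is approximated by an Euler scheme with step h in which the coefficients
   are frozen at the state of [X] at the right end of each step. Conditioning on the last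
   step shows that one step acts on the functions theta |-> E[exp(- theta E_k) 1{X = j}]
   exactly as the explicit operator A_h = [euler_op h], and dA_h/dh at h = 0 is the
   right-hand side of the partial differential equation. No Ito formula is needed: a
   Lipschitz bound gives |A_{h/m}^m f - A_h f| <= C h^2 uniformly in m, the scheme
   converges to [M] (Ito isometry for the noise, a discrete Gronwall inequality along each
   path), and the Laplace transforms converge by uniform integrability. In the limit
   |g(., t + h) - A_h g(., t)| <= C h^2, for negative h as well since A_{-h} A_h is the
   identity up to O(h^2), so that the time derivative of g is that of A_h g at h = 0. *)

Require Import Defs.
From HB Require Import structures.
From mathcomp Require Import all_boot all_order all_algebra.
From mathcomp Require Import all_classical all_reals all_analysis.
From mathcomp Require Import measurable_realfun lebesgue_integral_under ring lra.
Import Order.TTheory GRing.Theory Num.Theory.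
Import numFieldNormedType.Exports.

Set Implicit Arguments.
Unset Strict Implicit.
Unset Printing Implicit Defensive.

Local Open Scope classical_set_scope.
Local Open Scope ring_scope.

(** * Increments of the transition matrices *)

Section matrix_exponential.
Context {R : realType} {d : nat}.
Implicit Types A Q : 'M[R]_d.

(** The difficulty is uniformity in the mesh. Laplace transforms grow exponentially in theta, so all
    bounds live on a window [|theta| <= K]. A short nonnegative step contracts the argument, so the
    window survives any number of steps; only the comparison of two steps of arbitrary sign enlarges
    it, by a factor [1 + G] per step, where [G] is the sum of the gammas. A single number [N] bounds
    both the values and the Lipschitz constant and grows by [1 + C h] per step, hence by an
    exponential of the elapsed time whatever the mesh. As the square of exp(- theta E_k) is the same
    expression at 2 theta, that bound is also the second moment estimate behind uniform
    integrability. Right-end coefficients look into the future of the chain, which is harmless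
    because increments of [B] are independent of the whole chain. Once the states on the grid are
    prescribed, the scheme is a function of [B] alone, and this separates the transition matrix from
    the Gaussian factor. Mean square convergence gives almost sure convergence along a subsequence
    only, and the limits at t and t + h have to share it. *)

Lemma cvg_mx_coord {T : Type} {F : set_system T} {FF : Filter F} (m n : nat)
    (f : T -> 'M[R]_(m, n)) (M : 'M[R]_(m, n)) :
  (forall i j, f x i j @[x --> F] --> M i j) -> f x @[x --> F] --> M.
Proof.
move=> fM A [P MP sPA].
have : \forall x \near F, forall i, forall j, P i j (f x i j).
  apply: filter_forall => i; apply: filter_forall => j.
  exact: fM (MP i j).
by apply: filterS => x; exact: sPA.
Qed.

Lemma expmx_entry_le A (a : R) : (forall i j, `|A i j| <= a) ->
  forall n i j, `|(A ^+ n) i j| <= (d%:R * a) ^+ n.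
Proof.
move=> Aa; elim=> [|n IH] i j.
  by rewrite !expr0 !mxE; case: eqP => _; rewrite ?normr1 ?normr0.
rewrite exprS mxE; apply: le_trans (ler_norm_sum _ _ _) _.
apply: (@le_trans _ _ (\sum_(k < d) a * (d%:R * a) ^+ n)).
  by apply: ler_sum => k _; rewrite normrM ler_pM.
by rewrite sumr_const card_ord exprS -[leLHS]mulr_natl mulrA.
Qed.

Lemma mulmx_exprZ (s : R) Q n : (s *: Q) ^+ n = s ^+ n *: Q ^+ n.
Proof.
elim: n => [|n IH]; first by rewrite !expr0 scale1r.
by rewrite !exprS IH -!mulmxE -scalemxAl -scalemxAr scalerA.
Qed.

Let coef Q i j n : R := (n`!%:R)^-1 * (Q ^+ n) i j.

Lemma expmx_series_cvg Q (s : R) i j :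
  cvgn (series (fun n => coef Q i j n * s ^+ n)).
Proof.
pose a : R := \sum_i \sum_j `|Q i j|.
have Qa k l : `|Q k l| <= a.
  rewrite /a (bigD1 k)//= (bigD1 l)//= -addrA lerDl addr_ge0 ?sumr_ge0//.
  by move=> ? _; rewrite sumr_ge0.
apply: normed_cvg.
apply: (series_le_cvg _ _ _ (is_cvg_series_exp_coeff (d%:R * a * `|s|))) => n //=.
  by rewrite exp_coeff_ge0// mulr_ge0// mulr_ge0//; exact: le_trans (Qa i j).
rewrite /coef /exp_coeff /= !normrM normrX (exprMn _ (_ * a)) normfV normr_nat.
rewrite -mulrA mulrC ler_wpM2r ?invr_ge0// ler_wpM2r ?exprn_ge0//.
exact: expmx_entry_le.
Qed.

Lemma expmx_entryE Q (s : R) i j :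
  series (fun n => coef Q i j n * s ^+ n) @ \oo --> expmx (s *: Q) i j.
Proof.
pose L := \matrix_(i, j) limn (series (fun n => coef Q i j n * s ^+ n)).
have : series (fun n => (n`!%:R)^-1 *: (s *: Q) ^+ n) @ \oo --> L.
  apply: cvg_mx_coord => k l; rewrite mxE.
  have : cvgn (series (fun n => coef Q k l n * s ^+ n)) by exact: expmx_series_cvg.
  apply: cvg_trans; apply: near_eq_cvg; apply: nearW => n.
  rewrite /series /= summxE; apply: eq_bigr => m _.
  by rewrite mulmx_exprZ !mxE /coef mulrAC mulrA.
move=> /cvg_lim L_lim; rewrite /expmx L_lim; last exact: norm_hausdorff.
by rewrite mxE; exact: expmx_series_cvg.
Qed.

Lemma expmx0 Q i j : expmx (0 *: Q) i j = (i == j)%:R.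
Proof.
have E := @expmx_entryE Q 0 i j.
apply: (cvg_unique _ E) => //.
apply: cvg_near_cst.
near=> n; rewrite /series /=.
have -> : n = n.-1.+1 by rewrite prednK//; near: n; exists 1%N.
rewrite big_nat_recl//= big1 ?addr0; last by move=> k _; rewrite expr0n mulr0.
by rewrite /coef fact0 invr1 mul1r !expr0 mulr1 mxE.
Unshelve. all: by end_near. Qed.

Lemma series_exp_coeff_le (x : R) n : 0 <= x ->
  series (exp_coeff x) n <= expR x.
Proof.
move=> x0; rewrite /expR.
apply: nondecreasing_cvgn_le; last exact: is_cvg_series_exp_coeff.
apply/nondecreasing_seqP => k.
by rewrite /series /= big_nat_recr//= lerDl exp_coeff_ge0.
Qed.

(** The quotient by [u - s] is a sum of [n.+2] monomials of degree [n.+1]. This degree is at least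
    1, so with [r <= 1] each monomial is at most [r]; the surviving factor [r] makes the remainder
    of the exponential second order. *)
Lemma expr_increment_le (s u r : R) n : `|s| <= r -> `|u| <= r -> r <= 1 ->
  `|u ^+ n.+2 - s ^+ n.+2| <= n.+2%:R * (`|u - s| * r).
Proof.
move=> sr ur r1; rewrite subrXX normrM mulrCA ler_wpM2l//.
apply: le_trans (ler_norm_sum _ _ _) _.
have r0 : 0 <= r by exact: le_trans sr.
apply: (@le_trans _ _ (\sum_(i < n.+2) r)); last first.
  by rewrite sumr_const card_ord -[leLHS]mulr_natl.
apply: ler_sum => i _; rewrite normrM !normrX.
apply: (@le_trans _ _ (r ^+ (n.+1 - i) * r ^+ i)).
  by rewrite ler_pM ?exprn_ge0// lerXn2r// nnegrE.
rewrite -exprD subnK -1?ltnS// exprS ler_piMr// exprn_ile1//.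
Qed.

(** The terms of degree 0 and 1 of the entrywise power series cancel exactly, and
    [expr_increment_le] bounds the others. All later estimates on [expmx] come from this
    expansion. *)
Lemma expmx_increment Q : exists2 C : R, 0 <= C &
  forall (s h : R) i j, `|s| + `|h| <= 1 ->
  `|expmx ((s + h) *: Q) i j - expmx (s *: Q) i j - h * Q i j| <=
    C * `|h| * (`|s| + `|h|).
Proof.
pose a : R := \sum_i \sum_j `|Q i j|.
have Qa k l : `|Q k l| <= a.
  rewrite /a (bigD1 k)//= (bigD1 l)//= -addrA lerDl addr_ge0 ?sumr_ge0//.
  by move=> ? _; rewrite sumr_ge0.
have a0 : 0 <= a by rewrite /a sumr_ge0// => i _; rewrite sumr_ge0.
pose c := d%:R * a.
have c0 : 0 <= c by rewrite mulr_ge0.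
exists (expR (2 * c)); first exact: expR_ge0.
move=> s h i j sh1; set r : R := `|s| + `|h|.
have H := cvgB (cvgB (@expmx_entryE Q (s + h) i j) (@expmx_entryE Q s i j))
  (cvg_cst (h * Q i j)).
apply: (cvgr_to_le (cvg_norm (H _ _ _))); near=> n.
have -> : n = n.-2.+2.
  by rewrite prednK//; [rewrite prednK//|rewrite -ltnS prednK//];
    near: n; exists 3%N => // -[|[|]].
set m := n.-2.
rewrite /series /= !fctE !big_nat_recl//= !expr0 !expr1.
set S1 := \sum_(0 <= k < m) _; set S2 := \sum_(0 <= k < m) _.
have -> : coef Q i j 0 * 1 + (coef Q i j 1 * (s + h) + S1) -
  (coef Q i j 0 * 1 + (coef Q i j 1 * s + S2)) - h * Q i j = S1 - S2.
  by rewrite /coef !fact0 !factS !fact0 !expr1 !muln1 invr1; ring.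
rewrite /S1 /S2 -sumrB.
apply: le_trans (ler_norm_sum _ _ _) _.
apply: (@le_trans _ _ (\sum_(0 <= k < m) exp_coeff (2 * c) k.+2 * (`|h| * r))).
  apply: ler_sum_nat => k _; rewrite -mulrBr normrM.
  have := @expr_increment_le s (s + h) r k.
  rewrite /r lerDl normr_ge0 => /(_ isT (ler_normD _ _) sh1).
  rewrite (addrC s h) addrK (addrC h s) => Hk.
  apply: le_trans (ler_wpM2l (normr_ge0 _) Hk) _.
  rewrite [leLHS]mulrA; apply: ler_wpM2r; first by rewrite mulr_ge0 ?addr_ge0.
  rewrite /coef normrM normfV normr_nat /exp_coeff /= exprMn.
  rewrite [leRHS]mulrC -mulrA ler_wpM2l ?invr_ge0// mulrC.
  rewrite ler_pM//; first by rewrite -natrX ler_nat ltnW// ltn_expl.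
  exact: expmx_entry_le.
rewrite -mulr_suml -[leRHS]mulrA; apply: ler_wpM2r.
  by rewrite mulr_ge0// addr_ge0.
apply: le_trans (@series_exp_coeff_le _ m.+2 _); last by rewrite mulr_ge0.
rewrite /series /= !big_nat_recl//=.
by rewrite addrA lerDr addr_ge0// exp_coeff_ge0// mulr_ge0.
Unshelve. all: by end_near. Qed.

End matrix_exponential.

Opaque expmx.

(** * The one-step operator on Laplace transforms *)

Section exponential_increments.
Context {R : realType}.
Implicit Types a b c y : R.

Lemma normr_expR_sub1 y : `|expR y - 1| <= `|y| * expR `|y|.
Proof.
have [y0|y0] := leP 0 y.
  have e1 : 1 <= expR y by rewrite -expR0 ler_expR.
  rewrite ger0_norm ?subr_ge0// ger0_norm//.
  have := expR_ge1Dx (- y); rewrite -(ler_pM2l (expR_gt0 y)) -expRD subrr expR0.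
  by lra.
have e1 : expR y <= 1 by rewrite -[leRHS]expR0 ler_expR ltW.
rewrite distrC ger0_norm ?subr_ge0// ltr0_norm//.
have := expR_ge1Dx y; have := expR_ge1Dx (- y).
have : 0 < - y by rewrite oppr_gt0.
set E := expR (- y); set F := expR y => *.
by nra.
Qed.

Lemma expR_le_1D y c : `|y| <= c -> expR y <= 1 + `|y| * expR c.
Proof.
move=> yc; rewrite -lerBlDl; apply: le_trans (ler_norm _) _.
apply: le_trans (normr_expR_sub1 y) _.
by rewrite ler_wpM2l// ler_expR.
Qed.

(** Factor out [expR b]: one [c] in the exponent bounds it, the other two bound [expR] of
    [|a - b|]. *)
Lemma expR_lip a b c : `|a| <= c -> `|b| <= c ->
  `|expR a - expR b| <= expR (3 * c) * `|a - b|.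
Proof.
move=> ac bc.
have -> : expR a - expR b = expR b * (expR (a - b) - 1).
  by rewrite mulrBr mulr1 -expRD subrKC.
rewrite normrM ger0_norm ?expR_ge0//.
have -> : 3 * c = c + (c + c) by ring.
rewrite [in leRHS]expRD -[leRHS]mulrA; apply: ler_pM; rewrite ?expR_ge0//.
  by rewrite ler_expR (le_trans (ler_norm _)).
apply: le_trans (normr_expR_sub1 _) _.
rewrite mulrC ler_wpM2r// ler_expR.
by apply: le_trans (ler_normB _ _) _; rewrite lerD.
Qed.

End exponential_increments.

Section euler_operator.
Context {R : realType} {d : nat}.
Variables (Q : 'M[R]_d) (alpha gamma sigma : 'cV[R]_d).
Implicit Types (f g : 'I_d -> R -> R) (h s K N : R) (i j l : 'I_d).

(** The Laplace exponent of Brownian motion with drift [alpha j 0] and volatility [sigma j 0]: over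
    a time [h], its increment has Laplace transform exp(h * symbol j x) at [x]. *)
Definition symbol j (x : R) : R :=
  - (x * alpha j 0) + 2^-1 * x ^+ 2 * sigma j 0 ^+ 2.

(* The effect on Laplace transforms of one Euler step of length [h] whose coefficients are
   frozen at the final state [j] of the chain. *)
Definition euler_op h f j (x : R) : R :=
  expR (h * symbol j x) *
  \sum_i expmx (h *: Q) i j * f i ((1 - gamma j 0 * h) * x).

(** The window [|x| <= K] is part of the bound because even the initial transform exp(- x m0) is in
    general unbounded on the line. *)
Definition supb K N f := forall i x, `|x| <= K -> `|f i x| <= N.

Definition lipb K N f := forall i x y, `|x| <= K -> `|y| <= K ->
  `|f i x - f i y| <= N * `|x - y|.

Lemma euler_opB h f g j x :
  euler_op h (fun i y => f i y - g i y) j x = euler_op h f j x - euler_op h g j x.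
Proof.
rewrite /euler_op -mulrBr -sumrB; congr (_ * _).
by apply: eq_bigr => i _; rewrite mulrBr.
Qed.

Lemma euler_op0 f j x : euler_op 0 f j x = f j x.
Proof.
rewrite /euler_op mul0r expR0 mul1r mulr0 subr0 mul1r (bigD1 j)//= expmx0.
rewrite eqxx mul1r big1 ?addr0// => i /negbTE ij.
by rewrite expmx0 ij mul0r.
Qed.

Lemma symbol_bound K : 0 <= K -> exists2 c : R, 0 <= c & forall j,
  (forall x, `|x| <= K -> `|symbol j x| <= c) /\
  (forall x y, `|x| <= K -> `|y| <= K ->
     `|symbol j x - symbol j y| <= c * `|x - y|).
Proof.
move=> K0.
pose c : R := \sum_j (K * `|alpha j 0| + K ^+ 2 * sigma j 0 ^+ 2 +
                 (`|alpha j 0| + K * sigma j 0 ^+ 2)).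
have sq_ge0 j : 0 <= sigma j 0 ^+ 2 by rewrite sqr_ge0.
have c0 j : 0 <= K * `|alpha j 0| + K ^+ 2 * sigma j 0 ^+ 2 /\
       0 <= `|alpha j 0| + K * sigma j 0 ^+ 2.
  by split; rewrite addr_ge0// mulr_ge0// exprn_ge0.
have cj j : K * `|alpha j 0| + K ^+ 2 * sigma j 0 ^+ 2 +
                 (`|alpha j 0| + K * sigma j 0 ^+ 2) <= c.
  rewrite /c (bigD1 j)//= lerDl sumr_ge0// => i _.
  by have [? ?] := c0 i; rewrite addr_ge0.
exists c; first by rewrite sumr_ge0// => j _; have [? ?] := c0 j; rewrite addr_ge0.
move=> j; have [ca cb] := c0 j; have cj' := cj j; split=> [x xK|x y xK yK].
- apply: (le_trans (ler_normD _ _)).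
  rewrite normrN !normrM -!expr2 (real_normK (num_real (sigma j 0)))
      (@ger0_norm _ 2^-1) ?invr_ge0//.
  have h1 : `|x| * `|alpha j 0| <= K * `|alpha j 0| by rewrite ler_wpM2r.
  have h2 : `|x| ^+ 2 * sigma j 0 ^+ 2 <= K ^+ 2 * sigma j 0 ^+ 2.
    by rewrite ler_wpM2r// lerXn2r// nnegrE.
  have h3 : 0 <= `|x| ^+ 2 * sigma j 0 ^+ 2 by rewrite mulr_ge0// exprn_ge0.
  rewrite -mulrA; lra.
- have -> : symbol j x - symbol j y =
    (- alpha j 0 + 2^-1 * (x + y) * sigma j 0 ^+ 2) * (x - y).
    by rewrite /symbol; field.
  rewrite normrM ler_wpM2r//; apply: (le_trans (ler_normD _ _)).
  rewrite normrN !normrM -!expr2 (real_normK (num_real (sigma j 0)))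
      (@ger0_norm _ 2^-1) ?invr_ge0//.
  have h2 : `|x + y| * sigma j 0 ^+ 2 <= (K + K) * sigma j 0 ^+ 2.
    by rewrite ler_wpM2r// (le_trans (ler_normD _ _))// lerD.
  rewrite -mulrA; lra.
Qed.

Lemma expmx_close : exists2 c : R, 0 <= c & forall h i j, `|h| <= 1 ->
  `|expmx (h *: Q) i j - (i == j)%:R| <= c * `|h|.
Proof.
have [C C0 HC] := expmx_increment Q.
pose a : R := \sum_i \sum_j `|Q i j|.
have Qa k l : `|Q k l| <= a.
  rewrite /a (bigD1 k)//= (bigD1 l)//= -addrA lerDl addr_ge0 ?sumr_ge0//.
  by move=> ? _; rewrite sumr_ge0.
have a0 : 0 <= a by rewrite /a sumr_ge0// => i _; rewrite sumr_ge0.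
exists (C + a) => [|h i j h1]; first by rewrite addr_ge0.
have := HC 0 h i j; rewrite normr0 (add0r h) (add0r `|h|) (expmx0 Q i j) => /(_ h1) H.
have -> : expmx (h *: Q) i j - (i == j)%:R =
  (expmx (h *: Q) i j - (i == j)%:R - h * Q i j) + h * Q i j by ring.
apply: le_trans (ler_normD _ _) _; rewrite mulrDl lerD//.
  apply: le_trans H _; rewrite -[leRHS]mulr1; apply: ler_wpM2l => //.
  by rewrite mulr_ge0.
by rewrite normrM mulrC ler_wpM2r.
Qed.

(** [euler_op] sums over the first index of the transition matrix, so column sums matter. They are 1
    only up to O(h), and absolute values are taken because entries may be negative for [h < 0]. *)
Lemma expmx_col_sum : exists2 c : R, 0 <= c & forall h j, `|h| <= 1 ->
  \sum_i `|expmx (h *: Q) i j| <= 1 + c * `|h|.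
Proof.
have [c c0 Hc] := expmx_close.
exists (d%:R * c) => [|h j h1]; first by rewrite mulr_ge0.
apply: (@le_trans _ _ (\sum_(i < d) ((i == j)%:R + c * `|h|))).
  apply: ler_sum => i _; rewrite -lerBlDl.
  apply: le_trans (Hc h i j h1).
  rewrite -{1}[(i == j)%:R]ger0_norm ?ler0n//; exact: lerB_dist.
rewrite big_split/= sumr_const card_ord (bigD1 j)//= eqxx big1 ?addr0; last first.
  by move=> i /negbTE ->.
by rewrite -[_ *+ d]mulr_natl mulrA.
Qed.

Lemma wsum_bound K N f (w : 'I_d -> R) W x : 0 <= N -> supb K N f -> `|x| <= K ->
  \sum_l `|w l| <= W -> `|\sum_l w l * f l x| <= W * N.
Proof.
move=> N0 fN xK wW; apply: le_trans (ler_norm_sum _ _ _) _.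
apply: (@le_trans _ _ (\sum_l `|w l| * N)).
  by apply: ler_sum => l _; rewrite normrM ler_wpM2l// fN.
by rewrite -mulr_suml ler_wpM2r.
Qed.

Lemma wsum_lip K N f (w : 'I_d -> R) W x y : 0 <= N -> lipb K N f ->
  `|x| <= K -> `|y| <= K ->
  \sum_l `|w l| <= W ->
  `|\sum_l w l * f l x - \sum_l w l * f l y| <= W * N * `|x - y|.
Proof.
move=> N0 fN xK yK wW; rewrite -sumrB; apply: le_trans (ler_norm_sum _ _ _) _.
apply: (@le_trans _ _ (\sum_l `|w l| * (N * `|x - y|))).
  by apply: ler_sum => l _; rewrite -mulrBr normrM ler_wpM2l// fN.
by rewrite -mulr_suml -mulrA ler_wpM2r// mulr_ge0.
Qed.

(** Comparison of two frozen steps with the same weights but different exponents and arguments; the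
    values of [f] pay for the first change and its Lipschitz constant for the second. *)
Lemma weighted_diff K N f (w : 'I_d -> R) (W a b c x y : R) :
  0 <= N -> 0 <= W -> supb K N f -> lipb K N f -> `|x| <= K -> `|y| <= K ->
  `|a| <= c -> `|b| <= c -> \sum_l `|w l| <= W ->
  `|expR a * (\sum_l w l * f l x) - expR b * (\sum_l w l * f l y)| <=
    expR (3 * c) * W * N * (`|a - b| + `|x - y|).
Proof.
move=> N0 W0 fN fL xK yK ac bc wW.
set Sx := \sum_l w l * f l x; set Sy := \sum_l w l * f l y.
have -> : expR a * Sx - expR b * Sy = (expR a - expR b) * Sx + expR b * (Sx - Sy).
  by ring.
have c0 : 0 <= c by exact: le_trans ac.
rewrite [leRHS]mulrDr; apply: le_trans (ler_normD _ _) _.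
apply: lerD; rewrite normrM.
- have -> : expR (3 * c) * W * N * `|a - b| = (expR (3 * c) * `|a - b|) * (W * N).
    by ring.
  by rewrite ler_pM//; [exact: expR_lip|exact: (@wsum_bound K)].
- rewrite ger0_norm ?expR_ge0// -!mulrA; apply: ler_pM; rewrite ?expR_ge0//.
    rewrite ler_expR; apply: le_trans (ler_norm _) _; apply: le_trans bc _.
    by rewrite ler_peMl// ler1n.
  by rewrite mulrA; exact: (@wsum_lip K).
Qed.

Hypothesis gamma_ge0 : forall i, 0 <= gamma i 0.

Let G := \sum_i gamma i 0.

Let G_ge0 : 0 <= G. Proof. by rewrite /G sumr_ge0. Qed.

Let gamma_le j : gamma j 0 <= G.
Proof. by rewrite /G (bigD1 j)//= lerDl sumr_ge0. Qed.

(** Since [gamma j 0 <= G], the factor lies in [0, 1]. Hence short forward steps can be iterated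
    without leaving the window. *)
Lemma contraction_le h j (x : R) : 0 <= h -> G * h <= 1 ->
  `|(1 - gamma j 0 * h) * x| <= `|x|.
Proof.
move=> h0 Gh; rewrite normrM ler_piMl//.
have : gamma j 0 * h <= 1 by apply: le_trans Gh; rewrite ler_wpM2r.
have : 0 <= gamma j 0 * h by rewrite mulr_ge0.
by rewrite ler_norml; lra.
Qed.

(** The shape [1 + C * h] is what counts: its powers are bounded by an exponential of the total
    time. The same [N] serves for values and slopes because the exponential factor turns the bound
    on values into a slope of order [h], measured by the constant [e] of the proof. *)
Lemma euler_op_stable K : 0 <= K -> exists2 C : R, 0 <= C &
  forall h N f, 0 <= h -> h <= 1 -> G * h <= 1 -> 0 <= N -> supb K N f ->
  supb K (N * (1 + C * h)) (euler_op h f) /\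
  (lipb K N f -> lipb K (N * (1 + C * h)) (euler_op h f)).
Proof.
move=> K0.
have [cq cq0 Hq] := symbol_bound K0.
have [cp cp0 Hp] := expmx_col_sum.
pose a := cq * expR cq.
have a0 : 0 <= a by rewrite mulr_ge0// expR_ge0.
pose e := expR (3 * cq) * cq * (1 + cp).
have e0 : 0 <= e by rewrite /e !mulr_ge0// ?expR_ge0// addr_ge0.
exists (a + cp + a * cp + e) => [|h N f h0 h1 Gh N0 fN].
  by rewrite !addr_ge0// mulr_ge0.
have col j : \sum_l `|expmx (h *: Q) l j| <= 1 + cp * h.
  by have := Hp h j; rewrite ger0_norm//; apply.
have hq j x : `|x| <= K -> `|h * symbol j x| <= cq * h.
  by move=> xK; rewrite normrM (ger0_norm h0) mulrC ler_wpM2r// (proj1 (Hq j)).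
have cqh : cq * h <= cq by rewrite ler_piMr.
have eq1 j x : `|x| <= K -> expR (h * symbol j x) <= 1 + a * h.
  move=> xK; apply: (le_trans (@expR_le_1D _ _ cq _)).
    exact: le_trans (hq _ _ xK) cqh.
  by rewrite lerD2l /a mulrAC ler_wpM2r ?expR_ge0// hq.
have ah : (1 + a * h) * (1 + cp * h) <= 1 + (a + cp + a * cp) * h.
  have : a * cp * (h * h) <= a * cp * h by rewrite ler_wpM2l ?mulr_ge0// ler_piMr.
  by lra.
have eh0 : 0 <= e * h by rewrite mulr_ge0.
have sumK j x : `|x| <= K ->
    `|\sum_i expmx (h *: Q) i j * f i ((1 - gamma j 0 * h) * x)| <=
    (1 + cp * h) * N.
  move=> xK; apply: (@wsum_bound K) => //.
  exact: le_trans (contraction_le _ _ _ _) xK.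
have opK j x : `|x| <= K -> `|euler_op h f j x| <= N * (1 + (a + cp + a * cp) * h).
  move=> xK; rewrite /euler_op normrM ger0_norm ?expR_ge0//.
  apply: (@le_trans _ _ ((1 + a * h) * ((1 + cp * h) * N))).
    by rewrite ler_pM ?expR_ge0//; [exact: eq1|exact: sumK].
  by rewrite mulrA mulrC ler_wpM2l.
split=> [j x xK|fL j x y xK yK].
  by apply: le_trans (opK _ _ xK) _; rewrite ler_wpM2l//; lra.
rewrite /euler_op.
set Sx := \sum_i _; set Sy := \sum_i _.
have -> : expR (h * symbol j x) * Sx - expR (h * symbol j y) * Sy =
  (expR (h * symbol j x) - expR (h * symbol j y)) * Sx +
  expR (h * symbol j y) * (Sx - Sy) by ring.
have xK' := le_trans (contraction_le j x h0 Gh) xK.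
have yK' := le_trans (contraction_le j y h0 Gh) yK.
have h2 : `|expR (h * symbol j y) * (Sx - Sy)| <=
    N * (1 + (a + cp + a * cp) * h) * `|x - y|.
  rewrite normrM ger0_norm ?expR_ge0//.
  apply: (@le_trans _ _ ((1 + a * h) * ((1 + cp * h) * N * `|x - y|))).
    apply: ler_pM; rewrite ?expR_ge0//; first exact: eq1.
    apply: (le_trans (wsum_lip N0 fL xK' yK' (col j))).
    rewrite ler_wpM2l ?mulr_ge0// ?addr_ge0 ?mulr_ge0//.
    by rewrite -mulrBr contraction_le.
  rewrite !mulrA; apply: ler_wpM2r => //.
  by rewrite mulrC ler_wpM2l.
have h3 : `|(expR (h * symbol j x) - expR (h * symbol j y)) * Sx| <=
    N * (e * h) * `|x - y|.
  rewrite normrM.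
  apply: (@le_trans _ _ (expR (3 * cq) * (h * (cq * `|x - y|)) * ((1 + cp) * N))).
    apply: ler_pM => //.
      apply: le_trans (expR_lip (le_trans (hq _ _ xK) cqh)
        (le_trans (hq _ _ yK) cqh)) _.
      rewrite ler_wpM2l ?expR_ge0// -mulrBr normrM (ger0_norm h0) ler_wpM2l//.
      exact: (proj2 (Hq j)).
    apply: le_trans (sumK _ _ xK) _.
    by rewrite ler_wpM2r// lerD2l ler_piMr.
  by rewrite /e le_eqVlt; apply/orP; left; apply/eqP; ring.
apply: le_trans (ler_normD _ _) _; apply: le_trans (lerD h3 h2) _.
by rewrite le_eqVlt; apply/orP; left; apply/eqP; ring.
Qed.

(** Two successive steps are compared with one step of the total length by summing over the
    intermediate state [i]. If [i = j], exponents and arguments differ by O(|s| |h|) only; if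
    [i != j], they differ by O(|s|) but the transition weight is O(|h|). The product of the two
    transition matrices misses the third one at second order. Steps of both signs are allowed, so
    each may stretch the argument by [1 + G], whence the window [K * (1 + G) ^+ 2]. *)
Lemma euler_op_local_error K : 0 <= K -> exists2 C : R, 0 <= C &
  forall s h N f, `|s| + `|h| <= 1 -> 0 <= N ->
  supb (K * (1 + G) ^+ 2) N f -> lipb (K * (1 + G) ^+ 2) N f ->
  forall j x, `|x| <= K ->
  `|euler_op h (euler_op s f) j x - euler_op (s + h) f j x| <=
    C * N * `|h| * (`|s| + `|h|).
Proof.
move=> K0.
set K2 := K * (1 + G) ^+ 2.
have G1 : 1 <= 1 + G by rewrite lerDl.
pose K1 := K * (1 + G).
have K10 : 0 <= K1 by rewrite mulr_ge0// addr_ge0.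
have K20 : 0 <= K2 by rewrite mulr_ge0// exprn_ge0// addr_ge0.
have KK1 : K <= K1 by rewrite ler_peMr.
have K12 : K1 <= K2 by rewrite /K1 /K2 expr2 mulrA ler_peMr.
have [cq cq0 Hq] := symbol_bound K10.
have [cp cp0 Hp] := expmx_col_sum.
have [cd cd0 Hd] := expmx_close.
have [ci ci0 Hi] := expmx_increment Q.
pose c := cq + cq.
pose D := expR (3 * c) * (1 + cp).
have D0 : 0 <= D by rewrite mulr_ge0 ?expR_ge0// addr_ge0.
pose L := cq * (G * K) + G * G * K.
have L0 : 0 <= L by rewrite addr_ge0 ?mulr_ge0.
pose O := c + 3 * (G + G * G) * K + c.
have O0 : 0 <= O by rewrite /O /c !addr_ge0 ?mulr_ge0 ?addr_ge0// mulr_ge0.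
pose J := d%:R * (cd * cd) + 2 * ci.
have J0 : 0 <= J by rewrite addr_ge0// ?mulr_ge0.
have c0 : 0 <= c by rewrite addr_ge0.
have DE : D = expR (3 * c) * (1 + cp) by [].
have LE : L = cq * (G * K) + G * G * K by [].
have OE : O = c + 3 * (G + G * G) * K + c by [].
have JE : J = d%:R * (cd * cd) + 2 * ci by [].
clearbody D L O J.
exists ((1 + cd) * (D * L) + d%:R * (cd * (D * O)) + expR c * (d%:R * J)).
  apply: addr_ge0; last by rewrite !mulr_ge0// expR_ge0.
  apply: addr_ge0; first by rewrite mulr_ge0 ?addr_ge0// mulr_ge0.
  by rewrite !mulr_ge0.
move=> s h N f sh1 N0 fN fL j x xK.
have s1 : `|s| <= 1 by apply: le_trans sh1; rewrite lerDl.
have h1 : `|h| <= 1 by apply: le_trans sh1; rewrite lerDr.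
have sD1 : `|s + h| <= 1 by apply: le_trans sh1; exact: ler_normD.
have xK1 := le_trans xK KK1.
have fac i u : `|u| <= 1 -> `|1 - gamma i 0 * u| <= 1 + G.
  move=> u1; apply: le_trans (ler_normB _ _) _; rewrite normr1 lerD2l normrM.
  by rewrite (ger0_norm (gamma_ge0 i)) -[leRHS]mulr1 ler_pM.
pose x1 := (1 - gamma j 0 * h) * x.
have x1K : `|x1| <= K1 by rewrite normrM mulrC ler_pM// fac.
pose y i := (1 - gamma i 0 * s) * x1.
have yK i : `|y i| <= K2.
  by rewrite /K2 expr2 mulrA normrM mulrC ler_pM// fac.
pose x2 := (1 - gamma j 0 * (s + h)) * x.
have x2K : `|x2| <= K2.
  by apply: le_trans K12; rewrite normrM mulrC ler_pM// fac.
pose a i := h * symbol j x + s * symbol i x1.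
pose b := (s + h) * symbol j x.
have cqc : cq <= c by rewrite lerDl.
have bc : `|b| <= c.
  apply: le_trans cqc; rewrite normrM -[leRHS]mul1r.
  by rewrite ler_pM// (proj1 (Hq j)).
have ac i : `|a i| <= c.
  apply: le_trans (ler_normD _ _) _; rewrite !normrM lerD//.
    by rewrite -[leRHS]mul1r ler_pM// (proj1 (Hq j)).
  by rewrite -[leRHS]mul1r ler_pM// (proj1 (Hq i)).
have pW u i : `|u| <= 1 -> \sum_l `|expmx (u *: Q) l i| <= 1 + cp.
  by move=> u1; apply: le_trans (Hp u i u1) _; rewrite lerD2l ler_piMr.
(* [U i] is the contribution of the true composition through state [i]; [V i] has the exponent and
   the argument of the single long step, frozen at [j]. *)
pose U i := expR (a i) * \sum_l expmx (s *: Q) l i * f l (y i).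
pose V i := expR b * \sum_l expmx (s *: Q) l i * f l x2.
have UV i : `|U i - V i| <= D * N * (`|a i - b| + `|y i - x2|).
  by rewrite DE; apply: (@weighted_diff K2) => //; [rewrite addr_ge0|exact: pW].
have xx1 : `|x1 - x| <= `|h| * (G * K).
  rewrite /x1 mulrBl mul1r addrC addKr normrN normrM normrM (ger0_norm (gamma_ge0 j)).
  by rewrite mulrAC mulrC ler_wpM2l// ler_pM.
have UVj : `|U j - V j| <= D * L * N * (`|s| * `|h|).
  apply: le_trans (UV j) _.
  have -> : D * L * N * (`|s| * `|h|) = D * N * (L * (`|s| * `|h|)) by ring.
  rewrite ler_wpM2l ?mulr_ge0// LE mulrDl lerD//.
    have -> : a j - b = s * (symbol j x1 - symbol j x) by rewrite /a /b; ring.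
    rewrite normrM.
    have -> : cq * (G * K) * (`|s| * `|h|) = `|s| * (cq * (`|h| * (G * K))) by ring.
    rewrite ler_wpM2l//; apply: le_trans (proj2 (Hq j) _ _ x1K xK1) _.
    by rewrite ler_wpM2l.
  have -> : y j - x2 = gamma j 0 * gamma j 0 * x * (s * h) by rewrite /y /x1 /x2; ring.
  rewrite !normrM (ger0_norm (gamma_ge0 j)) ler_wpM2r ?mulr_ge0//.
  by rewrite ler_pM ?mulr_ge0// ler_pM.
have UVi i : `|U i - V i| <= D * O * N * `|s|.
  apply: le_trans (UV i) _.
  have -> : D * O * N * `|s| = D * N * (O * `|s|) by ring.
  rewrite ler_wpM2l ?mulr_ge0//.
  have -> : a i - b = s * (symbol i x1 - symbol j x) by rewrite /a /b; ring.
  have -> : y i - x2 = (gamma j 0 - gamma i 0 + gamma i 0 * gamma j 0 * h) * x * s.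
    by rewrite /y /x1 /x2; ring.
  rewrite 2!normrM [`|s| * _]mulrC -mulrDl ler_wpM2r// normrM.
  have : `|symbol i x1 - symbol j x| <= c.
    by apply: le_trans (ler_normB _ _) _; rewrite lerD// ?(proj1 (Hq _)).
  have : `|gamma j 0 - gamma i 0 + gamma i 0 * gamma j 0 * h| * `|x| <=
      3 * (G + G * G) * K.
    rewrite ler_pM//; apply: le_trans (ler_normD _ _) _.
    have : `|gamma j 0 - gamma i 0| <= G + G.
      apply: le_trans (ler_normB _ _) _.
      by rewrite !ger0_norm// lerD.
    have : `|gamma i 0 * gamma j 0 * h| <= G * G.
      rewrite !normrM (ger0_norm (gamma_ge0 i)) (ger0_norm (gamma_ge0 j)) -[leRHS]mulr1.
      by rewrite ler_pM ?mulr_ge0// ler_pM.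
    have : 0 <= G * G by rewrite mulr_ge0.
    by lra.
  rewrite OE; lra.
pose w l := \sum_i expmx (s *: Q) l i * expmx (h *: Q) i j - expmx ((s + h) *: Q) l j.
(* The mismatch of the matrices is a product of two deviations from the identity plus a difference
   of two first-order remainders, all of them already estimated. *)
have wE l : w l = \sum_i (expmx (s *: Q) l i - (l == i)%:R) *
       (expmx (h *: Q) i j - (i == j)%:R) +
     (expmx (h *: Q) l j - (l == j)%:R - h * Q l j -
      (expmx ((s + h) *: Q) l j - expmx (s *: Q) l j - h * Q l j)).
  have E1 : \sum_i expmx (s *: Q) l i * (i == j)%:R = expmx (s *: Q) l j.
    rewrite (bigD1 j)//= eqxx mulr1 big1 ?addr0// => k /negbTE ->.
    by rewrite mulr0.
  have E2 : \sum_i (l == i)%:R * (expmx (h *: Q) i j - (i == j)%:R) =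
      expmx (h *: Q) l j - (l == j)%:R.
    rewrite (bigD1 l)//= eqxx mul1r big1 ?addr0// => k kl.
    by rewrite eq_sym (negbTE kl) mul0r.
  under eq_bigr do rewrite mulrBl.
  rewrite sumrB E2; under eq_bigr do rewrite mulrBr.
  by rewrite sumrB E1 /w; ring.
have wJ l : `|w l| <= J * (`|h| * (`|s| + `|h|)).
  rewrite wE; apply: le_trans (ler_normD _ _) _.
  have hr0 : 0 <= `|h| * (`|s| + `|h|) by rewrite mulr_ge0// addr_ge0.
  rewrite JE mulrDl lerD//.
    apply: le_trans (ler_norm_sum _ _ _) _.
    apply: (@le_trans _ _ (\sum_(i < d) cd * cd * (`|h| * (`|s| + `|h|)))).
      apply: ler_sum => i _; rewrite normrM.
      apply: (@le_trans _ _ ((cd * `|s|) * (cd * `|h|))); first by rewrite ler_pM// Hd.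
      rewrite mulrACA ler_wpM2l ?mulr_ge0// mulrC ler_wpM2l// lerDl//.
    by rewrite sumr_const card_ord -[leLHS]mulr_natl !mulrA.
  apply: le_trans (ler_normB _ _) _.
  have -> : 2 * ci * (`|h| * (`|s| + `|h|)) =
    ci * `|h| * (`|s| + `|h|) + ci * `|h| * (`|s| + `|h|) by ring.
  apply: lerD; last exact: Hi.
  have := Hi 0 h l j; rewrite normr0 (add0r h) (add0r `|h|) (expmx0 Q l j) => /(_ h1) H.
  by apply: le_trans H _; rewrite ler_wpM2l ?mulr_ge0// lerDr.
have -> : euler_op h (euler_op s f) j x - euler_op (s + h) f j x =
   (\sum_i expmx (h *: Q) i j * (U i - V i)) + expR b * \sum_l w l * f l x2.
  under [in RHS]eq_bigr do rewrite mulrBr.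
  rewrite sumrB.
  have -> : \sum_i expmx (h *: Q) i j * U i = euler_op h (euler_op s f) j x.
    rewrite /euler_op mulr_sumr; apply: eq_bigr => i _.
    by rewrite /U /a /y /x1 expRD [RHS]mulrCA; congr (_ * _); rewrite -mulrA.
  have -> : \sum_i expmx (h *: Q) i j * V i = expR b *
      (\sum_l (\sum_i expmx (s *: Q) l i * expmx (h *: Q) i j) * f l x2).
    under [in RHS]eq_bigr do rewrite mulr_suml.
    rewrite exchange_big/= mulr_sumr; apply: eq_bigr => i _.
    rewrite /V mulrCA; congr (_ * _); rewrite mulr_sumr; apply: eq_bigr => l _.
    by rewrite mulrA [_ * expmx (h *: Q) i j]mulrC.
  have -> : \sum_l w l * f l x2 =
      \sum_l (\sum_i expmx (s *: Q) l i * expmx (h *: Q) i j) * f l x2 -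
      \sum_l expmx ((s + h) *: Q) l j * f l x2.
    by rewrite -sumrB; apply: eq_bigr => l _; rewrite -mulrBl.
  by rewrite [in RHS]mulrBr subrKA /euler_op -/b -/x2.
set r := `|s| + `|h|.
have r0 : 0 <= r by rewrite addr_ge0.
have sr : `|s| <= r by rewrite lerDl.
have part2 : `|expR b * \sum_l w l * f l x2| <= expR c * (d%:R * J) * N * `|h| * r.
  rewrite normrM ger0_norm ?expR_ge0//.
  have -> : expR c * (d%:R * J) * N * `|h| * r =
    expR c * ((d%:R * (J * (`|h| * r))) * N) by ring.
  apply: ler_pM; rewrite ?expR_ge0//.
    by rewrite ler_expR; exact: le_trans (ler_norm _) bc.
  apply: (@wsum_bound K2) => //.
  rewrite -[d in d%:R]card_ord mulr_natl -sumr_const.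
  by apply: ler_sum => l _; exact: wJ.
have part1 : `|\sum_i expmx (h *: Q) i j * (U i - V i)| <=
    ((1 + cd) * (D * L) + d%:R * (cd * (D * O))) * N * `|h| * r.
  rewrite (bigD1 j)//=; apply: le_trans (ler_normD _ _) _.
  rewrite mulrDl mulrDl mulrDl; apply: lerD.
    rewrite normrM.
    have -> : (1 + cd) * (D * L) * N * `|h| * r =
      (1 + cd) * (D * L * N * (r * `|h|)) by ring.
    apply: ler_pM => //.
      have := Hd h j j h1; rewrite eqxx => H.
      rewrite -[expmx _ _ _](subrK 1) addrC; apply: le_trans (ler_normD _ _) _.
      rewrite normr1 lerD2l; apply: le_trans H _; by rewrite ler_piMr.
    apply: le_trans UVj _; rewrite ler_wpM2l ?mulr_ge0//; last by rewrite ler_wpM2r.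
  have -> : d%:R * (cd * (D * O)) * N * `|h| * r =
    d%:R * ((cd * `|h|) * (D * O * N * r)) by ring.
  apply: le_trans (ler_norm_sum _ _ _) _.
  rewrite big_mkcond/= -[d in d%:R]card_ord mulr_natl -sumr_const.
  apply: ler_sum => i _; case: ifPn => [ij|_]; last by rewrite !mulr_ge0.
  rewrite normrM; apply: ler_pM => //.
    by have := Hd h i j h1; rewrite (negbTE ij) subr0.
  by apply: le_trans (UVi i) _; rewrite ler_wpM2l ?mulr_ge0.
apply: le_trans (ler_normD _ _) _.
rewrite (mulrDl _ (expR c * _) N) (mulrDl _ (expR c * _ * N) `|h|).
by rewrite (mulrDl _ (expR c * _ * N * `|h|) r) lerD.
Qed.

Lemma euler_op_supb K : 0 <= K -> exists2 C : R, 0 <= C &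
  forall h N f, 0 <= h -> h <= 1 -> G * h <= 1 -> 0 <= N -> supb K N f ->
  supb K (N * (1 + C * h)) (euler_op h f).
Proof.
move=> K0; have [C C0 H] := euler_op_stable K0.
by exists C => // h N f h0 h1 Gh N0 fN; have [] := H h N f h0 h1 Gh N0 fN.
Qed.

Lemma expr_1D_le_expR (c h : R) m : 0 <= c * h -> (1 + c * h) ^+ m <= expR (c * (m%:R * h)).
Proof.
move=> ch; have -> : c * (m%:R * h) = (c * h) * m%:R by ring.
by rewrite expRM_natr lerXn2r// ?nnegrE ?expR_ge0 ?addr_ge0// expR_ge1Dx.
Qed.

(** Induction on the number of steps. The new error compares one short step applied to the operator
    of length [k%:R * h] with the operator of length [k.+1%:R * h], both acting on the original [f];
    so the Lipschitz bound is asked of [f] only, and the old error is propagated by sup stability.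
    The bound depends on [m] and [h] through [m%:R * h] alone. *)
Lemma euler_op_iter K : 0 <= K -> exists2 C : R, 0 <= C &
  forall m h N f, 0 <= h -> m%:R * h <= 1 -> G * h <= 1 -> 0 <= N ->
  supb (K * (1 + G) ^+ 2) N f -> lipb (K * (1 + G) ^+ 2) N f ->
  forall j x, `|x| <= K ->
  `|iter m (euler_op h) f j x - euler_op (m%:R * h) f j x| <=
    C * N * (m%:R * h) ^+ 2.
Proof.
move=> K0; have [Cs Cs0 Hs] := euler_op_supb K0.
have [Cl Cl0 Hl] := euler_op_local_error K0.
exists (expR Cs * Cl); first by rewrite mulr_ge0 ?expR_ge0.
move=> m h N f h0 mh Gh N0 fN fL.
have Csh : 0 <= Cs * h by rewrite mulr_ge0.
(* The local error of step [k] is of order [k.+1%:R * h ^+ 2], so the errors add up to order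
   [(k%:R * h) ^+ 2]; the power in front accounts for their propagation. *)
have step k : (k <= m)%N -> forall j x, `|x| <= K ->
    `|iter k (euler_op h) f j x - euler_op (k%:R * h) f j x| <=
    (1 + Cs * h) ^+ k * (Cl * N * (h * h) * (k%:R * k%:R)).
  elim: k => [_ j x _|k IH km j x xK].
    by rewrite mul0r euler_op0 subrr normr0 !mulr0.
  have kh : k.+1%:R * h <= 1 by apply: le_trans mh; rewrite ler_wpM2r// ler_nat.
  have h1 : h <= 1 by apply: le_trans kh; rewrite ler_peMl// ler1n.
  pose B := (1 + Cs * h) ^+ k * (Cl * N * (h * h) * (k%:R * k%:R)).
  have B0 : 0 <= B.
    by rewrite mulr_ge0 ?exprn_ge0// ?addr_ge0// !mulr_ge0.
  have sB : supb K B (fun i y => iter k (euler_op h) f i y -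
                                 euler_op (k%:R * h) f i y).
    by move=> i y yK; apply: IH => //; exact: ltnW.
  have H1 := Hs h B _ h0 h1 Gh B0 sB j x xK.
  rewrite euler_opB in H1.
  have H2 : `|euler_op h (euler_op (k%:R * h) f) j x - euler_op (k.+1%:R * h) f j x|
      <= Cl * N * h * (k.+1%:R * h).
    have -> : k.+1%:R * h = k%:R * h + h by rewrite -natr1; ring.
    have := Hl (k%:R * h) h N f; rewrite (ger0_norm h0) (@ger0_norm _ (k%:R * h)) ?mulr_ge0//.
    apply => //.
    by apply: le_trans kh; rewrite -natr1; lra.
  rewrite iterS.
  set u := euler_op h _ j x in H1 *; set v := euler_op h (euler_op _ f) j x in H1 H2 *.
  set w := euler_op _ f j x in H2 *.
  have -> : u - w = (u - v) + (v - w) by ring.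
  apply: le_trans (ler_normD _ _) _; apply: le_trans (lerD H1 H2) _.
  rewrite /B exprS; set E := (1 + Cs * h) ^+ k.
  have E1 : 1 <= (1 + Cs * h) * E.
    by rewrite /E -exprS exprn_ege1// lerDl.
  pose M := Cl * N * (h * h).
  have M0 : 0 <= M by rewrite !mulr_ge0.
  have -> : E * (Cl * N * (h * h) * (k%:R * k%:R)) * (1 + Cs * h) +
     Cl * N * h * (k.+1%:R * h) =
     (1 + Cs * h) * E * (M * (k%:R * k%:R)) + M * k.+1%:R by rewrite /M; ring.
  rewrite -/M.
  apply: (@le_trans _ _ ((1 + Cs * h) * E * (M * (k%:R * k%:R)) +
     (1 + Cs * h) * E * (M * k.+1%:R))).
    by rewrite lerD2l ler_peMl// mulr_ge0.
  rewrite -mulrDr ler_wpM2l ?(le_trans ler01 E1)// -mulrDr ler_wpM2l//.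
  by rewrite -natr1; have := ler0n R k; lra.
move=> j x xK; apply: le_trans (step m (leqnn m) j x xK) _.
have -> : expR Cs * Cl * N * (m%:R * h) ^+ 2 =
   expR Cs * (Cl * N * (h * h) * (m%:R * m%:R)) by ring.
rewrite ler_wpM2r ?mulr_ge0//; apply: le_trans (expr_1D_le_expR m Csh) _.
by rewrite ler_expR ler_piMr.
Qed.

Lemma is_derive_quadratic (F : R -> R) (x l C : R) :
  (forall h, `|h| <= 1 -> `|F (x + h) - F x - h * l| <= C * h ^+ 2) ->
  is_derive x 1 F l.
Proof.
move=> H.
have C0 : 0 <= C.
  have := H 1; rewrite normr1 lexx => /(_ isT); rewrite expr1n mulr1.
  exact: le_trans.
have Fl : h^-1 *: (F (h *: (1 : R) + x) - F x) @[h --> 0^'] --> l.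
  apply/cvgrPdist_le => /= e e0.
  near=> h.
  have h0 : h != 0 by near: h; exact: nbhs_dnbhs_neq.
  have h1 : `|h| <= 1.
    by near: h; apply: dnbhs0_le; rewrite ?ltr01.
  have hC : `|h| <= e / (C + 1).
    by near: h; apply: dnbhs0_le; rewrite divr_gt0// ltr_wpDl.
  rewrite distrC scaler1 (addrC h x).
  have -> : h^-1 *: (F (x + h) - F x) - l = h^-1 * (F (x + h) - F x - h * l).
    by rewrite /GRing.scale/= [in RHS]mulrBr mulKf.
  rewrite normrM normfV mulrC ler_pdivrMr ?normr_gt0//.
  apply: le_trans (H h h1) _.
  rewrite -(real_normK (num_real h)) expr2 mulrA ler_wpM2r//.
  apply: le_trans (ler_wpM2l C0 hC) _.
  by rewrite mulrCA ler_piMr ?(ltW e0)// ler_pdivrMr ?ltr_wpDl// mul1r lerDl.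
apply: DeriveDef; last by apply/cvg_lim.
by apply/cvg_ex; exists l.
Unshelve. all: by end_near.
Qed.

Lemma is_derive_expmx i j : is_derive (0 : R) 1 (fun h => expmx (h *: Q) i j) (Q i j).
Proof.
have [C C0 HC] := expmx_increment Q.
apply: (@is_derive_quadratic _ _ _ C) => h h1.
have := HC 0 h i j; rewrite normr0 (add0r `|h|) => /(_ h1).
by rewrite -mulrA -expr2 real_normK ?num_real.
Qed.

Lemma is_derive_euler_op f (df : 'I_d -> R) j (x : R) :
  (forall i, is_derive x 1 (f i) (df i)) ->
  is_derive (0 : R) 1 (fun h => euler_op h f j x)
    (symbol j x * f j x + \sum_i Q i j * f i x - gamma j 0 * x * df j).
Proof.
move=> fdf.
have d1 : is_derive (0 : R) 1 (fun h => (1 - gamma j 0 * h) * x) (- (gamma j 0 * x)).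
  by apply: is_derive_eq; rewrite /GRing.scale/=; ring.
have d2 i : is_derive (0 : R) 1 (fun h => f i ((1 - gamma j 0 * h) * x))
    (df i * - (gamma j 0 * x)).
  have fi : is_derive ((1 - gamma j 0 * (0 : R)) * x) 1 (f i) (df i).
    by rewrite mulr0 subr0 mul1r.
  exact: (@is_derive1_comp _ (f i) (fun h => (1 - gamma j 0 * h) * x) 0 _ _ fi d1).
have d3 i : is_derive (0 : R) 1
    (fun h => expmx (h *: Q) i j * f i ((1 - gamma j 0 * h) * x))
    ((i == j)%:R * (df i * - (gamma j 0 * x)) + f i x * Q i j).
  have := is_deriveM (is_derive_expmx i j) (d2 i).
  by rewrite /= mulr0 subr0 mul1r (expmx0 Q i j).
have d4 : is_derive (0 : R) 1
   (fun h => \sum_i expmx (h *: Q) i j * f i ((1 - gamma j 0 * h) * x))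
   (\sum_i ((i == j)%:R * (df i * - (gamma j 0 * x)) + f i x * Q i j)).
  have := @is_derive_sum _ _ _ _ _ _ _ _ d3.
  by rewrite fct_sumE.
have d5 : is_derive (0 : R) 1 (fun h => expR (h * symbol j x)) (symbol j x).
  by apply: is_derive_eq; rewrite /GRing.scale/= mul0r expR0; ring.
have := is_deriveM d5 d4.
set l1 := (X in is_derive _ _ _ X) => D.
apply: is_derive_eq D _.
rewrite {}/l1 mul0r expR0 scale1r big_split/=.
have -> : \sum_i expmx (0 *: Q) i j * f i ((1 - gamma j 0 * 0) * x) = f j x.
  rewrite mulr0 subr0 mul1r (bigD1 j)//= (expmx0 Q j j) eqxx mul1r big1 ?addr0//.
  by move=> i /negbTE ij; rewrite (expmx0 Q i j) ij mul0r.
have -> : \sum_i (i == j)%:R * (df i * - (gamma j 0 * x)) = - (gamma j 0 * x * df j).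
  rewrite (bigD1 j)//= eqxx mul1r big1 ?addr0; first by ring.
  by move=> i /negbTE ij; rewrite ij mul0r.
have -> : \sum_i f i x * Q i j = \sum_i Q i j * f i x.
  by apply: eq_bigr => i _; rewrite mulrC.
by rewrite /GRing.scale/=; ring.
Qed.

End euler_operator.

(** * Independence and moments of Brownian increments *)

Section independent_product.
Context {disp : measure_display} {T : measurableType disp} {R : realType}.
Variable P : probability T R.

Definition indep_fun (f h : T -> R) := forall A C : set R,
  measurable A -> measurable C ->
  P (f @^-1` A `&` h @^-1` C) = (P (f @^-1` A) * P (h @^-1` C))%E.

Section mfun.
Variables (f h : {mfun T >-> R}).
Hypothesis fh : indep_fun f h.

Let fhpair (w : T) := (f w, h w).

Let measurable_fhpair : measurable_fun setT fhpair.
Proof. exact: measurable_fun_pair. Qed.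

HB.instance Definition _ := isMeasurableFun.Build _ _ _ _ fhpair measurable_fhpair.

(** Rectangles determine a finite product measure, so independence identifies the joint law with the
    product law and expectations of products become iterated integrals. *)
Lemma indep_joint (D : set (R * R)) : measurable D ->
  (distribution P f \x distribution P h)%E D = distribution P fhpair D.
Proof.
apply: product_measure_unique => A C mA mC.
by rewrite /distribution /pushforward -fh.
Qed.

Lemma indep_integral_norm :
  (\int[P]_w `|f w * h w|%:E = \int[P]_w `|f w|%:E * \int[P]_w `|h w|%:E)%E.
Proof.
pose F := fun z : R * R => (`|z.1 * z.2|)%:E.
have mF : measurable_fun setT F.
  by apply/measurable_EFinP; apply: measurableT_comp => //; exact: measurable_funM.
transitivity (\int[distribution P fhpair]_z F z)%E.
  by rewrite ge0_integral_distribution//= => z; rewrite lee_fin.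
rewrite (eq_measure_integral (distribution P f \x distribution P h)%E); last first.
  by move=> D mD _; apply/esym; exact: indep_joint.
apply: (eq_trans (fubini_tonelli1 _ _ _)) => //; first by move=> z; rewrite lee_fin.
rewrite /fubini_F /F/=.
have mnorm : measurable_fun [set: R] (fun x : R => `|x|%:E).
  by apply/measurable_EFinP; exact: normr_measurable.
have distE (k : {mfun T >-> R}) :
    (\int[distribution P k]_x `|x|%:E = \int[P]_w `|k w|%:E)%E.
  by rewrite ge0_integral_distribution.
rewrite -(distE f) -(distE h).
transitivity (\int[distribution P f]_x (`|x|%:E * \int[distribution P h]_y `|y|%:E))%E.
  apply: eq_integral => x _; rewrite -ge0_integralZl//.
  by apply: eq_integral => y _; rewrite normrM EFinM.
by rewrite ge0_integralZr// integral_ge0.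
Qed.

Hypotheses (fi : P.-integrable setT (EFin \o f)) (hi : P.-integrable setT (EFin \o h)).

Lemma indep_integrableM_mfun : P.-integrable setT (fun w => (f w * h w)%:E).
Proof.
apply/integrableP; split; first by apply/measurable_EFinP; exact: measurable_funM.
have /integrableP[_ fi'] := fi; have /integrableP[_ hi'] := hi.
under eq_integral do rewrite abse_EFin.
by rewrite indep_integral_norm lte_mul_pinfty// ?ge0_fin_numE// integral_ge0.
Qed.

Lemma indep_integralM_mfun :
  (\int[P]_w (f w * h w)%:E = \int[P]_w (f w)%:E * \int[P]_w (h w)%:E)%E.
Proof.
pose F := fun z : R * R => (z.1 * z.2)%:E.
have mF : measurable_fun setT F.
  by apply/measurable_EFinP; exact: measurable_funM.
have iF : (distribution P f \x distribution P h)%E.-integrable setT F.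
  apply/integrableP; split => //.
  rewrite (eq_measure_integral (distribution P fhpair)); last first.
    by move=> D mD _; exact: indep_joint.
  rewrite ge0_integral_distribution//; last exact: measurableT_comp.
  by have /integrableP[] := indep_integrableM_mfun.
transitivity (\int[distribution P fhpair]_z F z)%E.
  rewrite integral_distribution//.
  exact: indep_integrableM_mfun.
rewrite (eq_measure_integral (distribution P f \x distribution P h)%E); last first.
  by move=> D mD _; apply/esym; exact: indep_joint.
apply: (eq_trans (esym (integral12_prod_meas1 _))) => //; rewrite /fubini_F /F/=.
have distE (k : {mfun T >-> R}) : P.-integrable setT (EFin \o k) ->
    (distribution P k).-integrable setT EFin /\
    (\int[distribution P k]_x x%:E = \int[P]_w (k w)%:E)%E.
  move=> ki; split; first by apply: integrable_pushforward.
  by rewrite integral_distribution.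
have [fi' <-] := distE f fi; have [hi' <-] := distE h hi.
transitivity (\int[distribution P f]_x (x%:E * \int[distribution P h]_y y%:E))%E.
  apply: eq_integral => x _; rewrite -integralZl//.
have hfin : (\int[distribution P h]_x x%:E)%E \is a fin_num.
  exact: integrable_fin_num.
by rewrite -(fineK hfin) integralZr.
Qed.

End mfun.

Variables (f h : T -> R).
Hypotheses (mf : measurable_fun setT f) (mh : measurable_fun setT h).
Hypothesis fh : indep_fun f h.

Lemma indep_integral_normM :
  (\int[P]_w `|f w * h w|%:E = \int[P]_w `|f w|%:E * \int[P]_w `|h w|%:E)%E.
Proof.
pose f' : {mfun T >-> R} := HB.pack f (isMeasurableFun.Build _ _ _ _ f mf).
pose h' : {mfun T >-> R} := HB.pack h (isMeasurableFun.Build _ _ _ _ h mh).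
exact: (@indep_integral_norm f' h').
Qed.

Lemma indep_integrableM :
  P.-integrable setT (EFin \o f) -> P.-integrable setT (EFin \o h) ->
  P.-integrable setT (fun w => (f w * h w)%:E).
Proof.
pose f' : {mfun T >-> R} := HB.pack f (isMeasurableFun.Build _ _ _ _ f mf).
pose h' : {mfun T >-> R} := HB.pack h (isMeasurableFun.Build _ _ _ _ h mh).
exact: (@indep_integrableM_mfun f' h').
Qed.

Lemma indep_integralM :
  P.-integrable setT (EFin \o f) -> P.-integrable setT (EFin \o h) ->
  (\int[P]_w (f w * h w)%:E = \int[P]_w (f w)%:E * \int[P]_w (h w)%:E)%E.
Proof.
pose f' : {mfun T >-> R} := HB.pack f (isMeasurableFun.Build _ _ _ _ f mf).
pose h' : {mfun T >-> R} := HB.pack h (isMeasurableFun.Build _ _ _ _ h mh).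
exact: (@indep_integralM_mfun f' h').
Qed.

End independent_product.

(** * Differentiation of exponential moments under the integral *)

Section moment_generating_function.
Context {disp : measure_display} {T : measurableType disp} {R : realType}.
Variable mu : {measure set T -> \bar R}.
Variables (U Y : T -> R).
Hypotheses (mU : measurable_fun setT U) (mY : measurable_fun setT Y).
Hypothesis iU : forall theta : R,
  mu.-integrable setT (fun w => (U w * expR (theta * Y w))%:E).

Let measurable_exp (theta : R) : measurable_fun setT (fun w => expR (theta * Y w)).
Proof. by apply: measurableT_comp => //; exact: measurable_funM. Qed.

Let normr_le_exp (y : R) : `|y| <= expR y + expR (- y).
Proof.
have := expR_ge1Dx y; have := expR_ge1Dx (- y).
have := expR_ge0 y; have := expR_ge0 (- y).
by case: (lerP 0 y) => y0; [rewrite ger0_norm|rewrite ltr0_norm]; lra.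
Qed.

(** For [|x - theta| < 1], bounding [|y|] by exp(y) + exp(- y) shifts the parameter [x] by 1, so it
    stays within 2 of [theta]; on that range the exponential is dominated by the sum of its values
    at the end points [theta + 2] and [theta - 2]. *)
Let dominating (theta : R) w : R :=
  `|U w * expR ((theta + 2) * Y w)| + `|U w * expR ((theta - 2) * Y w)|.

Let exp_dominated (theta x y : R) : `|x - theta| < 1 ->
  `|y| * expR (x * y) <= 2 * (expR ((theta + 2) * y) + expR ((theta - 2) * y)).
Proof.
move=> xt.
apply: (@le_trans _ _ ((expR y + expR (- y)) * expR (x * y))).
  by rewrite ler_wpM2r ?expR_ge0.
rewrite mulrDl -!expRD.
have key (z : R) : `|z - theta| <= 2 ->
    expR (z * y) <= expR ((theta + 2) * y) + expR ((theta - 2) * y).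
  rewrite ler_norml => /andP[z1 z2].
  have [y0|y0] := leP 0 y.
    apply: (@le_trans _ _ (expR ((theta + 2) * y))).
      by rewrite ler_expR ler_wpM2r//; lra.
    by rewrite lerDl expR_ge0.
  apply: (@le_trans _ _ (expR ((theta - 2) * y))).
    by rewrite ler_expR ler_wnM2r ?(ltW y0)//; lra.
  by rewrite lerDr expR_ge0.
move: xt; rewrite ltr_norml => /andP[x1 x2].
have -> : y + x * y = (x + 1) * y by ring.
have -> : - y + x * y = (x - 1) * y by ring.
have k1 : `|x + 1 - theta| <= 2 by rewrite ler_norml; lra.
have k2 : `|x - 1 - theta| <= 2 by rewrite ler_norml; lra.
have := key _ k1; have := key _ k2; lra.
Qed.

Let integrable_dominating theta : mu.-integrable setT (EFin \o (fun w => 2 * dominating theta w)).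
Proof.
rewrite /comp; under eq_fun do rewrite EFinM.
apply: integrableZl => //; rewrite /dominating.
under eq_fun do rewrite EFinD.
apply: integrableD => //.
  exact: integrable_abse (iU (theta + 2)).
exact: integrable_abse (iU (theta - 2)).
Qed.

Let dominating_le (theta x : R) w : `|x - theta| < 1 ->
  `|U w * Y w * expR (x * Y w)| <= 2 * dominating theta w.
Proof.
move=> xt; rewrite -mulrA normrM (normrM (Y w)) (@ger0_norm _ (expR _)) ?expR_ge0//.
apply: (le_trans (ler_wpM2l (normr_ge0 _) (exp_dominated (Y w) xt))).
rewrite /dominating !normrM !(@ger0_norm _ (expR _)) ?expR_ge0//.
by rewrite -mulrDr mulrCA.
Qed.

Lemma integrable_mgf_derive (theta : R) :
  mu.-integrable setT (fun w => (U w * Y w * expR (theta * Y w))%:E).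
Proof.
apply: (@le_integrable _ _ _ mu _ measurableT _ (EFin \o (fun w => 2 * dominating theta w))).
- by apply/measurable_EFinP; apply: measurable_funM => //; exact: measurable_funM.
- move=> w _; rewrite /= lee_fin (@ger0_norm _ (2 * _)); last by rewrite !mulr_ge0// addr_ge0.
  by apply: dominating_le; rewrite subrr normr0.
- exact: integrable_dominating.
Qed.

(** The weight [U] makes the lemma iterable, with [U * Y] in place of [U], which gives Gaussian
    moments; with [U] an indicator and [Y] equal to - M(t) it gives the theta derivative of the
    Laplace transform. *)
Lemma is_derive_mgf (theta : R) :
  is_derive theta 1 (fun x => \int[mu]_w (U w * expR (x * Y w)))
    (\int[mu]_w (U w * Y w * expR (theta * Y w))).
Proof.
pose f x w := U w * expR (x * Y w).
have df (x : R) w : is_derive x 1 (f ^~ w) (U w * Y w * expR (x * Y w)).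
  by apply: is_derive_eq; rewrite /GRing.scale/=; ring.
have I_theta : `]theta - 1, theta + 1[%classic theta.
  by rewrite /= in_itv/=; apply/andP; split; lra.
have I_dist (x : R) : `]theta - 1, theta + 1[%classic x -> `|x - theta| < 1.
  by rewrite /= in_itv/= ltr_norml => /andP[? ?]; apply/andP; split; lra.
have p1 (x : R) w : partial1of2 f x w = U w * Y w * expR (x * Y w).
  by rewrite partial1of2E; exact: derive_val.
have i1 (x : R) : `]theta - 1, theta + 1[%classic x -> mu.-integrable setT (EFin \o f x).
  by move=> _; exact: iU.
have i2 (x : R) y : `]theta - 1, theta + 1[%classic x -> [set: T] y -> derivable (f ^~ y) x 1.
  by move=> _ _; apply: ex_derive.
have dom0 y : 0 <= 2 * dominating theta y by rewrite mulr_ge0// addr_ge0.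
have i3 (x : R) y : `]theta - 1, theta + 1[%classic x -> [set: T] y ->
    `|partial1of2 f x y| <= 2 * dominating theta y.
  by move=> /I_dist xt _; rewrite p1; exact: dominating_le.
have D1 := @derivable_under_integral _ _ _ mu f setT measurableT theta
  (theta - 1) (theta + 1) I_theta i1 i2 _ dom0 (integrable_dominating theta) i3.
have D2 := @differentiation_under_integral _ _ _ mu f setT measurableT theta
  (theta - 1) (theta + 1) I_theta i1 i2 _ dom0 (integrable_dominating theta) i3.
apply: DeriveDef => //.
rewrite -derive1E D2; apply: eq_Rintegral => w _; exact: p1.
Qed.

End moment_generating_function.

(** * The Gaussian Laplace transform *)

Section normal_moments.
Context {R : realType}.
Implicit Types (s lam : R).

(** Change of variables goes through the Radon-Nikodym derivative, which agrees almost everywhere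
    with [normal_pdf] as both have the same integral over every measurable set. *)
Lemma ge0_integral_normal_prob (m s : R) (f : R -> \bar R) :
  (forall x, 0 <= f x)%E -> measurable_fun setT f ->
  (\int[normal_prob m s]_x f x =
   \int[lebesgue_measure]_x (f x * (normal_pdf m s x)%:E))%E.
Proof.
move=> f0 mf.
have nd := normal_prob_dominates m s.
have mpdf : measurable_fun [set: R] (EFin \o normal_pdf m s).
  by apply/measurable_EFinP; exact: measurable_normal_pdf.
rewrite -(Radon_Nikodym_SigmaFinite.change_of_variables nd)//.
apply: ae_eq_integral => //.
- apply: emeasurable_funM => //.
  exact: measurable_int (Radon_Nikodym_SigmaFinite.f_integrable nd).
- exact: emeasurable_funM.
- apply: (@filterS2 _ _ _ _ _ _ _ (aeW _ (fun x => I))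
    (_ : {ae lebesgue_measure, forall x, setT x ->
      Radon_Nikodym_SigmaFinite.f (normal_prob m s) lebesgue_measure x =
        (normal_pdf m s x)%:E})).
    by move=> x _ + _ => ->.
  apply: integral_ae_eq => //.
  + exact: Radon_Nikodym_SigmaFinite.f_integrable.
  + by move=> E _ mE; rewrite -Radon_Nikodym_SigmaFinite.f_integral.
Qed.

Lemma normal_mgf s lam : s != 0 ->
  (\int[normal_prob 0 s]_x (expR (lam * x))%:E =
   (expR (2^-1 * lam ^+ 2 * s ^+ 2))%:E)%E.
Proof.
move=> s0.
have ms : measurable_fun setT (fun x : R => (expR (lam * x))%:E).
  by apply/measurable_EFinP; apply: measurableT_comp => //; exact: measurable_funM.
rewrite ge0_integral_normal_prob//.
(* Completing the square: the exponential weight turns the centred density into the density with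
   mean [lam * s ^+ 2], up to a constant factor. *)
transitivity (\int[lebesgue_measure]_x ((expR (2^-1 * lam ^+ 2 * s ^+ 2))%:E *
    (normal_pdf (lam * s ^+ 2) s x)%:E))%E.
  apply: eq_integral => x _; rewrite -!EFinM; congr EFin.
  rewrite !normal_pdfE// mulrCA [RHS]mulrCA; congr (_ * _).
  rewrite /normal_fun -!expRD; congr expR; field.
  by rewrite s0.
rewrite ge0_integralZl//.
- by rewrite integral_normal_pdf mule1.
- by apply/measurable_EFinP; exact: measurable_normal_pdf.
- by move=> x _; rewrite lee_fin normal_pdf_ge0.
Qed.

End normal_moments.

(** * Independence of Brownian increments from the chain and the Brownian past *)

Section enlarged_filtration.
Context {disp : measure_display} {T : measurableType disp} {R : realType}.
Variables (P : probability T R) (d : nat) (X : R -> T -> 'I_d) (B : R -> T -> R).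
Hypothesis mX : forall t i, 0 <= t -> measurable (X t @^-1` [set i]).
Hypothesis bmB : is_brownian_motion P B.
Hypothesis indepXB : independent P (sigma_process setT `[0, +oo[ X)
                                   (sigma_process measurable `[0, +oo[ B).

Definition chain_gen : set (set T) := sigma_process setT `[0, +oo[ X.
Definition enlarged_gen (s : R) : set (set T) :=
  chain_gen `|` sigma_process measurable `[0, s] B.

(* The increments of [B] after time [s] are independent of this enlarged sigma-algebra,
   which contains the whole chain and so makes the right-end coefficients of the Euler
   scheme adapted. *)
Definition enlarged_measurable (s : R) (f : T -> R) :=
  @measurable_fun _ _ (g_sigma_algebraType (enlarged_gen s)) R setT f.

Let mB t : 0 <= t -> measurable_fun setT (B t).
Proof. by case: bmB => + _ _ _ _ => /(_ t). Qed.

Lemma measurable_chain t (A : set 'I_d) : 0 <= t -> measurable (X t @^-1` A).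
Proof.
move=> t0.
have -> : X t @^-1` A = \bigcup_(i in A) (X t @^-1` [set i]).
  by apply/seteqP; split => [w Aw|w [i /= iA ->//]]; exists (X t w).
by apply: fin_bigcup_measurable => [|i _]; [exact: finite_finset|exact: mX].
Qed.

Lemma chain_gen_measurable : chain_gen `<=` measurable.
Proof.
apply: smallest_sub; first exact: sigma_algebra_measurable.
move=> _ [s /= s0 [A _ <-]]; rewrite setTI; apply: measurable_chain.
by move: s0; rewrite in_itv/= andbT.
Qed.

Lemma sigma_process_sub {S : Type} (E : set (set S)) (I J : set R) (Y : R -> T -> S) :
  I `<=` J -> sigma_process E I Y `<=` sigma_process E J Y.
Proof.
by move=> IJ; apply: sub_sigma_algebra2; exact: bigcup_subset.
Qed.

Lemma sigma_brownian_measurable : sigma_process measurable `[0, +oo[ B `<=` measurable.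
Proof.
apply: smallest_sub; first exact: sigma_algebra_measurable.
move=> _ [s /= s0 [A mA <-]]; apply: mB => //.
by move: s0; rewrite in_itv/= andbT.
Qed.

Let sub_itv (s : R) : `[0, s]%classic `<=` `[0, +oo[%classic.
Proof. by move=> r /=; rewrite !in_itv/= => /andP[->]. Qed.

Lemma enlarged_gen_sub s : <<s enlarged_gen s >> `<=` measurable.
Proof.
apply: smallest_sub; first exact: sigma_algebra_measurable.
rewrite /enlarged_gen subUset; split; first exact: chain_gen_measurable.
apply: subset_trans sigma_brownian_measurable.
exact: sigma_process_sub (@sub_itv s).
Qed.

Lemma enlarged_measurableP s f : enlarged_measurable s f <->
  forall A : set R, measurable A -> <<s enlarged_gen s >> (f @^-1` A).
Proof.
split=> [mf A mA|mf _ A mA]; last by rewrite setTI; exact: mf.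
by have := mf measurableT A mA; rewrite setTI.
Qed.

Lemma enlarged_measurable_fun s f : enlarged_measurable s f -> measurable_fun setT f.
Proof.
move=> /enlarged_measurableP mf _ A mA; rewrite setTI.
by apply: (@enlarged_gen_sub s); exact: mf.
Qed.

Lemma enlarged_measurableS s t f : s <= t ->
  enlarged_measurable s f -> enlarged_measurable t f.
Proof.
move=> st /enlarged_measurableP mf; apply/enlarged_measurableP => A mA.
apply: sub_sigma_algebra2 (mf A mA); apply: setUS; apply: sigma_process_sub.
by move=> r /=; rewrite !in_itv/= => /andP[->/= /le_trans]; exact.
Qed.

Lemma enlarged_measurable_chain s t (phi : 'I_d -> R) : 0 <= t ->
  enlarged_measurable s (fun w => phi (X t w)).
Proof.
move=> t0; apply/enlarged_measurableP => A mA; apply: sub_sigma_algebra; left.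
apply: sub_sigma_algebra; exists t; first by rewrite /= in_itv/= t0.
by exists (phi @^-1` A) => //; rewrite setTI.
Qed.

Lemma enlarged_measurable_brownian s t : 0 <= t -> t <= s ->
  enlarged_measurable s (B t).
Proof.
move=> t0 ts; apply/enlarged_measurableP => A mA; apply: sub_sigma_algebra; right.
apply: sub_sigma_algebra; exists t; first by rewrite /= in_itv/= t0.
by exists A => //; rewrite setTI.
Qed.

(** The simple processes in [is_ito_integral] are adapted to the smaller joint filtration; this
    places them beside the Euler coefficients, so that differences of the two can be treated at
    once. *)
Lemma enlarged_measurable_joint s f : measurable_wrt (joint_filtration X B s) f ->
  enlarged_measurable s f.
Proof.
move=> mf; apply/enlarged_measurableP => A mA.
have : joint_filtration X B s (f @^-1` A).
  by apply: mf; exists A => //; rewrite setTI.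
apply: sub_sigma_algebra2; apply: setSU; exact: sigma_process_sub (@sub_itv s).
Qed.

Lemma enlarged_measurableM s f h : enlarged_measurable s f ->
  enlarged_measurable s h -> enlarged_measurable s (fun w => f w * h w).
Proof. exact: measurable_funM. Qed.

Lemma enlarged_measurableD s f h : enlarged_measurable s f ->
  enlarged_measurable s h -> enlarged_measurable s (fun w => f w + h w).
Proof. exact: measurable_funD. Qed.

Lemma enlarged_measurableB s f h : enlarged_measurable s f ->
  enlarged_measurable s h -> enlarged_measurable s (fun w => f w - h w).
Proof. exact: measurable_funB. Qed.

(** Events A1 of the chain and A2 of the Brownian past give a generating family stable under
    intersection. On it, independence of [X] and [B] splits off A1 from both A2 and its intersection
    with the increment event D, and the independence of Brownian increments splits A2 from D.
    Uniqueness of measures extends the product formula. *)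
Lemma indep_increment (s t : R) f : 0 <= s -> s < t -> enlarged_measurable s f ->
  indep_fun P f (fun w => B t w - B s w).
Proof.
move=> s0 st /enlarged_measurableP mf A C mA mC.
have t0 : 0 <= t by rewrite (le_trans s0)// ltW.
set D := (fun w => B t w - B s w) @^-1` C.
pose sB (I : set R) := sigma_process measurable I B.
have BsD : sB `[0, +oo[%classic D.
  pose U := g_sigma_algebraType (\bigcup_(s in `[0, +oo[%classic)
    preimage_set_system setT (B s) measurable).
  have mBU r : 0 <= r -> @measurable_fun _ _ U R setT (B r).
    move=> r0 _ V mV; apply: sub_sigma_algebra; exists r => //=.
      by rewrite in_itv/= r0.
    by exists V.
  have mBB : @measurable_fun _ _ U R setT (fun w => B t w - B s w).
    by apply: measurable_funB; exact: mBU.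
  by have := mBB measurableT C mC; rewrite setTI.
have mD : measurable D by exact: sigma_brownian_measurable.
(* The two measures to be identified are [P] restricted to [D] and [P] multiplied by the constant
   [P D]. *)
pose m2 := mscale (NngNum (fine_ge0 (measure_ge0 P D))) P.
have m2E E : m2 E = (P D * P E)%E by rewrite /m2 /mscale/= fineK// fin_num_measure.
pose G := [set E | exists A1 A2, [/\ chain_gen A1, sB `[0, s]%classic A2 & E = A1 `&` A2]].
have sBs : sB `[0, s]%classic `<=` sB `[0, +oo[%classic.
  exact: sigma_process_sub (@sub_itv s).
have GE : enlarged_gen s `<=` G.
  move=> E [XE|BE].
    exists E, setT; split; rewrite ?setIT//.
    exact: (@measurableT _ (g_sigma_algebraType _)).
  exists setT, E; split; rewrite ?setTI//.
  exact: (@measurableT _ (g_sigma_algebraType _)).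
have Gm : G `<=` measurable.
  move=> _ [A1 [A2 [mA1 mA2 ->]]]; apply: measurableI.
    exact: chain_gen_measurable.
  by apply: sigma_brownian_measurable; exact: sBs.
suff : mrestr P mD (f @^-1` A) = m2 (f @^-1` A).
  by rewrite m2E muleC.
apply: (g_sigma_algebra_measure_unique G Gm (fun=> setT)).
- move=> _; exists setT, setT; split; rewrite ?setTI//.
    exact: (@measurableT _ (g_sigma_algebraType _)).
  exact: (@measurableT _ (g_sigma_algebraType _)).
- by rewrite bigcup_const//; exists 0%N.
- move=> _ _ [A1 [A2 [a1 a2 ->]]] [C1 [C2 [c1 c2 ->]]].
  exists (A1 `&` C1), (A2 `&` C2); split.
  + exact: (@measurableI _ (g_sigma_algebraType _)).
  + exact: (@measurableI _ (g_sigma_algebraType _)).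
  + by rewrite setIACA.
- move=> _ [A1 [A2 [a1 a2 ->]]].
  rewrite -[RHS]/(m2 _) m2E -[LHS]/(P (_ `&` D)) -setIA.
  rewrite indepXB//; last first.
    by apply: (@measurableI _ (g_sigma_algebraType _)) => //; exact: sBs.
  rewrite (indepXB a1 (sBs _ a2)).
  case: bmB => _ _ _ _ /(_ s t s0 st) Bind.
  have DC : preimage_set_system setT (fun w => B t w - B s w) measurable D.
    by exists C => //; rewrite setTI.
  by rewrite (Bind A2 D a2 DC) [RHS]muleC muleA.
- by move=> k; rewrite -[X in (X < _)%E]/(P (_ `&` D)) setTI ltey_eq fin_num_measure.
- exact: sub_sigma_algebra2 GE _ (mf A mA).
Qed.

End enlarged_filtration.

Section brownian_increments.
Context {disp : measure_display} {T : measurableType disp} {R : realType}.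
Variables (P : probability T R) (B : R -> T -> R).
Hypothesis bmB : is_brownian_motion P B.
Implicit Types s t lam : R.

Let mB t : 0 <= t -> measurable_fun setT (B t).
Proof. by case: bmB => + _ _ _ _ => /(_ t). Qed.

Lemma measurable_increment s t : 0 <= s -> s <= t ->
  measurable_fun setT (fun w => B t w - B s w).
Proof.
by move=> s0 st; apply: measurable_funB; apply: mB => //; exact: le_trans st.
Qed.

Lemma increment_mgf s t lam : 0 <= s -> s <= t ->
  (\int[P]_w (expR (lam * (B t w - B s w)))%:E =
   (expR (2^-1 * lam ^+ 2 * (t - s)))%:E)%E.
Proof.
move=> s0; rewrite le_eqVlt => /predU1P[<-|st].
  under eq_integral do rewrite subrr mulr0.
  rewrite integral_cst// [X in (_ * X)%E](_ : _ = 1%E); last exact: probability_setT.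
  by rewrite mule1 subrr mulr0.
have mY := measurable_increment s0 (ltW st).
have [Y YE] : exists Y : {mfun T >-> measurableTypeR R},
    Y = (fun w => B t w - B s w) :> (T -> R).
  have mY' : @measurable_fun _ _ T (measurableTypeR R) setT (fun w => B t w - B s w).
    exact: mY.
  pose Z : {mfun T >-> measurableTypeR R} :=
    HB.pack (fun w => B t w - B s w : measurableTypeR R)
      (isMeasurableFun.Build _ _ _ _ _ mY').
  by exists Z.
have mexp : measurable_fun setT (fun x : measurableTypeR R => (expR (lam * x))%:E).
  by apply/measurable_EFinP; apply: measurableT_comp => //; exact: measurable_funM.
have exp0 (x : R) : (0 <= (expR (lam * x))%:E)%E by rewrite lee_fin expR_ge0.
have := @ge0_integral_distribution _ _ _ _ _ P Y _ mexp exp0.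
rewrite /comp/= YE => <-.
transitivity (\int[normal_prob 0 (Num.sqrt (t - s))]_y (expR (lam * y))%:E)%E.
  apply: eq_measure_integral => A mA _.
  by case: bmB => _ _ _ /(_ s t s0 st A mA) + _; rewrite -YE.
have ts : 0 < t - s by rewrite subr_gt0.
by rewrite normal_mgf ?gt_eqF ?sqrtr_gt0// sqr_sqrtr// ltW.
Qed.

Lemma integrable_increment_exp s t lam : 0 <= s -> s <= t ->
  P.-integrable setT (fun w => (expR (lam * (B t w - B s w)))%:E).
Proof.
move=> s0 st; apply/integrableP; split.
  apply/measurable_EFinP; apply: measurableT_comp => //.
  by apply: measurable_funM => //; exact: measurable_increment.
under eq_integral do rewrite gee0_abs ?lee_fin ?expR_ge0//.
by rewrite increment_mgf// ltry.
Qed.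

(** Two differentiations at 0 of the known exponential moment; [integrable_mgf_derive] gives
    integrability at each order. *)
Lemma increment_moments s t : 0 <= s -> s <= t ->
  [/\ P.-integrable setT (fun w => (B t w - B s w)%:E),
      P.-integrable setT (fun w => ((B t w - B s w) ^+ 2)%:E),
      \int[P]_w (B t w - B s w) = 0 &
      \int[P]_w ((B t w - B s w) ^+ 2) = t - s].
Proof.
move=> s0 st; set Y := fun w => B t w - B s w.
have mY : measurable_fun setT Y by exact: measurable_increment.
have m1 : measurable_fun [set: T] (fun=> 1 : R) by [].
have i0 theta : P.-integrable setT (fun w => (1 * expR (theta * Y w))%:E).
  by under eq_fun do rewrite mul1r; exact: integrable_increment_exp.
have i1 := integrable_mgf_derive m1 mY i0.
have m1Y : measurable_fun setT (fun w => 1 * Y w) by exact: measurable_funM.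
have i2 := integrable_mgf_derive m1Y mY i1.
have F0 : (fun x : R => \int[P]_w (1 * expR (x * Y w))) =
    (fun x => expR (2^-1 * x ^+ 2 * (t - s))).
  apply/funext => x; rewrite /Rintegral; under eq_integral do rewrite mul1r.
  by rewrite increment_mgf.
have D0 (theta : R) := is_derive_mgf i0 theta.
have F1 : (fun x : R => \int[P]_w (1 * Y w * expR (x * Y w))) =
    (fun x => x * (t - s) * expR (2^-1 * x ^+ 2 * (t - s))).
  apply/funext => x; have [_ <-] := D0 x; rewrite F0; apply: derive_val.
  apply: is_derive_eq; rewrite /GRing.scale/=.
  by field.
have := is_derive_mgf i1 0; rewrite F1 => D1.
split.
- by have := i1 0; under eq_fun do rewrite mul0r expR0 mulr1 mul1r.
- by have := i2 0; under eq_fun do rewrite mul0r expR0 mulr1 mul1r -expr2.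
- have /(congr1 (fun f => f 0)) := F1; rewrite !mul0r.
  by under eq_Rintegral do rewrite mul0r expR0 mulr1 mul1r.
- have [_] := D1.
  under eq_Rintegral do rewrite mul0r expR0 mulr1 mul1r -expr2.
  have D2 (x : R) : is_derive x 1 (fun x => x * (t - s) * expR (2^-1 * x ^+ 2 * (t - s)))
      ((t - s) * expR (2^-1 * x ^+ 2 * (t - s)) * (1 + x ^+ 2 * (t - s))).
    by apply: is_derive_eq; rewrite /GRing.scale/=; field.
  by have [_ ->] := D2 0; rewrite expr0n/= !(mulr0, mul0r) expR0 => <-; ring.
Qed.

End brownian_increments.

(** * The Ito integral of step processes *)

Section integrability_complements.
Context {disp : measure_display} {T : measurableType disp} {R : realType}.
Variable mu : {measure set T -> \bar R}.

Lemma Rintegral_sum (I : finType) (D : set T) (f : I -> T -> R) : measurable D ->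
  (forall i, mu.-integrable D (EFin \o f i)) ->
  mu.-integrable D (fun w => (\sum_i f i w)%:E) /\
  \int[mu]_(w in D) (\sum_i f i w) = \sum_i \int[mu]_(w in D) f i w.
Proof.
move=> mD fi.
have E w : (\sum_i f i w)%:E = (\sum_i (f i w)%:E)%E by rewrite sumEFin.
have S : mu.-integrable D (fun w => (\sum_i f i w)%:E).
  under eq_fun do rewrite E.
  by apply: integrable_sum => // i _; exact: fi.
split=> //; rewrite /Rintegral; under eq_integral do rewrite E.
rewrite integral_sum//.
rewrite (eq_bigr (fun i => (\int[mu]_(w in D) f i w)%:E)) ?sumEFin// => i _.
by rewrite /Rintegral fineK//; apply: integrable_fin_num => //; exact: fi.
Qed.

Lemma integrable_bounded_mul (a f : T -> R) (c : R) :
  measurable_fun setT a -> (forall w, `|a w| <= c) ->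
  mu.-integrable setT (EFin \o f) -> mu.-integrable setT (fun w => (a w * f w)%:E).
Proof.
move=> ma ac fi.
have [/measurable_EFinP mf _] := integrableP _ _ _ fi.
apply: (@le_integrable _ _ _ mu _ measurableT _ (fun w => (c * f w)%:E)).
- by apply/measurable_EFinP; exact: measurable_funM.
- move=> w _; rewrite /= lee_fin !normrM ler_wpM2r//.
  by apply: le_trans (ac w) _; exact: ler_norm.
- by under eq_fun do rewrite EFinM; exact: integrableZl.
Qed.

End integrability_complements.

(** * Isometry for sums over possibly overlapping intervals *)

Section ito_isometry.
Context {disp : measure_display} {T : measurableType disp} {R : realType}.
Variables (P : probability T R) (d : nat) (X : R -> T -> 'I_d) (B : R -> T -> R).
Hypothesis mX : forall (t : R) i, 0 <= t -> measurable (X t @^-1` [set i]).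
Hypothesis bmB : is_brownian_motion P B.
Hypothesis indepXB : independent P (sigma_process setT `[0, +oo[ X)
                                   (sigma_process measurable `[0, +oo[ B).

Implicit Types (u v s t : R) (a xi f : T -> R).

Local Notation adapted := (enlarged_measurable X B).
Local Notation integrable f := (P.-integrable setT (EFin \o f)).
Let inc u v w := B v w - B u w.
Let bounded a := exists c : R, forall w, `|a w| <= c.

Let adaptedW s f : adapted s f -> measurable_fun setT f.
Proof. by move=> fs; apply: (@enlarged_measurable_fun _ _ _ P _ X B mX bmB s). Qed.

Let adapted_inc s u v : 0 <= u -> u <= v -> v <= s -> adapted s (inc u v).
Proof.
move=> u0 uv vs; apply: enlarged_measurableB; apply: enlarged_measurable_brownian => //.
- exact: le_trans uv.
- exact: le_trans vs.
Qed.

Let boundedM a1 a2 : bounded a1 -> bounded a2 -> bounded (fun w => a1 w * a2 w).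
Proof.
move=> [c1 h1] [c2 h2]; exists (c1 * c2) => w; rewrite normrM ler_pM//.
Qed.

Let integrable_bounded s a : adapted s a -> bounded a -> integrable a.
Proof.
move=> sa [c ac].
have i1 : integrable (fun=> 1 : R) by apply: finite_measure_integrable_cst.
have := integrable_bounded_mul (adaptedW sa) ac i1.
by under eq_fun do rewrite mulr1.
Qed.

Let integrable_bounded_inc s a u v : adapted s a -> bounded a -> 0 <= u -> u <= v ->
  integrable (fun w => a w * inc u v w).
Proof.
move=> sa [c ac] u0 uv; have [i1 _ _ _] := increment_moments bmB u0 uv.
exact: integrable_bounded_mul (adaptedW sa) ac i1.
Qed.

Let indep_Rintegral xi f : measurable_fun setT xi -> measurable_fun setT f ->
  indep_fun P xi f -> integrable xi -> integrable f ->
  integrable (fun w => xi w * f w) /\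
  \int[P]_w (xi w * f w) = (\int[P]_w xi w) * (\int[P]_w f w).
Proof.
move=> mxi mf xif ixi i_f; split; first exact: indep_integrableM.
rewrite /Rintegral indep_integralM// fineM//; exact: integrable_fin_num.
Qed.

(** The case [u = v] is separate because the definition of Brownian motion gives the law and the
    independence of increments for [s < t] only. *)
Lemma adapted_increment u v xi : 0 <= u -> u <= v -> adapted u xi -> integrable xi ->
  integrable (fun w => xi w * inc u v w) /\ \int[P]_w (xi w * inc u v w) = 0.
Proof.
move=> u0; rewrite le_eqVlt => /predU1P[<-|uv] uxi ixi.
  have inc0 w : xi w * inc u u w = 0 by rewrite /inc subrr mulr0.
  split; first by rewrite /comp; under eq_fun do rewrite inc0; exact: integrable0.
  by under eq_Rintegral do rewrite inc0; rewrite Rintegral_cst// mul0r.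
have [i1 _ E1 _] := increment_moments bmB u0 (ltW uv).
have mi := measurable_increment bmB u0 (ltW uv).
have [iM ->] := indep_Rintegral (adaptedW uxi) mi
  (indep_increment mX bmB indepXB u0 uv uxi) ixi i1.
by rewrite E1 mulr0.
Qed.

Lemma adapted_increment_sqr u v xi : 0 <= u -> u <= v -> adapted u xi -> integrable xi ->
  integrable (fun w => xi w * inc u v w ^+ 2) /\
  \int[P]_w (xi w * inc u v w ^+ 2) = (\int[P]_w xi w) * (v - u).
Proof.
move=> u0; rewrite le_eqVlt => /predU1P[<-|uv] uxi ixi.
  have inc0 w : xi w * inc u u w ^+ 2 = 0 by rewrite /inc subrr expr0n/= mulr0.
  split; first by rewrite /comp; under eq_fun do rewrite inc0; exact: integrable0.
  by under eq_Rintegral do rewrite inc0; rewrite Rintegral_cst// mul0r subrr mulr0.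
have [_ i2 _ E2] := increment_moments bmB u0 (ltW uv).
have mi := measurable_increment bmB u0 (ltW uv).
have mi2 : measurable_fun setT (fun w => inc u v w ^+ 2) by exact: measurable_funX.
have ind : indep_fun P xi (fun w => inc u v w ^+ 2).
  move=> A C mA mC; apply: (indep_increment mX bmB indepXB u0 uv uxi mA
    (C := (fun x => x ^+ 2) @^-1` C)).
  rewrite -[X in measurable X]setTI; apply: measurable_funX => //; exact: measurable_id.
by have [iM ->] := indep_Rintegral (adaptedW uxi) mi2 ind ixi i2; rewrite E2.
Qed.

(** This is the conditioning on the last Euler step: [xi] may involve the chain at times after [u],
    in particular its state at the right end of the step. *)
Lemma adapted_increment_exp u v (lam : R) xi : 0 <= u -> u <= v -> adapted u xi ->
  integrable xi ->
  integrable (fun w => xi w * expR (lam * inc u v w)) /\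
  \int[P]_w (xi w * expR (lam * inc u v w)) =
    (\int[P]_w xi w) * expR (2^-1 * lam ^+ 2 * (v - u)).
Proof.
move=> u0; rewrite le_eqVlt => /predU1P[<-|uv] uxi ixi.
  have inc0 w : xi w * expR (lam * inc u u w) = xi w.
    by rewrite /inc subrr mulr0 expR0 mulr1.
  rewrite subrr mulr0 expR0 mulr1.
  split; first by rewrite /comp; under eq_fun do rewrite inc0.
  by under eq_Rintegral do rewrite inc0.
have mi := measurable_increment bmB u0 (ltW uv).
have mexp : measurable_fun setT (fun x : R => expR (lam * x)).
  by apply: measurableT_comp => //; exact: measurable_funM.
have mi2 : measurable_fun setT (fun w => expR (lam * inc u v w)).
  exact: (measurableT_comp mexp mi).
have ind : indep_fun P xi (fun w => expR (lam * inc u v w)).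
  move=> A C mA mC; apply: (indep_increment mX bmB indepXB u0 uv uxi mA
    (C := (fun x => expR (lam * x)) @^-1` C)).
  by rewrite -[X in measurable X]setTI; exact: mexp.
have ie := integrable_increment_exp bmB lam u0 (ltW uv).
have [iM ->] := indep_Rintegral (adaptedW uxi) mi2 ind ixi ie.
by split=> //; rewrite [X in _ * X]/Rintegral increment_mgf// ltW.
Qed.

(** The length of the intersection of ]u1, v1] and ]u2, v2]. *)
Definition overlap u1 v1 u2 v2 : R :=
  Num.max 0 (Num.min v1 v2 - Num.max u1 u2).

(** The increments are cut at [u2] and at the smaller right end. Only the square of the common piece
    has a nonzero mean; in every other product, one factor is an increment independent of all that
    multiplies it. *)
Let increment_cov_le a1 a2 u1 v1 u2 v2 : 0 <= u1 -> u1 <= v1 -> u2 <= v2 -> u1 <= u2 ->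
  adapted u1 a1 -> adapted u2 a2 -> bounded a1 -> bounded a2 ->
  integrable (fun w => (a1 w * inc u1 v1 w) * (a2 w * inc u2 v2 w)) /\
  \int[P]_w ((a1 w * inc u1 v1 w) * (a2 w * inc u2 v2 w)) =
    (\int[P]_w (a1 w * a2 w)) * overlap u1 v1 u2 v2.
Proof.
move=> u10 uv1 uv2 u12 A1 A2 b1 b2.
have u20 : 0 <= u2 by exact: le_trans u12.
have A1' : adapted u2 a1 by exact: enlarged_measurableS u12 A1.
have A12 : adapted u2 (fun w => a1 w * a2 w) by exact: enlarged_measurableM.
have b12 := boundedM b1 b2.
have [vu|uv] := leP v1 u2.
  have E w : a1 w * inc u1 v1 w * (a2 w * inc u2 v2 w) =
     (a1 w * a2 w * inc u1 v1 w) * inc u2 v2 w by ring.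
  have -> : overlap u1 v1 u2 v2 = 0.
    rewrite /overlap (max_idPr u12); apply/max_idPl.
    by rewrite subr_le0 ge_min vu.
  rewrite mulr0 /comp; under eq_fun do rewrite E.
  under eq_Rintegral do rewrite E.
  apply: adapted_increment => //.
    by apply: enlarged_measurableM => //; exact: adapted_inc.
  exact: integrable_bounded_inc A12 b12 u10 uv1.
pose w0 := Num.min v1 v2.
have uw : u2 <= w0 by rewrite le_min (ltW uv) uv2.
have w00 : 0 <= w0 by exact: le_trans uw.
have wv1 : w0 <= v1 by rewrite ge_min lexx.
have wv2 : w0 <= v2 by rewrite ge_min lexx orbT.
(* Beyond the common piece at most one of the two intervals is left. *)
have xy w : inc w0 v1 w * inc w0 v2 w = 0.
  rewrite /inc /w0; case: (leP v1 v2) => _; first by rewrite subrr mul0r.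
  by rewrite subrr mulr0.
have E w : a1 w * inc u1 v1 w * (a2 w * inc u2 v2 w) =
  (a1 w * a2 w * inc u1 u2 w) * inc u2 v2 w + (a1 w * a2 w) * inc u2 w0 w ^+ 2
  + (a1 w * a2 w * inc u2 w0 w) * inc w0 v1 w +
  (a1 w * a2 w * inc u2 w0 w) * inc w0 v2 w.
  have -> : inc u1 v1 w = inc u1 u2 w + inc u2 w0 w + inc w0 v1 w by rewrite /inc; ring.
  have -> : inc u2 v2 w = inc u2 w0 w + inc w0 v2 w by rewrite /inc; ring.
  apply/eqP; rewrite -subr_eq0; apply/eqP.
  transitivity (a1 w * a2 w * (inc w0 v1 w * inc w0 v2 w)); first by ring.
  by rewrite xy mulr0.
have A12w : adapted w0 (fun w => a1 w * a2 w) by exact: enlarged_measurableS uw A12.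
have [i1 E1] : integrable (fun w => (a1 w * a2 w * inc u1 u2 w) * inc u2 v2 w) /\
    \int[P]_w ((a1 w * a2 w * inc u1 u2 w) * inc u2 v2 w) = 0.
  apply: adapted_increment => //.
    by apply: enlarged_measurableM => //; exact: adapted_inc.
  exact: integrable_bounded_inc A12 b12 u10 u12.
have [i2 E2] := adapted_increment_sqr u20 uw A12 (integrable_bounded A12 b12).
have key v : w0 <= v -> integrable (fun w => (a1 w * a2 w * inc u2 w0 w) * inc w0 v w) /\
    \int[P]_w ((a1 w * a2 w * inc u2 w0 w) * inc w0 v w) = 0.
  move=> wv; apply: adapted_increment => //.
    by apply: enlarged_measurableM => //; exact: adapted_inc.
  exact: integrable_bounded_inc A12 b12 u20 uw.
have [i3 E3] := key v1 wv1; have [i4 E4] := key v2 wv2.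
have i12 := integrableD measurableT i1 i2.
have i123 := integrableD measurableT i12 i3.
split.
  rewrite /comp; under eq_fun do rewrite E !EFinD.
  exact: integrableD.
under eq_Rintegral do rewrite E.
rewrite RintegralD// RintegralD// RintegralD// E1 E2 E3 E4 add0r !addr0.
congr (_ * _); rewrite /overlap (max_idPr u12) (max_idPr _)// subr_ge0//.
Qed.

Lemma overlapC u1 v1 u2 v2 : overlap u1 v1 u2 v2 = overlap u2 v2 u1 v1.
Proof. by rewrite /overlap minC [Num.max u1 _]maxC. Qed.

Lemma increment_cov a1 a2 u1 v1 u2 v2 : 0 <= u1 -> 0 <= u2 -> u1 <= v1 -> u2 <= v2 ->
  adapted u1 a1 -> adapted u2 a2 -> bounded a1 -> bounded a2 ->
  integrable (fun w => (a1 w * inc u1 v1 w) * (a2 w * inc u2 v2 w)) /\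
  \int[P]_w ((a1 w * inc u1 v1 w) * (a2 w * inc u2 v2 w)) =
    (\int[P]_w (a1 w * a2 w)) * overlap u1 v1 u2 v2.
Proof.
move=> u10 u20 uv1 uv2 A1 A2 b1 b2.
have [u12|u21] := leP u1 u2; first exact: increment_cov_le.
have := increment_cov_le u20 uv2 uv1 (ltW u21) A2 A1 b2 b1.
have E w : a2 w * inc u2 v2 w * (a1 w * inc u1 v1 w) =
  a1 w * inc u1 v1 w * (a2 w * inc u2 v2 w) by rewrite mulrC.
rewrite /comp; under eq_fun do rewrite E.
under eq_Rintegral do rewrite E.
by under [in X in _ = X * _]eq_Rintegral do rewrite mulrC; rewrite overlapC.
Qed.

Lemma sqr_sum_pair (I : finType) (x : I -> R) :
  (\sum_i x i) ^+ 2 = \sum_(p : I * I) x p.1 * x p.2.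
Proof. by rewrite expr2 big_distrlr/= pair_big. Qed.

Lemma integral_indic_overlap (u1 v1 u2 v2 t : R) :
  0 <= u1 -> v1 <= t ->
  lebesgue_measure.-integrable `[0, t] (fun s =>
    (\1_(`]u1, v1]%classic) s * \1_(`]u2, v2]%classic) s : R)%:E) /\
  \int[lebesgue_measure]_(s in `[0, t])
    (\1_(`]u1, v1]%classic) s * \1_(`]u2, v2]%classic) s : R) = overlap u1 v1 u2 v2.
Proof.
move=> u10 v1t.
have E (s : R) : \1_(`]u1, v1]%classic) s * \1_(`]u2, v2]%classic) s =
    \1_(`](Num.max u1 u2), (Num.min v1 v2)]%classic) s :> R.
  rewrite -[LHS]/((\1_(`]u1, v1]%classic) \* \1_(`]u2, v2]%classic)) s) -indicI.
  congr (\1_ _ _); apply/seteqP; split => r /=.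
    by rewrite !in_itv/= gt_max le_min => -[/andP[-> ->] /andP[-> ->]].
  by rewrite !in_itv/= gt_max le_min => /andP[/andP[-> ->] /andP[-> ->]].
have E' : (fun s : R => \1_(`]u1, v1]%classic) s * \1_(`]u2, v2]%classic) s) =
    (\1_(`](Num.max u1 u2), (Num.min v1 v2)]%classic) : R -> R).
  exact/funext.
split.
  rewrite [X in _.-integrable _ X](_ : _ = EFin \o
     (\1_(`](Num.max u1 u2), (Num.min v1 v2)]%classic) : R -> R)); last first.
    by apply/funext => s /=; rewrite E.
  by apply: integrableS (integrable_indic_itv _ _ _ _).
under eq_Rintegral do rewrite E.
rewrite /Rintegral integral_indic//= setIidl; last first.
  move=> r /=; rewrite !in_itv/= gt_max le_min => /andP[/andP[u1r _] /andP[rv1 _]].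
  by rewrite (le_trans u10 (ltW u1r)) (le_trans rv1 v1t).
rewrite lebesgue_measure_itv/= lte_fin /overlap; case: ltP => h.
  by rewrite -EFinD/=; apply/esym/max_idPr; rewrite subr_ge0 ltW.
by apply/esym/max_idPl; rewrite subr_le0.
Qed.

(** Overlaps are allowed so that processes on unrelated grids can be subtracted without a common
    refinement. After expanding both squares over pairs of indices, the covariances on the left
    match the integrals of products of indicators on the right. *)
Lemma ito_isometry (I : finType) (t : R) (u v : I -> R) (a : I -> T -> R) :
  (forall i, 0 <= u i) -> (forall i, u i <= v i) -> (forall i, v i <= t) ->
  (forall i, adapted (u i) (a i)) ->
  (forall i, exists c : R, forall w, `|a i w| <= c) ->
  (\int[P]_w ((\sum_i a i w * (B (v i) w - B (u i) w)) ^+ 2)%:E =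
   \int[P]_w \int[lebesgue_measure]_(s in `[0%R, t])
     ((\sum_i a i w * \1_(`]u i, v i]%classic) s) ^+ 2)%:E)%E.
Proof.
move=> u0 uv vt au ab.
pose V := \sum_(p : I * I) (\int[P]_w (a p.1 w * a p.2 w)) *
  overlap (u p.1) (v p.1) (u p.2) (v p.2).
have L : (\int[P]_w ((\sum_i a i w * (B (v i) w - B (u i) w)) ^+ 2)%:E = V%:E)%E.
  under eq_integral do rewrite sqr_sum_pair.
  have cov (p : I * I) := increment_cov (u0 p.1) (u0 p.2) (uv p.1) (uv p.2) (au p.1) (au p.2)
    (ab p.1) (ab p.2).
  have [iS ES] := @Rintegral_sum _ _ _ P (I * I)%type setT
    (fun p w => a p.1 w * (B (v p.1) w - B (u p.1) w) *
                (a p.2 w * (B (v p.2) w - B (u p.2) w))) measurableT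
    (fun p => (proj1 (cov p))).
  rewrite -[LHS]fineK; last exact: integrable_fin_num iS.
  congr EFin; rewrite [LHS]ES; apply: eq_bigr => p _; exact: (proj2 (cov p)).
rewrite L; apply/esym.
transitivity (\int[P]_w (\sum_(p : I * I) (a p.1 w * a p.2 w) *
  overlap (u p.1) (v p.1) (u p.2) (v p.2))%:E)%E.
  apply: eq_integral => w _.
  have ov (p : I * I) := @integral_indic_overlap (u p.1) (v p.1) (u p.2) (v p.2) t
    (u0 p.1) (vt p.1).
  have mI : @measurable _ (measurableTypeR R) `[0, t]%classic by exact: measurable_itv.
  pose F (p : I * I) (s : R) : R := (a p.1 w * a p.2 w) *
    (\1_(`]u p.1, v p.1]%classic) s * \1_(`]u p.2, v p.2]%classic) s).
  have iov (p : I * I) : lebesgue_measure.-integrable `[0, t] (EFin \o F p).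
    exact: (integrableZl mI (a p.1 w * a p.2 w) (proj1 (ov p))).
  have [iS ES] := @Rintegral_sum _ _ _ lebesgue_measure (I * I)%type `[0, t]%classic
    F mI iov.
  have E (s : R) : (\sum_i a i w * \1_(`]u i, v i]%classic) s) ^+ 2 =
     \sum_(p : I * I) F p s.
    by rewrite sqr_sum_pair; apply: eq_bigr => p _; rewrite mulrACA.
  under eq_integral do rewrite E.
  rewrite -[LHS]fineK; last by apply: integrable_fin_num iS.
  congr EFin; rewrite [LHS]ES; apply: eq_bigr => p _.
  by rewrite RintegralZl//; [rewrite (proj2 (ov p))|exact: (proj1 (ov p))].
have ia (p : I * I) : integrable (fun w => a p.1 w * a p.2 w).
  have [c ac] := ab p.1.
  apply: (integrable_bounded_mul (adaptedW (au p.1)) ac).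
  exact: integrable_bounded (au p.2) (ab p.2).
have iov (p : I * I) : integrable (fun w => a p.1 w * a p.2 w *
    overlap (u p.1) (v p.1) (u p.2) (v p.2)).
  rewrite /comp; under eq_fun do rewrite EFinM.
  exact: (integrableZr measurableT _ (ia p)).
have [iS ES] := @Rintegral_sum _ _ _ P (I * I)%type setT _ measurableT iov.
rewrite -[LHS]fineK; last by apply: integrable_fin_num iS.
congr EFin; rewrite [LHS]ES; apply: eq_bigr => p _.
by rewrite RintegralZr.
Qed.

End ito_isometry.

Section joint_measurability.
Context {disp : measure_display} {T : measurableType disp} {R : realType}.
Variable t : R.
Implicit Types phi psi : R -> T -> R.

Definition joint_measurable phi :=
  measurable_fun (`[0, t]%classic `*` [set: T]) (fun z : R * T => phi z.1 z.2).

Let mD : measurable (`[0, t]%classic `*` [set: T]).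
Proof. by apply: measurableX => //; exact: measurable_itv. Qed.

Lemma joint_measurableB phi psi : joint_measurable phi -> joint_measurable psi ->
  joint_measurable (fun s w => phi s w - psi s w).
Proof. exact: measurable_funB. Qed.

Lemma joint_measurableM phi psi : joint_measurable phi -> joint_measurable psi ->
  joint_measurable (fun s w => phi s w * psi s w).
Proof. exact: measurable_funM. Qed.

Lemma joint_measurable_sqr phi : joint_measurable phi ->
  joint_measurable (fun s w => phi s w ^+ 2).
Proof. by move=> h; apply: joint_measurableM. Qed.

Lemma joint_measurable_step (I : finType) (a : I -> T -> R) (u v : I -> R) :
  (forall i, measurable_fun setT (a i)) ->
  joint_measurable (fun s w => \sum_i a i w * \1_(`]u i, v i]%classic) s).
Proof.
move=> ma; apply: measurable_funTS; apply: measurable_sum => i.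
apply: measurable_funM.
  by apply: measurableT_comp => //; exact: measurable_snd.
apply: (measurableT_comp _ measurable_fst).
exact: measurable_indic.
Qed.

Lemma joint_measurable_section phi w : joint_measurable phi ->
  measurable_fun `[0, t]%classic (phi ^~ w).
Proof.
move=> mphi _ A mA.
have := mphi mD A mA; move=> /(measurable_ysection w); congr measurable.
apply/seteqP; split => s; rewrite /ysection/= inE/=.
  by move=> -[[? _] ?]; split.
by move=> [? ?]; split.
Qed.

(** Extension by zero to all times reduces the claim to the measurability part of Tonelli's
    theorem. *)
Lemma joint_measurable_integral phi : joint_measurable phi ->
  (forall s w, 0 <= phi s w) ->
  measurable_fun setT (fun w : T =>
    \int[lebesgue_measure]_(s in `[0%R, t]) (phi s w)%:E)%E.
Proof.
move=> mphi phi0.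
pose f : measurableTypeR R * T -> \bar R :=
  (fun z => (phi z.1 z.2)%:E) \_ (`[0, t]%classic `*` [set: T]).
have mf : measurable_fun setT f.
  apply/(measurable_restrictT _ _).1; first exact: mD.
  by apply/measurable_EFinP; exact: mphi.
have f0 x : (0 <= f x)%E.
  by rewrite /f patchE; case: ifP => // _; rewrite lee_fin.
have := @measurable_fun_fubini_tonelli_G _ _ _ _ R lebesgue_measure f mf f0.
congr measurable_fun; apply/funext => w; rewrite /fubini_G.
rewrite [RHS]integral_mkcond; apply: eq_integral => s _.
rewrite /f !patchE; congr (if _ then _ else _).
by rewrite /in_mem/=; apply: asbool_equiv_eq; split => [[]|].
Qed.

End joint_measurability.

Section integral_squares.
Context {disp : measure_display} {T : measurableType disp} {R : realType}.
Variables (mu : {measure set T -> \bar R}) (D : set T).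
Hypothesis mD : measurable D.

Lemma ge0_integral_2lin (f g : T -> \bar R) :
  (forall w, D w -> 0 <= f w)%E -> (forall w, D w -> 0 <= g w)%E ->
  measurable_fun D f -> measurable_fun D g ->
  (\int[mu]_(w in D) (2%:E * f w + 2%:E * g w) =
   2%:E * (\int[mu]_(w in D) f w) + 2%:E * (\int[mu]_(w in D) g w))%E.
Proof.
move=> f0 g0 mf mg.
rewrite ge0_integralD//.
- by rewrite !ge0_integralZl// lee_fin.
- by move=> w Dw; rewrite mule_ge0 ?lee_fin// f0.
- exact: measurable_funeM.
- by move=> w Dw; rewrite mule_ge0 ?lee_fin// g0.
- exact: measurable_funeM.
Qed.

Lemma integral_sqrD_le (x y : T -> R) :
  measurable_fun D x -> measurable_fun D y ->
  (\int[mu]_(w in D) ((x w + y w) ^+ 2)%:E <=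
   2%:E * (\int[mu]_(w in D) (x w ^+ 2)%:E) +
   2%:E * (\int[mu]_(w in D) (y w ^+ 2)%:E))%E.
Proof.
move=> mx my.
have msq (f : T -> R) : measurable_fun D f -> measurable_fun D (fun w => (f w ^+ 2)%:E).
  by move=> mf; apply/measurable_EFinP; exact: measurable_funX.
rewrite -ge0_integral_2lin; try exact: msq; try by move=> w _; rewrite lee_fin sqr_ge0.
apply: ge0_le_integral => //.
- by move=> w _; rewrite lee_fin sqr_ge0.
- by apply: msq; exact: measurable_funD.
- by apply: emeasurable_funD; apply: measurable_funeM; exact: msq.
- move=> w _; rewrite -!EFinM -EFinD lee_fin.
  by have := sqr_ge0 (x w - y w); rewrite !expr2; lra.
Qed.

End integral_squares.

Section ito_approximation.
Context {disp : measure_display} {T : measurableType disp} {R : realType}.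
Variables (P : probability T R) (d : nat) (X : R -> T -> 'I_d) (B : R -> T -> R).
Hypothesis mX : forall (t : R) i, 0 <= t -> measurable (X t @^-1` [set i]).
Hypothesis bmB : is_brownian_motion P B.
Hypothesis indepXB : independent P (sigma_process setT `[0, +oo[ X)
                                   (sigma_process measurable `[0, +oo[ B).

(** The isometry survives the passage from simple processes to [It] as an inequality. The factor 4
    comes from two uses of (x + y)^2 <= 2 x^2 + 2 y^2: once to pass from [It] to [S n], once to pass
    from [S n] to [H] inside the time integral. *)
Lemma ito_integral_close (H : R -> T -> R) (t : R) (It : T -> R)
    (I : finType) (u v : I -> R) (a : I -> T -> R) :
  is_ito_integral P (joint_filtration X B) B H t It ->
  (forall i, 0 <= u i) -> (forall i, u i <= v i) -> (forall i, v i <= t) ->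
  (forall i, enlarged_measurable X B (u i) (a i)) ->
  (forall i, exists c : R, forall w, `|a i w| <= c) ->
  (\int[P]_w ((It w - \sum_i a i w * (B (v i) w - B (u i) w)) ^+ 2)%:E <=
   4%:E * \int[P]_w \int[lebesgue_measure]_(s in `[0%R, t])
     ((\sum_i a i w * \1_(`]u i, v i]%classic) s - H s w) ^+ 2)%:E)%E.
Proof.
move=> [mH mI [S [adS HS IS]]] u0 uv vt au ab.
set J := fun w => \sum_i a i w * (B (v i) w - B (u i) w).
set A := fun s w => \sum_i a i w * \1_(`]u i, v i]%classic) s.
have ma i : measurable_fun setT (a i).
  exact: (@enlarged_measurable_fun _ _ _ P _ X B mX bmB (u i)).
have jA : joint_measurable t A by exact: joint_measurable_step.
have mB r : 0 <= r -> measurable_fun setT (B r) by case: bmB => + _ _ _ _; exact.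
have mJ : measurable_fun setT J.
  apply: measurable_sum => i; apply: measurable_funM => //.
  by apply: measurable_funB; apply: mB => //; exact: le_trans (uv i).
have tk n k : (k <= sp_size (S n))%N -> 0 <= sp_time (S n) k /\ sp_time (S n) k <= t.
  have [t0 tN tS _ _] := adS n.
  have mono i j : (i <= j)%N -> (j <= sp_size (S n))%N -> sp_time (S n) i <= sp_time (S n) j.
    elim: j => [|j IH]; first by rewrite leqn0 => /eqP ->.
    rewrite leq_eqVlt => /predU1P[->//|ij] jN.
    exact: le_trans (IH ij (ltnW jN)) (tS j jN).
  by move=> kN; split; [rewrite -t0|rewrite -tN]; exact: mono.
have mc n (k : 'I_(sp_size (S n))) :
    enlarged_measurable X B (sp_time (S n) k) (sp_coef (S n) k).
  by apply: enlarged_measurable_joint; have [_ _ _ + _] := adS n; exact.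
have mc' n (k : 'I_(sp_size (S n))) : measurable_fun setT (sp_coef (S n) k).
  exact: (@enlarged_measurable_fun _ _ _ P _ X B mX bmB _ _ (mc n k)).
have jS n : joint_measurable t (sp_val (S n)) by exact: joint_measurable_step.
have mS n : measurable_fun setT (sp_int B (S n)).
  apply: measurable_sum => k; apply: measurable_funM => //.
  apply: measurable_funB; apply: mB.
    by have [] := tk n k.+1 (ltn_ord k).
  by have [] := tk n k (ltnW (ltn_ord k)).
have iso n : (\int[P]_w ((sp_int B (S n) w - J w) ^+ 2)%:E =
   \int[P]_w \int[lebesgue_measure]_(s in `[0%R, t]) ((sp_val (S n) s w - A s w) ^+ 2)%:E)%E.
  (* The difference of the two step processes is itself one step process, indexed by the disjoint
     sum, with the coefficients of the second sign-reversed. *)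
  pose I2 := ('I_(sp_size (S n)) + I)%type.
  pose u2 (i : I2) := match i with inl k => sp_time (S n) k | inr i => u i end.
  pose v2 (i : I2) := match i with inl k => sp_time (S n) k.+1 | inr i => v i end.
  pose a2 (i : I2) := match i with inl k => sp_coef (S n) k | inr i => fun w => - a i w end.
  have := @ito_isometry _ _ _ P _ X B mX bmB indepXB I2 t u2 v2 a2.
  have [_ _ tS _ cS] := adS n.
  have H1 i : 0 <= u2 i.
    by case: i => [k|i] //=; have [] := tk n k (ltnW (ltn_ord k)).
  have H2 i : u2 i <= v2 i by case: i => [k|i] //=; exact: tS.
  have H3 i : v2 i <= t.
    by case: i => [k|i] //=; have [] := tk n k.+1 (ltn_ord k).
  have H4 i : enlarged_measurable X B (u2 i) (a2 i).
    case: i => [k|i] /=; first exact: mc.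
    have : enlarged_measurable X B (u i) (fun w => 0 - a i w).
      by apply: enlarged_measurableB => //; exact: measurable_cst.
    by congr enlarged_measurable; apply/funext => w; rewrite sub0r.
  have H5 i : exists c : R, forall w, `|a2 i w| <= c.
    case: i => [k|i] /=; first exact: cS.
    by have [c hc] := ab i; exists c => w; rewrite normrN.
  move=> /(_ H1 H2 H3 H4 H5).
  have E1 w : \sum_i a2 i w * (B (v2 i) w - B (u2 i) w) = sp_int B (S n) w - J w.
    rewrite big_sumType/=; congr (_ + _); rewrite /J -sumrN.
    by apply: eq_bigr => i _; rewrite mulNr.
  have E2 s w : \sum_i a2 i w * \1_(`]u2 i, v2 i]%classic) s = sp_val (S n) s w - A s w.
    rewrite big_sumType/=; congr (_ + _); rewrite /A -sumrN.
    by apply: eq_bigr => i _; rewrite mulNr.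
  under eq_integral do rewrite E1.
  move=> ->; apply: eq_integral => w _; apply: eq_integral => s _; by rewrite E2.
set HA := (\int[P]_w \int[lebesgue_measure]_(s in `[0%R, t]) ((A s w - H s w) ^+ 2)%:E)%E.
have step1 n : (\int[P]_w ((sp_int B (S n) w - J w) ^+ 2)%:E <=
   2%:E * (\int[P]_w \int[lebesgue_measure]_(s in `[0%R, t])
     ((sp_val (S n) s w - H s w) ^+ 2)%:E) + 2%:E * HA)%E.
  rewrite iso.
  have mItv : @measurable _ (measurableTypeR R) `[0, t]%classic by exact: measurable_itv.
  have j1 : joint_measurable t (fun s w => (sp_val (S n) s w - H s w) ^+ 2).
    by apply: joint_measurable_sqr; exact: joint_measurableB.
  have j2 : joint_measurable t (fun s w => (A s w - H s w) ^+ 2).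
    by apply: joint_measurable_sqr; exact: joint_measurableB.
  have j3 : joint_measurable t (fun s w => (sp_val (S n) s w - A s w) ^+ 2).
    by apply: joint_measurable_sqr; exact: joint_measurableB.
  have m1 := joint_measurable_integral j1 (fun s w => sqr_ge0 _).
  have m2 := joint_measurable_integral j2 (fun s w => sqr_ge0 _).
  have m3 := joint_measurable_integral j3 (fun s w => sqr_ge0 _).
  have int0 (phi : R -> T -> R) w :
      (0 <= \int[lebesgue_measure]_(s in `[0%R, t]) (phi s w ^+ 2)%:E)%E.
    by apply: integral_ge0 => s _; rewrite lee_fin sqr_ge0.
  rewrite /HA -ge0_integral_2lin//; last 2 first.
  - by move=> w _; exact: (int0 (fun s w => sp_val (S n) s w - H s w)).
  - by move=> w _; exact: (int0 (fun s w => A s w - H s w)).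
  apply: ge0_le_integral => //.
  - by move=> w _; exact: (int0 (fun s w => sp_val (S n) s w - A s w)).
  - by apply: emeasurable_funD; apply: measurable_funeM.
  - move=> w _.
    have s1 : @measurable_fun _ _ (measurableTypeR R) R `[0, t]%classic
        (fun s => sp_val (S n) s w - H s w).
      by apply: (joint_measurable_section (phi := fun s w => sp_val (S n) s w - H s w));
        exact: joint_measurableB.
    have s2 : @measurable_fun _ _ (measurableTypeR R) R `[0, t]%classic
        (fun s => H s w - A s w).
      by apply: (joint_measurable_section (phi := fun s w => H s w - A s w));
        exact: joint_measurableB.
    have := integral_sqrD_le lebesgue_measure mItv s1 s2.
    under eq_integral do rewrite subrKA.
    by under [X in (_ <= _ + _ * X)%E -> _]eq_integral do rewrite -sqrrN opprB.
have step2 n : (\int[P]_w ((It w - J w) ^+ 2)%:E <=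
   2%:E * (\int[P]_w ((sp_int B (S n) w - It w) ^+ 2)%:E) +
   2%:E * \int[P]_w ((sp_int B (S n) w - J w) ^+ 2)%:E)%E.
  have m1 : measurable_fun setT (fun w => It w - sp_int B (S n) w) by exact: measurable_funB.
  have m2 : measurable_fun setT (fun w => sp_int B (S n) w - J w) by exact: measurable_funB.
  have := integral_sqrD_le P measurableT m1 m2.
  under eq_integral do rewrite subrKA.
  by under [X in (_ <= _ * X + _)%E -> _]eq_integral do rewrite -sqrrN opprB.
have step3 n : (\int[P]_w ((It w - J w) ^+ 2)%:E <=
  2%:E * (\int[P]_w ((sp_int B (S n) w - It w) ^+ 2)%:E) +
  4%:E * (\int[P]_w \int[lebesgue_measure]_(s in `[0%R, t])
     ((sp_val (S n) s w - H s w) ^+ 2)%:E) + 4%:E * HA)%E.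
  apply: le_trans (step2 n) _; rewrite -addeA leeD2l//.
  have -> : (4%:E = 2%:E * 2%:E :> \bar R)%E by rewrite -EFinM -natrM.
  have HA0 : (0 <= HA)%E.
    by apply: integral_ge0 => w _; apply: integral_ge0 => s _; rewrite lee_fin sqr_ge0.
  rewrite -!muleA -ge0_muleDr; [|apply: mule_ge0; rewrite ?lee_fin//..].
    by rewrite lee_pmul2l ?lte_fin//; exact: step1.
  by apply: integral_ge0 => w _; apply: integral_ge0 => s _; rewrite lee_fin sqr_ge0.
have lim0 : (2%:E * (\int[P]_w ((sp_int B (S n) w - It w) ^+ 2)%:E) +
  4%:E * (\int[P]_w \int[lebesgue_measure]_(s in `[0%R, t])
     ((sp_val (S n) s w - H s w) ^+ 2)%:E) + 4%:E * HA)%E @[n --> \oo] --> (4%:E * HA)%E.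
  rewrite -[X in _ --> X]add0e -[X in _ --> (X + _)%E]add0e.
  apply: cvgeD => //; last exact: cvg_cst.
  apply: cvgeD => //.
    by rewrite -[X in _ --> X](mule0 2%:E); apply: cvgeZl.
  by rewrite -[X in _ --> X](mule0 4%:E); apply: cvgeZl.
by apply: (cvge_to_ge lim0); apply: nearW.
Qed.

End ito_approximation.

(** * Laplace transform of the Euler scheme *)

Section euler_scheme.
Context {disp : measure_display} {T : measurableType disp} {R : realType}.
Variables (P : probability T R) (d : nat) (Q : 'M[R]_d).
Variables (X : R -> T -> 'I_d) (B : R -> T -> R).
Variables (alpha gamma sigma : 'cV[R]_d) (m0 : R).
Hypothesis mcX : is_markov_chain P Q X.
Hypothesis bmB : is_brownian_motion P B.
Hypothesis indepXB : independent P (sigma_process setT `[0, +oo[ X)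
                                   (sigma_process measurable `[0, +oo[ B).

Let mX (t : R) i : 0 <= t -> measurable (X t @^-1` [set i]).
Proof. by case: mcX => + _ _; exact. Qed.

Implicit Types (tau : nat -> R) (x : nat -> 'I_d).

(* The coefficients are frozen at the right end of each step: by right continuity of
   [X] the resulting step functions converge at every point of every path. *)
Fixpoint euler_path tau x k (w : T) : R := match k with
  | 0 => m0
  | k.+1 => (1 - gamma (x k.+1) 0 * (tau k.+1 - tau k)) * euler_path tau x k w +
      alpha (x k.+1) 0 * (tau k.+1 - tau k) +
      sigma (x k.+1) 0 * (B (tau k.+1) w - B (tau k) w)
  end.

Definition euler tau k w := euler_path tau (fun l => X (tau l) w) k w.

Fixpoint euler_laplace tau k : 'I_d -> R -> R := match k with
  | 0 => fun j theta => expR (- (theta * m0)) * fine (P (X (tau 0%N) @^-1` [set j]))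
  | k.+1 => euler_op Q alpha gamma sigma (tau k.+1 - tau k) (euler_laplace tau k)
  end.

Lemma euler_path_ext tau x y k w : (forall l, (0 < l <= k)%N -> x l = y l) ->
  euler_path tau x k w = euler_path tau y k w.
Proof.
elim: k => // k IH xy /=; rewrite IH ?xy ?leqnn// => l /andP[l0 lk].
by rewrite xy// l0 leqW.
Qed.

Section grid.
Variable tau : nat -> R.
Hypothesis tau0 : tau 0%N = 0.
Hypothesis tauS : forall k, tau k <= tau k.+1.

Let tau_ge0 k : 0 <= tau k.
Proof. by elim: k => [|k IH]; [rewrite tau0|exact: le_trans IH _]. Qed.

Lemma enlarged_measurable_euler k : enlarged_measurable X B (tau k) (euler tau k).
Proof.
elim: k => [|k IH]; first exact: measurable_cst.
apply: enlarged_measurableD.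
  apply: enlarged_measurableD; last first.
    exact: (@enlarged_measurable_chain _ _ _ _ X B _ _
      (fun i => alpha i 0 * (tau k.+1 - tau k))).
  apply: enlarged_measurableM; last exact: enlarged_measurableS (tauS k) IH.
  exact: (@enlarged_measurable_chain _ _ _ _ X B _ _
    (fun i => 1 - gamma i 0 * (tau k.+1 - tau k))).
apply: enlarged_measurableM.
  exact: (@enlarged_measurable_chain _ _ _ _ X B _ _ (fun i => sigma i 0)).
by apply: enlarged_measurableB; exact: enlarged_measurable_brownian.
Qed.

Let brownian_type := g_sigma_algebraType (\bigcup_(s in `[0, +oo[%classic)
  preimage_set_system setT (B s) measurable).

Let chain_type := g_sigma_algebraType (\bigcup_(s in `[0, +oo[%classic)
  preimage_set_system setT (X s) setT).

(** This is why [euler_path] takes the states as an argument: once they are prescribed the scheme is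
    built from [B] alone, hence is independent of the chain. *)
Lemma brownian_measurable_euler_path x k :
  @measurable_fun _ _ brownian_type R setT (euler_path tau x k).
Proof.
have mB t : 0 <= t -> @measurable_fun _ _ brownian_type R setT (B t).
  move=> t0 _ A mA; apply: sub_sigma_algebra; exists t.
    by rewrite /= in_itv/= t0.
  by exists A.
elim: k => [|k IH]; first exact: measurable_cst.
apply: measurable_funD.
  by apply: measurable_funD; [exact: measurable_funM|exact: measurable_cst].
apply: measurable_funM; first exact: measurable_cst.
by apply: measurable_funB; exact: mB.
Qed.

Definition chain_path k (w : T) : {ffun 'I_k.+1 -> 'I_d} := [ffun l : 'I_k.+1 => X (tau l) w].

(** The finite-dimensional laws in [is_markov_chain] are indexed by infinite sequences of states;
    the filler [j] is at the same time the state reached at index [k.+1]. *)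
Let extend k (y : {ffun 'I_k.+1 -> 'I_d}) (j : 'I_d) (l : nat) : 'I_d :=
  if (l <= k)%N then y (inord l) else j.

Let chain_pathP k (y : {ffun 'I_k.+1 -> 'I_d}) j :
  chain_path k @^-1` [set y] =
  \bigcap_(l in `I_k.+1) (X (tau l) @^-1` [set extend y j l]).
Proof.
apply/seteqP; split => [w /= <- l /= lk|w h /=].
  by rewrite /extend -ltnS lk ffunE inordK.
apply/ffunP => l; rewrite ffunE; have /= := h l (ltn_ord l).
by rewrite /extend -ltnS ltn_ord inord_val.
Qed.

Let chain_path_transition k (y : {ffun 'I_k.+1 -> 'I_d}) j :
  P (chain_path k @^-1` [set y] `&` X (tau k.+1) @^-1` [set j]) =
  (P (chain_path k @^-1` [set y]) *
   (expmx ((tau k.+1 - tau k) *: Q) (y ord_max) j)%:E)%E.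
Proof.
have [_ _ fdd] := mcX.
have t0 : 0 <= tau 0%N by rewrite tau0.
have := fdd k.+1 tau (extend y j) t0 (fun l _ => tauS l).
have := fdd k tau (extend y j) t0 (fun l _ => tauS l).
rewrite -chain_pathP => ->.
rewrite (_ : \bigcap_(l in `I_k.+2) _ =
  chain_path k @^-1` [set y] `&` X (tau k.+1) @^-1` [set j]).
  move=> ->; rewrite big_ord_recr/= EFinM muleA; congr (_ * (expmx _ _ _)%:E)%E.
    by rewrite /extend leqnn; congr (y _); apply: val_inj; rewrite /= inordK.
  by rewrite /extend ltnn.
rewrite (chain_pathP y j); apply/seteqP; split => w.
  move=> h; split; first by move=> l /= lk; apply: h => /=; exact: ltnW.
  by have /= := h k.+1 (ltnSn _); rewrite /extend ltnn.
move=> [h1 h2] l /=; rewrite ltnS leq_eqVlt => /predU1P[->|lk]; last exact: h1.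
by rewrite /extend ltnn.
Qed.

Let chain_path_gen k (y : {ffun 'I_k.+1 -> 'I_d}) j : chain_gen X
  (chain_path k @^-1` [set y]) /\
  chain_gen X (chain_path k @^-1` [set y] `&` X (tau k.+1) @^-1` [set j]).
Proof.
have gX l i : chain_gen X (X (tau l) @^-1` [set i]).
  apply: sub_sigma_algebra; exists (tau l); first by rewrite /= in_itv/= tau_ge0.
  by exists [set i] => //; rewrite setTI.
suff h : chain_gen X (chain_path k @^-1` [set y]).
  by split => //; apply: (@measurableI _ chain_type); [exact: h|exact: gX].
rewrite (chain_pathP y j).
by apply: (@bigcap_measurable _ chain_type); [exists 0%N|move=> l _; exact: gX].
Qed.

Let integral_chain_brownian (A : set T) (f : T -> R) : chain_gen X A ->
  @measurable_fun _ _ brownian_type R setT f -> (forall w, 0 <= f w) ->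
  (\int[P]_w (f w * \1_A w)%:E = P A * \int[P]_w (f w)%:E)%E.
Proof.
move=> gA mf f0.
have mA : measurable A by exact: (@chain_gen_measurable _ _ _ _ X mX).
have mfT : measurable_fun setT f.
  move=> _ C mC; rewrite setTI; apply: (@sigma_brownian_measurable _ _ _ P B bmB).
  by have := mf measurableT C mC; rewrite setTI.
have ind : indep_fun P (\1_A : T -> R) f.
  move=> C D mC mD; apply: indepXB.
    have := @measurable_indic _ chain_type R setT A gA.
    by move=> /(_ measurableT C mC); rewrite setTI.
  by have := mf measurableT D mD; rewrite setTI.
have := indep_integral_normM (measurable_indic mA) mfT ind.
under eq_integral do rewrite normrM (ger0_norm (f0 _)) ger0_norm ?indicE ?ler0n// mulrC.
under [X in _ = (X * _)%E -> _]eq_integral do rewrite ger0_norm ?indicE ?ler0n// -indicE.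
under [X in _ = (_ * X)%E -> _]eq_integral do rewrite ger0_norm//.
by rewrite integral_indic// setIT => <-; apply: eq_integral => w _; rewrite indicE.
Qed.

(** On the event that the chain follows [y], the scheme equals a variable built from [B], so both
    sides factor into the probability of a chain event and one common expectation. *)
Let integral_chain_path_transition k (y : {ffun 'I_k.+1 -> 'I_d}) (u : R) j :
  (\int[P]_w (expR (u * euler tau k w) *
     \1_(chain_path k @^-1` [set y] `&` X (tau k.+1) @^-1` [set j]) w)%:E =
   (expmx ((tau k.+1 - tau k) *: Q) (y ord_max) j)%:E *
   \int[P]_w (expR (u * euler tau k w) * \1_(chain_path k @^-1` [set y]) w)%:E)%E.
Proof.
have [g1 g2] := chain_path_gen y j.
pose f w := expR (u * euler_path tau (extend y j) k w).
have mf : @measurable_fun _ _ brownian_type R setT f.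
  apply: measurableT_comp => //; apply: measurable_funM => //.
  exact: brownian_measurable_euler_path.
have f0 w : 0 <= f w by exact: expR_ge0.
have fE (A : set T) w : A `<=` chain_path k @^-1` [set y] ->
    expR (u * euler tau k w) * \1_A w = f w * \1_A w.
  move=> Ay; rewrite indicE; case: (boolP (w \in A)) => [|_]; last by rewrite !mulr0.
  rewrite inE => /Ay; rewrite (chain_pathP y j) => h; congr (expR (_ * _) * _).
  apply: euler_path_ext => l /andP[_ lk].
  by apply: h; rewrite /= ltnS.
under eq_integral do rewrite fE//.
under [in RHS]eq_integral do rewrite fE//.
rewrite !integral_chain_brownian// chain_path_transition.
by rewrite [(P _ * _)%E]muleC muleA.
Qed.

(** The scheme depends on all earlier states, so the Markov property is applied path by path and the
    results are then summed over the paths with the same last state. *)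
Let markov_step k (u : R) j :
  P.-integrable setT (fun w => (expR (u * euler tau k w))%:E) ->
  \int[P]_w (expR (u * euler tau k w) * (X (tau k.+1) w == j)%:R) =
  \sum_i expmx ((tau k.+1 - tau k) *: Q) i j *
    \int[P]_w (expR (u * euler tau k w) * (X (tau k) w == i)%:R).
Proof.
move=> iF; set F := fun w => expR (u * euler tau k w).
have iFb (A : set T) : measurable A ->
    P.-integrable setT (EFin \o (fun w => F w * \1_A w)).
  move=> mA; rewrite (_ : _ \o _ = (fun w => (\1_A w * F w)%:E)); last first.
    by apply/funext => w /=; rewrite mulrC.
  apply: (@integrable_bounded_mul _ _ _ _ _ _ 1 (measurable_indic mA)) => // w.
  by rewrite indicE ger0_norm ?lern1 ?ler0n// leq_b1.
pose C y := chain_path k @^-1` [set y].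
have mC y : measurable (C y).
  by apply: (@chain_gen_measurable _ _ _ _ X mX); have [] := chain_path_gen y j.
have mCX y : measurable (C y `&` X (tau k.+1) @^-1` [set j]).
  by apply: measurableI => //; exact: mX.
have sumC (G : {ffun 'I_k.+1 -> 'I_d} -> R) w :
    \sum_y G y * \1_(C y) w = G (chain_path k w).
  rewrite (bigD1 (chain_path k w))//= indicE mem_set// mulr1 big1 ?addr0// => y yw.
  by rewrite indicE memNset ?mulr0//= => wy; move: yw; rewrite -wy eqxx.
have indX l i w : (X (tau l) w == i)%:R = \1_(X (tau l) @^-1` [set i]) w :> R.
  by rewrite indicE; case: eqP => ?; [rewrite mem_set|rewrite memNset].
transitivity (\int[P]_w \sum_y F w * \1_(C y `&` X (tau k.+1) @^-1` [set j]) w).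
  apply: eq_Rintegral => w _; rewrite indX; under eq_bigr do rewrite indicI/= mulrA mulrAC.
  by rewrite (sumC (fun=> F w * \1_(X (tau k.+1) @^-1` [set j]) w)).
rewrite (proj2 (Rintegral_sum measurableT (fun y => iFb _ (mCX y)))).
transitivity (\sum_(y : {ffun 'I_k.+1 -> 'I_d}) \int[P]_w (
    expmx ((tau k.+1 - tau k) *: Q) (y ord_max) j *
    (F w * \1_(C y) w))).
  apply: eq_bigr => y _; rewrite RintegralZl//; last exact: iFb.
  rewrite /Rintegral integral_chain_path_transition fineM//.
  exact: (integrable_fin_num measurableT (iFb _ (mC y))).
have iZ (c : R) (A : set T) : measurable A ->
    P.-integrable setT (EFin \o (fun w => c * (F w * \1_A w))).
  move=> mA; rewrite /comp; under eq_fun do rewrite EFinM.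
  exact: (integrableZl measurableT _ (iFb A mA)).
rewrite -(proj2 (Rintegral_sum measurableT (fun y => iZ _ _ (mC y)))).
have mXk i : measurable (X (tau k) @^-1` [set i]) by exact: mX.
transitivity (\int[P]_w \sum_i expmx ((tau k.+1 - tau k) *: Q) i j *
    (F w * \1_(X (tau k) @^-1` [set i]) w)).
  apply: eq_Rintegral => w _.
  under eq_bigr do rewrite mulrA.
  rewrite (sumC (fun y => expmx ((tau k.+1 - tau k) *: Q) (y ord_max) j * F w)).
  rewrite (bigD1 (X (tau k) w))//= -indX eqxx mulr1 big1 ?addr0 ?ffunE// => i iX.
  by rewrite -indX eq_sym (negbTE iX) !mulr0.
rewrite (proj2 (Rintegral_sum measurableT (fun i => iZ _ _ (mXk i)))).
apply: eq_bigr => i _; rewrite RintegralZl//; last exact: iFb.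
by congr (_ * _); apply: eq_Rintegral => w _; rewrite indX.
Qed.

(** Integrability and value are proved together, for all [theta] at once, because the induction step
    needs both at the contracted argument. *)
Lemma euler_laplaceE k theta j :
  P.-integrable setT (fun w => (expR (- (theta * euler tau k w)) * (X (tau k) w == j)%:R)%:E) /\
  \int[P]_w (expR (- (theta * euler tau k w)) * (X (tau k) w == j)%:R) =
  euler_laplace tau k j theta.
Proof.
have indX l i w : (X (tau l) w == i)%:R = \1_(X (tau l) @^-1` [set i]) w :> R.
  by rewrite indicE; case: eqP => ?; [rewrite mem_set|rewrite memNset].
elim: k theta j => [|k IH] theta j.
  have mXj : measurable (X (tau 0%N) @^-1` [set j]) by exact: mX.
  have E w : expR (- (theta * euler tau 0 w)) * (X (tau 0%N) w == j)%:R =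
      expR (- (theta * m0)) * \1_(X (tau 0%N) @^-1` [set j]) w by rewrite indX.
  have i1 : P.-integrable setT (fun w => (\1_(X (tau 0%N) @^-1` [set j]) w : R)%:E).
    exact: integrable_indic.
  split.
    under eq_fun do rewrite E EFinM.
    exact: integrableZl.
  under eq_Rintegral do rewrite E.
  by rewrite RintegralZl// /Rintegral integral_indic// setIT.
set dt := tau k.+1 - tau k.
(* On the event that the chain ends in [j], the exponential splits into a contracted power of the
   previous position ([u]), a drift constant ([c]) and a Brownian factor independent of [xi]. *)
pose u := - (theta * (1 - gamma j 0 * dt)).
pose c := expR (- (theta * (alpha j 0 * dt))).
pose xi w := c * (expR (u * euler tau k w) * (X (tau k.+1) w == j)%:R).
have E w : expR (- (theta * euler tau k.+1 w)) * (X (tau k.+1) w == j)%:R =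
    xi w * expR (- (theta * sigma j 0) * (B (tau k.+1) w - B (tau k) w)).
  rewrite /xi; case: eqP => [Xj|_]; last by rewrite !mulr0 mul0r.
  rewrite !mulr1 /c -!expRD; congr expR.
  by rewrite /u /euler /= Xj -/dt; ring.
(* The exponential without indicator is the sum over the final states of the expressions in the
   induction hypothesis. *)
have iEk theta' : P.-integrable setT (fun w => (expR (- (theta' * euler tau k w)))%:E).
  have [+ _] := Rintegral_sum measurableT (fun i => proj1 (IH theta' i)).
  congr (_.-integrable _ _); apply/funext => w; congr EFin.
  rewrite (bigD1 (X (tau k) w))//= eqxx mulr1 big1 ?addr0// => i iX.
  by rewrite eq_sym (negbTE iX) mulr0.
have uE w : u * euler tau k w = - ((1 - gamma j 0 * dt) * theta * euler tau k w).
  by rewrite /u; ring.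
have iu : P.-integrable setT (fun w => (expR (u * euler tau k w))%:E).
  under eq_fun do rewrite uE.
  exact: iEk.
have iu1 : P.-integrable setT
    (EFin \o (fun w => expR (u * euler tau k w) * (X (tau k.+1) w == j)%:R)).
  rewrite (_ : _ \o _ = (fun w => (\1_(X (tau k.+1) @^-1` [set j]) w *
      expR (u * euler tau k w))%:E)); last first.
    by apply/funext => w /=; rewrite indX mulrC.
  apply: (@integrable_bounded_mul _ _ _ _ _ _ 1) => // [|w].
    exact: measurable_indic (mX _ _).
  by rewrite indicE ger0_norm ?lern1 ?ler0n// leq_b1.
have ixi : P.-integrable setT (EFin \o xi).
  rewrite /comp /xi; under eq_fun do rewrite EFinM.
  exact: (integrableZl measurableT c iu1).
have axi : enlarged_measurable X B (tau k) xi.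
  apply: enlarged_measurableM; first exact: measurable_cst.
  apply: enlarged_measurableM.
    apply: measurableT_comp => //; apply: enlarged_measurableM.
      exact: measurable_cst.
    exact: enlarged_measurable_euler.
  exact: (@enlarged_measurable_chain _ _ _ _ X B _ _ (fun i => (i == j)%:R)).
have [iM EM] := adapted_increment_exp mX bmB indepXB (- (theta * sigma j 0))
  (tau_ge0 k) (tauS k) axi ixi.
split; first by under eq_fun do rewrite E.
under eq_Rintegral do rewrite E.
rewrite EM /xi RintegralZl// markov_step//= /euler_op -/dt.
rewrite mulrAC; congr (_ * _).
  by rewrite /c -expRD /symbol; congr expR; field.
apply: eq_bigr => i _; congr (_ * _); rewrite -(proj2 (IH _ _)).
by apply: eq_Rintegral => w _; rewrite uE.
Qed.

End grid.
End euler_scheme.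

(** * Convergence of the Euler scheme *)

(** The minus sign (mean reversion) spares the usual exponential: with s the partial sum of the
    [q k * e k], the next one is (1 - q) s + q r, a convex combination. *)
Lemma discrete_gronwall {R : realDomainType} (e r q : nat -> R) n :
  (forall k, (k < n)%N -> 0 <= q k <= 1) ->
  (forall l, (l <= n)%N -> e l = r l - \sum_(k < l) q k * e k) ->
  `|e n| <= `|r n| + \sum_(k < n) q k * `|r k|.
Proof.
move=> q01 eE.
have f_le l : (l <= n)%N -> `|\sum_(k < l) q k * e k| <= \sum_(k < l) q k * `|r k|.
  elim: l => [|l IH] ln; first by rewrite !big_ord0 normr0.
  rewrite !big_ord_recr/= eE; last exact: ltnW.
  have /andP[q0 q1] := q01 l ln.
  set s := \sum_(k < l) _ in IH *; rewrite (_ : s + _ = (1 - q l) * s + q l * r l); last by ring.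
  apply: le_trans (ler_normD _ _) _; rewrite !normrM (ger0_norm q0).
  apply: lerD => //; apply: le_trans _ (IH (ltnW ln)).
  by rewrite ler_piMl// ger0_norm ?subr_ge0// gerBl.
rewrite eE//; apply: le_trans (ler_normB _ _) _.
by rewrite lerD2l f_le.
Qed.

Section bounded_convergence.
Context {disp : measure_display} {T : measurableType disp} {R : realType}.
Variables (mu : {measure set T -> \bar R}) (D : set T).
Hypotheses (mD : measurable D) (finD : (mu D < +oo)%E).

Lemma integrable_cst_finite (c : R) : mu.-integrable D (fun=> c%:E).
Proof.
apply/integrableP; split => //.
by rewrite integral_cst// lte_mul_pinfty// abse_fin_num.
Qed.

Lemma bounded_convergence (f : nat -> T -> R) (g : T -> R) (c : R) :
  (forall m, measurable_fun D (f m)) -> measurable_fun D g ->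
  (forall m x, D x -> `|f m x| <= c) ->
  {ae mu, forall x, D x -> f m x @[m --> \oo] --> g x} ->
  (\int[mu]_(x in D) (f m x)%:E)%E @[m --> \oo] --> (\int[mu]_(x in D) (g x)%:E)%E.
Proof.
move=> mf mg fc f0.
have mf' m : measurable_fun D (EFin \o f m) by exact/measurable_EFinP.
have mg' : measurable_fun D (EFin \o g) by exact/measurable_EFinP.
have f0' : {ae mu, forall x, D x -> (f m x)%:E @[m --> \oo] --> (g x)%:E}.
  by apply: filterS f0 => x h Dx; apply: cvg_EFin; [exact: nearW|exact: h].
have [_ _] := @dominated_convergence _ _ _ mu D mD (fun m x => (f m x)%:E)
  (fun x => (g x)%:E) (fun=> c%:E) mf' mg' f0'
  (integrable_cst_finite c) (aeW _ (fun x m Dx => fc m x Dx)).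
exact.
Qed.

End bounded_convergence.

(** * Step functions on refining grids *)

Section grid_cells.
Context {R : realType}.
Implicit Types (tau : nat -> R) (s : R).

Lemma nondecreasing_grid tau : (forall k, tau k <= tau k.+1) ->
  forall i j, (i <= j)%N -> tau i <= tau j.
Proof. by move=> tauS i j; move: i j; apply/nondecreasing_seqP. Qed.

Lemma grid_cell tau n s : (forall k, tau k <= tau k.+1) -> tau 0%N < s -> s <= tau n ->
  exists k : 'I_n, tau k < s /\ s <= tau k.+1.
Proof.
move=> tauS; elim: n => [|n IH] s0 sn; first by move: s0; rewrite ltNge sn.
have [sn'|sn'] := leP s (tau n).
  by have [k ?] := IH s0 sn'; exists (widen_ord (leqnSn n) k).
by exists ord_max.
Qed.

Lemma grid_cell_sum tau n s (k : 'I_n) (c : nat -> R) : (forall k, tau k <= tau k.+1) ->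
  tau k < s -> s <= tau k.+1 ->
  \sum_(i < n) c i * \1_(`]tau i, tau i.+1]%classic) s = c k.
Proof.
move=> tauS ks sk; rewrite (bigD1 k)//= indicE mem_set/= ?in_itv/= ?ks// mulr1.
rewrite big1 ?addr0// => i ik; rewrite indicE memNset ?mulr0//= in_itv/= => /andP[is_ si].
have [ki|ki|ki] := ltngtP (val i) (val k); last by move/val_inj: ki ik => ->; rewrite eqxx.
- by have := nondecreasing_grid tauS ki; rewrite leNgt (lt_le_trans ks si).
- by have := nondecreasing_grid tauS ki; rewrite leNgt (lt_le_trans is_ sk).
Qed.

Lemma grid_cell_sum0 tau n s (c : nat -> R) : (forall k, tau k <= tau k.+1) ->
  s <= tau 0%N -> \sum_(i < n) c i * \1_(`]tau i, tau i.+1]%classic) s = 0.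
Proof.
move=> tauS s0; rewrite big1// => i _; rewrite indicE memNset ?mulr0//= in_itv/=.
move=> /andP[+ _]; apply/negP; rewrite -leNgt; apply: le_trans s0 _.
exact: nondecreasing_grid.
Qed.

Lemma grid_sum_bound tau n s (c : nat -> R) C : 0 <= C -> (forall k, tau k <= tau k.+1) ->
  s <= tau n -> (forall i, (i < n)%N -> `|c i| <= C) ->
  `|\sum_(i < n) c i * \1_(`]tau i, tau i.+1]%classic) s| <= C.
Proof.
move=> C0 tauS sn cC; have [s0|s0] := leP s (tau 0%N).
  by rewrite grid_cell_sum0// normr0.
have [k [ks sk]] := grid_cell tauS s0 sn.
by rewrite (grid_cell_sum c tauS ks sk) cC.
Qed.

Lemma grid_sum_trunc tau l n s (c : nat -> R) : (l <= n)%N -> (forall k, tau k <= tau k.+1) ->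
  s <= tau l -> \sum_(i < n) c i * \1_(`]tau i, tau i.+1]%classic) s =
    \sum_(i < l) c i * \1_(`]tau i, tau i.+1]%classic) s.
Proof.
move=> ln tauS sl; have [s0|s0] := leP s (tau 0%N).
  by rewrite !grid_cell_sum0.
have [k [ks sk]] := grid_cell tauS s0 sl.
rewrite (grid_cell_sum c tauS ks sk).
by rewrite (@grid_cell_sum tau n s (widen_ord ln k) c tauS ks sk).
Qed.

End grid_cells.

Section step_functions.
Context {R : realType}.
Variables (tau : nat -> nat -> R) (N : nat -> nat) (mesh : nat -> R) (t : R).
Hypothesis tau0 : forall m, tau m 0%N = 0.
Hypothesis tauS : forall m k, tau m k <= tau m k.+1.
Hypothesis tauN : forall m, tau m (N m) = t.
Hypothesis tau_mesh : forall m k, tau m k.+1 - tau m k <= mesh m.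
Hypothesis mesh0 : mesh m @[m --> \oo] --> 0.

Lemma step_cvg (c : nat -> nat -> R) (l s : R) : 0 < s -> s <= t ->
  (forall e, 0 < e -> exists2 eta, 0 < eta & forall m i, tau m i < s -> s <= tau m i.+1 ->
    tau m i.+1 - tau m i < eta -> `|c m i - l| <= e) ->
  \sum_(i < N m) c m i * \1_(`]tau m i, tau m i.+1]%classic) s @[m --> \oo] --> l.
Proof.
move=> s0 st h; apply/cvgrPdist_le => e e0; have [eta eta0 H] := h e e0.
near=> m.
have [k [ks sk]] : exists k : 'I_(N m), tau m k < s /\ s <= tau m k.+1.
  by apply: grid_cell => //; rewrite ?tau0 ?tauN.
rewrite (grid_cell_sum (c m) (tauS m) ks sk) distrC; apply: H => //.
apply: le_lt_trans (tau_mesh m k) _.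
by near: m; exact: (cvgr_lt 0 mesh0).
Unshelve. all: by end_near. Qed.

(** Right end points approach [s] from the right or equal it, where the path has the value [x s]
    even if it jumps at [s]; left end points would see the value before the jump. *)
Lemma step_cvg_right {A : Type} (x : R -> A) (phi : A -> R) (s : R) : 0 < s -> s <= t ->
  (\forall u \near s^'+, x u = x s) ->
  \sum_(i < N m) phi (x (tau m i.+1)) * \1_(`]tau m i, tau m i.+1]%classic) s
    @[m --> \oo] --> phi (x s).
Proof.
move=> s0 st [e /= e0 He].
apply: (step_cvg (c := fun m i => phi (x (tau m i.+1)))) => // e1 e10; exists e => // m i is_ si se.
have [->|ne] := eqVneq (tau m i.+1) s; first by rewrite subrr normr0 ltW.
rewrite He ?subrr ?normr0 ?(ltW e10)//; last by rewrite lt_neqAle eq_sym ne.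
by rewrite /= distrC ger0_norm ?subr_ge0//; lra.
Qed.

End step_functions.

Section right_continuous_measurable.
Context {disp : measure_display} {T : measurableType disp} {R : realType}.

(** The path is the pointwise limit of its right-end step functions on uniform grids. Time 0 lies in
    no half-open cell and is added as a singleton. *)
Lemma right_constant_measurable {A : Type} (x : R -> A) (phi : A -> R) (t : R) :
  0 <= t -> (forall s, 0 <= s -> \forall u \near s^'+, x u = x s) ->
  measurable_fun `[0, t]%classic (fun s => phi (x s)).
Proof.
move=> t0 rc.
suff m1 : measurable_fun `]0, t]%classic (fun s => phi (x s)).
  move: t0; rewrite le_eqVlt => /predU1P[<-|t0].
    by rewrite set_itv1; exact: measurable_fun_set1.
  have -> : `[0, t]%classic = [set 0 : R] `|` `]0, t]%classic.
    by rewrite setU1itv// bnd_simp ltW.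
  by apply/measurable_funU => //; split => //; exact: measurable_fun_set1.
pose tau (m k : nat) : R := k%:R * (t / m.+1%:R).
have tm0 m : 0 <= t / m.+1%:R by rewrite divr_ge0.
apply: (measurable_fun_cvg (h := fun m s => \sum_(i < m.+1) phi (x (tau m i.+1)) *
  \1_(`]tau m i, tau m i.+1]%classic) s)).
  by move=> m; apply: measurable_sum => i; apply: measurable_funM.
move=> s /=; rewrite in_itv/= => /andP[s0 st].
have h1 m : tau m 0%N = 0 by rewrite /tau mul0r.
have h2 m k : tau m k <= tau m k.+1 by rewrite /tau ler_wpM2r// ler_nat.
have h3 m : tau m m.+1 = t by rewrite /tau mulrCA divff ?mulr1 ?pnatr_eq0.
have h4 m k : tau m k.+1 - tau m k <= t / m.+1%:R.
  by rewrite /tau -natr1 mulrDl mul1r addrC addKr.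
have h5 : t / m.+1%:R @[m --> \oo] --> 0.
  rewrite -[X in _ --> X](mulr0 t); apply: cvgM; first exact: cvg_cst.
  exact: cvg_harmonic.
exact: (step_cvg_right (phi := phi) h1 h2 h3 h4 h5 s0 st (rc s (ltW s0))).
Qed.

End right_continuous_measurable.

(** * From almost sure convergence to convergence of expectations, and summable means *)

Section vitali.
Context {disp : measure_display} {T : measurableType disp} {R : realType}.
Variable P : probability T R.

Lemma fatou_bound (f : nat -> T -> R) (g : T -> R) (C : R) :
  (forall k, measurable_fun setT (f k)) -> (forall k w, 0 <= f k w) ->
  {ae P, forall w, f k w @[k --> \oo] --> g w} -> measurable_fun setT g ->
  (forall k, \int[P]_w (f k w)%:E <= C%:E)%E ->
  (\int[P]_w `|g w|%:E <= C%:E)%E.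
Proof.
move=> mf f0 fg mg fC.
have mf' k : measurable_fun setT (EFin \o f k) by exact/measurable_EFinP.
apply: (@le_trans _ _ (\int[P]_w limn_einf (fun k => (f k w)%:E))%E).
  rewrite le_eqVlt; apply/orP; left; apply/eqP; apply: ae_eq_integral => //.
  - by apply/measurable_EFinP; exact: measurableT_comp.
  - rewrite /limn_einf; apply: measurableT_comp => //.
    apply: measurable_fun_limn_esup => k.
    have mN : measurable_fun setT (fun x => - f k x) by exact: measurableT_comp.
    by have /measurable_EFinP := mN.
  - apply: filterS fg => w fw _.
    have fw' : (f k w)%:E @[k --> \oo] --> (g w)%:E.
      by apply: cvg_EFin; [exact: nearW|exact: fw].
    rewrite (cvg_limn_einf_sup fw') ger0_norm//.
    by apply: (cvgr_to_ge fw); apply: nearW.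
apply: le_trans (fatou P measurableT mf' _) _; first by move=> k w _; rewrite lee_fin.
rewrite limn_einf_lim; apply: lime_le; first exact: is_cvg_einfs.
apply: nearW => n; apply: le_trans (fC n).
by apply: ereal_inf_lbound; exists n => //=.
Qed.

(** Truncate at height c: y - min(y, c) <= y^2 / c, so truncation changes every expectation by at
    most C / c, uniformly in [k], while truncated functions converge by bounded convergence. Fatou's
    lemma transfers the second moment bound to [g]. *)
Lemma vitali_sqr (f : nat -> T -> R) (g : T -> R) (C : R) :
  (forall k, measurable_fun setT (f k)) -> (forall k w, 0 <= f k w) ->
  {ae P, forall w, f k w @[k --> \oo] --> g w} -> measurable_fun setT g ->
  (forall w, 0 <= g w) ->
  (forall k, \int[P]_w (f k w ^+ 2)%:E <= C%:E)%E ->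
  P.-integrable setT (EFin \o g) /\
  \int[P]_w f k w @[k --> \oo] --> \int[P]_w g w.
Proof.
move=> mf f0 fg mg g0 fC.
have gC : (\int[P]_w (g w ^+ 2)%:E <= C%:E)%E.
  have := @fatou_bound (fun k w => f k w ^+ 2) (fun w => g w ^+ 2) C.
  under eq_integral do rewrite ger0_norm ?sqr_ge0//.
  apply => //.
  - by move=> k; exact: measurable_funX.
  - by move=> k w; exact: sqr_ge0.
  - by apply: filterS fg => w fw; rewrite expr2; exact: cvgM.
  - exact: measurable_funX.
have C0 : 0 <= C.
  by rewrite -lee_fin; apply: le_trans gC; apply: integral_ge0 => w _; rewrite lee_fin sqr_ge0.
have sqr_int (y : T -> R) : measurable_fun setT y -> (\int[P]_w (y w ^+ 2)%:E <= C%:E)%E ->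
    P.-integrable setT (EFin \o (fun w => y w ^+ 2)).
  move=> my yC; apply/integrableP; split; first by apply/measurable_EFinP; exact: measurable_funX.
  under eq_integral do rewrite /= ger0_norm ?sqr_ge0//.
  by apply: le_lt_trans yC _; rewrite ltry.
have int1 (y : T -> R) : measurable_fun setT y -> (\int[P]_w (y w ^+ 2)%:E <= C%:E)%E ->
    P.-integrable setT (EFin \o y).
  move=> my yC; have i1 : P.-integrable setT (EFin \o (fun=> 1 : R)).
    exact: finite_measure_integrable_cst.
  apply: (le_integrable measurableT _ _ (integrableD measurableT i1 (sqr_int y my yC))).
    exact/measurable_EFinP.
  move=> w _ /=; rewrite lee_fin [leRHS]ger0_norm; last by rewrite addr_ge0// sqr_ge0.
  rewrite ler_norml.
  have := sqr_ge0 (y w - 2^-1); have := sqr_ge0 (y w + 2^-1); rewrite !expr2.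
  by move=> *; apply/andP; split; lra.
split; first exact: int1.
pose tr (c y : R) := Num.min y c.
have mtr (c : R) (y : T -> R) : measurable_fun setT y -> measurable_fun setT (fun w => tr c (y w)).
  by move=> my; exact: measurable_minr.
have trC (c : R) (y : T -> R) : 0 < c -> measurable_fun setT y -> (forall w, 0 <= y w) ->
   (\int[P]_w (y w ^+ 2)%:E <= C%:E)%E ->
   P.-integrable setT (EFin \o (fun w => tr c (y w))) /\
   `|\int[P]_w y w - \int[P]_w tr c (y w)| <= C / c.
  move=> c0 my y0 yC.
  have iy := int1 y my yC.
  have itr : P.-integrable setT (EFin \o (fun w => tr c (y w))).
    apply: (le_integrable measurableT _ _ iy).
      by apply/measurable_EFinP; exact: mtr.
    move=> w _ /=; rewrite lee_fin !ger0_norm//; first by rewrite /tr ge_min lexx.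
    by rewrite /tr le_min y0 ltW.
  split=> //; rewrite -RintegralB//.
  have iB : P.-integrable setT (EFin \o (fun w => y w - tr c (y w))).
    rewrite /comp; under eq_fun do rewrite EFinB.
    exact: integrableB.
  apply: le_trans (le_normr_Rintegral measurableT iB) _.
  have iS : P.-integrable setT (EFin \o (fun w => c^-1 * y w ^+ 2)).
    rewrite /comp; under eq_fun do rewrite EFinM.
    exact: (integrableZl measurableT _ (sqr_int y my yC)).
  apply: (@le_trans _ _ (\int[P]_w (c^-1 * y w ^+ 2))).
    apply: le_Rintegral => //; first exact: integrable_abse iB.
    move=> w _; rewrite ger0_norm; last by rewrite subr_ge0 /tr ge_min lexx.
    rewrite /tr; case: (leP (y w) c) => yc.
      by rewrite subrr mulr_ge0 ?sqr_ge0// invr_ge0 ltW.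
    rewrite -(ler_pM2l c0) mulrA divff ?gt_eqF// mul1r.
    by rewrite expr2; have := y0 w; nra.
  rewrite RintegralZl//; last exact: sqr_int.
  rewrite mulrC ler_wpM2r ?invr_ge0 ?(ltW c0)//.
  rewrite -lee_fin /Rintegral fineK//; apply: integrable_fin_num => //; exact: sqr_int.
apply/cvgrPdist_le => /= e e0.
(* This gives [C / c <= e / 3]; the summand 1 keeps [c] positive when [C] is 0. *)
pose c := 3 * C / e + 1.
have c0 : 0 < c by rewrite ltr_wpDl// divr_ge0 ?(ltW e0)// mulr_ge0.
have Cc : C / c <= e / 3.
  rewrite ler_pdivrMr// /c mulrDr mulr1.
  have -> : e / 3 * (3 * C / e) = C by field; rewrite gt_eqF.
  by rewrite lerDl divr_ge0// ltW.
have trcvg : \int[P]_w tr c (f k w) @[k --> \oo] --> \int[P]_w tr c (g w).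
  apply: fine_cvg; rewrite fineK; last first.
    by apply: integrable_fin_num => //; have [] := trC c g c0 mg g0 gC.
  apply: (@bounded_convergence _ _ _ P setT measurableT _ _ _ c).
  - by rewrite (le_lt_trans (probability_le1 P measurableT))// ltry.
  - by move=> k; exact: mtr.
  - exact: mtr.
  - move=> k w _; rewrite /tr ger0_norm; first by rewrite ge_min lexx orbT.
    by rewrite le_min f0 ltW.
  - apply: filterS fg => w fw _; rewrite /tr minr_absE.
    under eq_fun do rewrite minr_absE.
    apply: cvgM; last exact: cvg_cst.
    apply: cvgB; first by apply: cvgD => //; exact: cvg_cst.
    by apply: cvg_norm; apply: cvgB => //; exact: cvg_cst.
have e3 : 0 < e / 3 by rewrite divr_gt0.
near=> k.
have [_ h1] := trC c g c0 mg g0 gC.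
have [_ h2] := trC c (f k) c0 (mf k) (f0 k) (fC k).
have h3 : `|\int[P]_w tr c (g w) - \int[P]_w tr c (f k w)| <= e / 3.
  by near: k; move/cvgrPdist_le: trcvg; apply.
set a := \int[P]_w g w in h1 *; set b := \int[P]_w f k w in h2 *.
set a' := \int[P]_w tr c (g w) in h1 h3 *; set b' := \int[P]_w tr c (f k w) in h2 h3 *.
have -> : a - b = (a - a') + (a' - b') - (b - b') by ring.
apply: le_trans (ler_normB _ _) _.
have := ler_normD (a - a') (a' - b').
have := le_trans h1 Cc; have := le_trans h2 Cc; lra.
Unshelve. all: by end_near. Qed.

(** The series of the [W k] has a finite integral, so it converges almost everywhere and its terms
    tend to 0. *)
Lemma summable_cvg_ae (W : nat -> T -> R) :
  (forall k, measurable_fun setT (W k)) -> (forall k w, 0 <= W k w) ->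
  (forall k, \int[P]_w (W k w)%:E <= (1 / (2 ^ (k + 1))%:R)%:E)%E ->
  {ae P, forall w, W k w @[k --> \oo] --> 0}.
Proof.
move=> mW W0 WC.
have mW' k : measurable_fun setT (EFin \o W k) by exact/measurable_EFinP.
have W0' k w : [set: T] w -> (0 <= (W k w)%:E)%E by rewrite lee_fin.
pose S w : \bar R := (\sum_(0 <= k <oo) (W k w)%:E)%E.
have S2 : (\int[P]_w S w < +oo)%E.
  rewrite /S integral_nneseries//.
  apply: (@le_lt_trans _ _ (\sum_(0 <= k <oo) (1 / (2 ^ (k + 1))%:R)%:E)%E).
    apply: lee_nneseries => // k _ _; apply: integral_ge0 => w _; exact: W0'.
  by rewrite [X in (X < _)%E](cvg_lim _ (@cvg_geometric_eseries_half R 1 0))// ltry.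
have S0 w : (0 <= S w)%E by apply: nneseries_ge0 => k _ _; exact: W0'.
have iS : P.-integrable setT S.
  apply/integrableP; split; first exact:
    (@ge0_emeasurable_sum _ T R setT (fun k w => (W k w)%:E) predT
      (fun k w _ _ => W0' k w I) (fun k _ => mW' k)).
  by under eq_integral do rewrite gee0_abs//.
have := integrable_ae measurableT iS.
apply: filterS => w /(_ I); rewrite ge0_fin_numE// => Sfin.
have tail := nneseries_tail_cvg Sfin (fun k _ => W0' k w I).
have : (W k w)%:E @[k --> \oo] --> 0%E.
  apply: (squeeze_cvge _ (cvg_cst 0%E) tail); apply: nearW => k; rewrite W0'//=.
  apply: le_trans (nneseries_lim_ge k.+1 _); last by move=> n _ _; exact: W0'.
  by rewrite big_nat1.
by move=> /fine_cvg.
Qed.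

End vitali.

Lemma ae_neq0 {R : realType} (A : R -> Prop) : (forall s, s != 0 -> A s) ->
  {ae (lebesgue_measure : set R -> \bar R), forall s : R, A s}.
Proof.
move=> h; exists [set 0]; split; [exact: measurable_set1|exact: lebesgue_measure_set1|].
by move=> s /= As; apply: contrapT => /eqP/h.
Qed.

Lemma lebesgue_itv0_finite {R : realType} (t : R) :
  (lebesgue_measure `[0%R, t]%classic < +oo)%E.
Proof. by rewrite lebesgue_measure_itv/=; case: ifP => _; rewrite ?ltry// -EFinD ltry. Qed.

Lemma integrable_itv0 {R : realType} (t K : R) (f : R -> R) :
  measurable_fun `[0, t]%classic f ->
  (forall s, 0 <= s -> s <= t -> `|f s| <= K) ->
  (lebesgue_measure : measure (measurableTypeR R) R).-integrable `[0, t] (EFin \o f).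
Proof.
move=> mf fK.
have mI : @measurable _ (measurableTypeR R) `[0, t]%classic by exact: measurable_itv.
apply: (@le_integrable _ _ _ _ _ mI _ (cst `|K|%:E)).
- by apply/measurable_EFinP.
- move=> s /=; rewrite in_itv/= => /andP[s0 st]; rewrite lee_fin normr_id.
  exact: le_trans (fK s s0 st) (ler_norm _).
- by apply: integrable_cst_finite => //; exact: lebesgue_itv0_finite.
Qed.

(** * The Euler error along one path *)

Section pathwise.
Context {R : realType} {d : nat}.
Variables (alpha gamma sigma : 'cV[R]_d) (m0 : R).
Variables (x : R -> 'I_d) (b M I : R -> R).
Hypothesis gamma_ge0 : forall i, 0 <= gamma i 0.
Hypothesis rcx : forall s, 0 <= s -> \forall u \near s^'+, x u = x s.
Hypothesis cM : {within `[0, +oo[, continuous M}.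
Hypothesis ME : forall s, 0 <= s -> M s = m0 +
  \int[lebesgue_measure]_(u in `[0, s]) (alpha (x u) 0 - gamma (x u) 0 * M u) + I s.

Variables (tau : nat -> nat -> R) (N : nat -> nat) (mesh : nat -> R) (t : R).
Hypothesis tau0 : forall m, tau m 0%N = 0.
Hypothesis tauS : forall m k, tau m k <= tau m k.+1.
Hypothesis tauN : forall m, tau m (N m) = t.
Hypothesis tau_mesh : forall m k, tau m k.+1 - tau m k <= mesh m.
Hypothesis mesh0 : mesh m @[m --> \oo] --> 0.
Hypothesis mesh_gamma : forall m, (\sum_i gamma i 0) * mesh m <= 1.

Variable E : nat -> nat -> R.
Let dt m k := tau m k.+1 - tau m k.
Hypothesis E0 : forall m, E m 0%N = m0.
Hypothesis ES : forall m k, E m k.+1 = (1 - gamma (x (tau m k.+1)) 0 * dt m k) * E m k +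
  alpha (x (tau m k.+1)) 0 * dt m k +
  sigma (x (tau m k.+1)) 0 * (b (tau m k.+1) - b (tau m k)).

Definition noise_defect m l := I (tau m l) -
  \sum_(i < l) sigma (x (tau m i.+1)) 0 * (b (tau m i.+1) - b (tau m i)).

(** The final defect and the time average of the defects are the two places where the noise enters
    the discrete Gronwall bound. Both are squared, so that second moments at fixed grid times
    control the expectation. *)
Definition noise_energy m := noise_defect m (N m) ^+ 2 +
  \sum_(l < N m) dt m l * noise_defect m l ^+ 2.

Let tau_ge0 m k : 0 <= tau m k.
Proof. by rewrite -(tau0 m); exact: nondecreasing_grid. Qed.

Let t_ge0 : 0 <= t. Proof. by rewrite -(tauN 0). Qed.

Let tau_le m k : (k <= N m)%N -> tau m k <= t.
Proof. by move=> kN; rewrite -(tauN m); exact: nondecreasing_grid. Qed.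

Let dt_ge0 m k : 0 <= dt m k. Proof. by rewrite subr_ge0. Qed.

Let G := \sum_i gamma i 0.
Let G_ge0 : 0 <= G. Proof. by rewrite sumr_ge0. Qed.
Let gamma_le i : gamma i 0 <= G.
Proof. by rewrite /G (bigD1 i)//= lerDl sumr_ge0. Qed.

Let psi s := alpha (x s) 0 - gamma (x s) 0 * M s.
(** The drift with the chain frozen at the right end of the cell, as in the scheme, but with [M] at
    the left end, so that [M - E] on the grid satisfies a linear recursion. *)
Let c m i := alpha (x (tau m i.+1)) 0 - gamma (x (tau m i.+1)) 0 * M (tau m i).
Let psi_ m s := \sum_(i < N m) c m i * \1_(`]tau m i, tau m i.+1]%classic) s.

Let M_bounded : exists2 K : R, 0 <= K & forall s, 0 <= s -> s <= t -> `|M s| <= K.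
Proof.
have cM' : {within `[0, t], continuous (fun s => `|M s|)}.
  have cMt : {within `[0, t], continuous M}.
    apply: continuous_subspaceW cM => s /=.
    by rewrite !in_itv/= andbT => /andP[].
  by move=> s; apply: continuous_comp; [exact: cMt|exact: norm_continuous].
have [s0 _ H] := EVT_max t_ge0 cM'.
exists `|M s0| => // s s00 st; apply: H; by rewrite in_itv/= s00.
Qed.

Let mI (s : R) : @measurable _ (measurableTypeR R) `[0, s]%classic.
Proof. exact: measurable_itv. Qed.

Let measurable_psi : measurable_fun `[0, t]%classic psi.
Proof.
apply: measurable_funB.
  exact: (right_constant_measurable (fun i => alpha i 0) t_ge0 rcx).
apply: measurable_funM.
  exact: (right_constant_measurable (fun i => gamma i 0) t_ge0 rcx).
apply: subspace_continuous_measurable_fun => //.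
apply: continuous_subspaceW cM => s /=.
by rewrite !in_itv/= andbT => /andP[].
Qed.

Let measurable_psi_ m D : measurable_fun D (psi_ m).
Proof. by apply: measurable_sum => i; apply: measurable_funM. Qed.

Let psi_bounded : exists2 K : R, 0 <= K & forall s, 0 <= s -> s <= t ->
  `|psi s| <= K /\ forall m, `|psi_ m s| <= K.
Proof.
have [K K0 MK] := M_bounded.
pose A := \sum_i `|alpha i 0|.
have A0 : 0 <= A by rewrite sumr_ge0.
have alpha_le i : `|alpha i 0| <= A.
  by rewrite /A (bigD1 i)//= lerDl sumr_ge0.
have aux i s : 0 <= s -> s <= t -> `|alpha i 0 - gamma i 0 * M s| <= A + G * K.
  move=> s0 st; apply: le_trans (ler_normB _ _) _; apply: lerD => //.
  by rewrite normrM ger0_norm// ler_pM// MK.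
have AGK : 0 <= A + G * K by rewrite addr_ge0// mulr_ge0.
exists (A + G * K) => // s s0 st; split=> [|m]; first exact: aux.
apply: grid_sum_bound => //; first by rewrite tauN.
by move=> i iN; apply: aux => //; exact/tau_le/ltnW.
Qed.

Let psi_cvg s : 0 < s -> s <= t -> psi_ m s @[m --> \oo] --> psi s.
Proof.
move=> s0 st.
apply: (step_cvg tau0 tauS tauN tau_mesh mesh0 (c := c)) => // e e0.
have [e1 /= e10 H1] := rcx (ltW s0).
have [cMo _] := (proj1 (continuous_within_itvcyP 0 M)) cM.
have cMs : {for s, continuous M} by apply: cMo; rewrite in_itv/= s0.
have eG : 0 < e / (G + 1) by rewrite divr_gt0// ltr_wpDl.
have /cvgrPdist_le/(_ _ eG)[e2 /= e20 H2] := cMs.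
exists (Num.min e1 e2); first by rewrite lt_min e10.
move=> m i is_ si; rewrite lt_min => /andP[me1 me2].
have -> : c m i = alpha (x s) 0 - gamma (x s) 0 * M (tau m i).
  rewrite /c; have [->//|ne] := eqVneq (tau m i.+1) s.
  rewrite H1//=; last by rewrite lt_neqAle eq_sym ne.
  by rewrite /= distrC ger0_norm ?subr_ge0//; lra.
have -> : alpha (x s) 0 - gamma (x s) 0 * M (tau m i) - psi s =
    gamma (x s) 0 * (M s - M (tau m i)) by rewrite /psi; ring.
rewrite normrM ger0_norm//.
have H : `|M s - M (tau m i)| <= e / (G + 1).
  by apply: H2 => /=; rewrite ger0_norm ?subr_ge0 ?(ltW is_)//; lra.
apply: (@le_trans _ _ (G * (e / (G + 1)))); first by rewrite ler_pM.
by rewrite mulrCA ler_piMr ?(ltW e0)// ler_pdivrMr ?ltr_wpDl// mul1r lerDl.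
Qed.

Let ZS m := \int[lebesgue_measure]_(s in `[0, t]) `|psi s - psi_ m s|.

Let psi_integrable :
  (lebesgue_measure : measure (measurableTypeR R) R).-integrable `[0, t] (EFin \o psi).
Proof.
have [K K0 psiK] := psi_bounded.
by apply: (@integrable_itv0 _ t K) => // s s0 st; have [] := psiK s s0 st.
Qed.

Let psi_m_integrable m :
  (lebesgue_measure : measure (measurableTypeR R) R).-integrable `[0, t] (EFin \o psi_ m).
Proof.
have [K K0 psiK] := psi_bounded.
by apply: (@integrable_itv0 _ t K) => // s s0 st; have [] := psiK s s0 st.
Qed.

Let ZS_cvg0 : ZS m @[m --> \oo] --> 0.
Proof.
have [K K0 psiK] := psi_bounded.
have H := @bounded_convergence _ (measurableTypeR R) R lebesgue_measure _ (mI t)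
   (lebesgue_itv0_finite t) (fun m s => `|psi s - psi_ m s|) (cst 0) (K + K).
have {}H : (\int[lebesgue_measure]_(s in `[0%R, t]) (`|psi s - psi_ m s|)%:E)%E
    @[m --> \oo] --> 0%:E.
  suff -> : 0%:E = (\int[lebesgue_measure]_(s in `[0%R, t]) (cst (0 : R) s)%:E)%E.
    apply: H => //.
    - move=> m; apply: measurableT_comp => //.
      by apply: measurable_funB; [exact: measurable_psi|exact: measurable_psi_].
    - move=> m s /=; rewrite in_itv/= => /andP[s0 st]; rewrite normr_id.
      by have [h1 h2] := psiK s s0 st; apply: le_trans (ler_normB _ _) _; apply: lerD.
    - apply: ae_neq0 => s s0 /=; rewrite in_itv/= => /andP[s0' st].
      rewrite -(normr0 R) -(subrr (psi s)); apply: cvg_norm.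
      apply: cvgB; first exact: cvg_cst.
      by apply: psi_cvg => //; rewrite lt_neqAle eq_sym s0.
  by rewrite integral0.
exact: (fine_cvg H).
Qed.

Let cell_integral m l : (l <= N m)%N ->
  \int[lebesgue_measure]_(s in `[0, tau m l]) psi_ m s = \sum_(i < l) dt m i * c m i.
Proof.
move=> lN.
have -> : \int[lebesgue_measure]_(s in `[0, tau m l]) psi_ m s =
    \int[lebesgue_measure]_(s in `[0, tau m l])
      \sum_(i < l) c m i * \1_(`]tau m i, tau m i.+1]%classic) s.
  apply: eq_Rintegral => s; rewrite inE/= in_itv/= => /andP[s0 st].
  by apply: grid_sum_trunc.
have H i : (lebesgue_measure : measure (measurableTypeR R) R).-integrable
    `[0, tau m l] (EFin \o \1_(`]tau m i, tau m i.+1]%classic : set R)).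
  apply: (@integrable_itv0 _ _ 1) => // s _ _.
  by rewrite indicE ger0_norm// lern1 leq_b1.
rewrite (proj2 (@Rintegral_sum _ (measurableTypeR R) R lebesgue_measure 'I_l _
  (fun i s => c m i * \1_(`]tau m i, tau m i.+1]%classic) s) (mI _) _))//.
- apply: eq_bigr => i _; rewrite RintegralZl ?H// mulrC; congr (_ * _).
  rewrite /Rintegral integral_indic//.
  rewrite (_ : _ `&` _ = `]tau m i, tau m i.+1]%classic); last first.
    apply/seteqP; split => [s []//|s /= h]; split=> //; move: h.
    rewrite /= !in_itv/= => /andP[is_ si]; rewrite (le_trans _ (ltW is_))//.
    by rewrite (le_trans si)//; exact: nondecreasing_grid.
  transitivity (fine (lebesgue_measure `]tau m i, tau m i.+1]%classic)); first by [].
  rewrite lebesgue_measure_itv/= lte_fin /dt.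
  by case: ltgtP (tauS m i) => //= -> _; rewrite subrr.
- move=> i; apply: (@integrable_itv0 _ _ `|c m i|) => [|s _ _].
    by apply: measurable_funM.
  by rewrite normrM ler_piMr// indicE ger0_norm// lern1 leq_b1.
Qed.

Let drift_defect m l : (l <= N m)%N ->
  `|\int[lebesgue_measure]_(s in `[0, tau m l]) psi s - \sum_(i < l) dt m i * c m i| <= ZS m.
Proof.
move=> lN; rewrite -cell_integral//.
have sub : `[0, tau m l]%classic `<=` `[0, t]%classic.
  move=> s /=; rewrite !in_itv/= => /andP[-> sl] /=; exact: le_trans (tau_le lN).
have i1 := integrableS (mI t) (mI _) sub psi_integrable.
have i2 := integrableS (mI t) (mI _) sub (psi_m_integrable m).
rewrite -(RintegralB _ i1 i2)//.
have i3 : (lebesgue_measure : measure (measurableTypeR R) R).-integrable `[0, tau m l]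
    (EFin \o (fun s => psi s - psi_ m s)).
  by apply: (integrableB _ i1 i2).
apply: le_trans (le_normr_Rintegral _ i3) _ => //.
have i4 := integrableB (mI t) psi_integrable (psi_m_integrable m).
rewrite /ZS /Rintegral fine_le//.
- by apply: integrable_fin_num => //; exact: (integrable_abse i3).
- by apply: integrable_fin_num => //; exact: (integrable_abse i4).
- apply: ge0_subset_integral => //.
  by case/integrableP: (integrable_abse i4).
Qed.

Let err m l := M (tau m l) - E m l.

Let ESum m l : E m l = m0 +
  \sum_(i < l) dt m i * (alpha (x (tau m i.+1)) 0 - gamma (x (tau m i.+1)) 0 * E m i) +
  \sum_(i < l) sigma (x (tau m i.+1)) 0 * (b (tau m i.+1) - b (tau m i)).
Proof.
elim: l => [|l IH]; first by rewrite !big_ord0 !addr0.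
by rewrite !big_ord_recr/= ES mulrBl mul1r {1}IH /dt; ring.
Qed.

(** The terms in alpha cancel and the gamma terms leave the errors themselves; this is the form
    required by [discrete_gronwall]. *)
Let errE m l : (l <= N m)%N -> err m l =
  (\int[lebesgue_measure]_(s in `[0, tau m l]) psi s - \sum_(i < l) dt m i * c m i +
    noise_defect m l) - \sum_(i < l) (dt m i * gamma (x (tau m i.+1)) 0) * err m i.
Proof.
move=> lN; rewrite /err {1}ME// {1}ESum /noise_defect -/psi.
have -> : \sum_(i < l) dt m i * (alpha (x (tau m i.+1)) 0 - gamma (x (tau m i.+1)) 0 * E m i) =
   \sum_(i < l) dt m i * c m i +
   \sum_(i < l) (dt m i * gamma (x (tau m i.+1)) 0) * (M (tau m i) - E m i).
  by rewrite -big_split/=; apply: eq_bigr => i _; rewrite /c; ring.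
by rewrite /psi; ring.
Qed.

Let dt_sum m : \sum_(i < N m) dt m i = t.
Proof.
rewrite -(big_mkord xpredT (dt m)) telescope_sumr// tauN tau0 subr0//.
Qed.

Lemma euler_pathwise : noise_energy m @[m --> \oo] --> 0 ->
  E m (N m) @[m --> \oo] --> M t.
Proof.
move=> W0.
(* The inequality |y| <= e + y^2 / e trades the absolute defect for its square; [e] stays free until
   the end, where it is chosen so that the limit of the bound is half of [eps]. *)
have bound e m : 0 < e -> `|M t - E m (N m)| <=
    (1 + G * t) * (ZS m + e) + (1 + G) * noise_energy m / e.
  move=> e0.
  have D l : (l <= N m)%N ->
      `|\int[lebesgue_measure]_(s in `[0, tau m l]) psi s - \sum_(i < l) dt m i * c m i +
      noise_defect m l| <= ZS m + e + noise_defect m l ^+ 2 / e.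
    move=> lN; apply: le_trans (ler_normD _ _) _; rewrite -addrA lerD ?drift_defect//.
    set y := noise_defect m l; rewrite -(real_normK (num_real y)).
    rewrite -(ler_pM2r e0) mulrDl divfK ?gt_eqF//.
    by have := sqr_ge0 (`|y| - e); nra.
  have q01 k : (k < N m)%N -> 0 <= dt m k * gamma (x (tau m k.+1)) 0 <= 1.
    move=> kN; rewrite mulr_ge0//=; apply: le_trans (mesh_gamma m).
    rewrite mulrC; apply: ler_pM => //; exact: tau_mesh.
  have := @discrete_gronwall _ (err m)
    (fun l => \int[lebesgue_measure]_(s in `[0, tau m l]) psi s - \sum_(i < l) dt m i * c m i +
      noise_defect m l) (fun i => dt m i * gamma (x (tau m i.+1)) 0) (N m) q01 (errE (m := m)).
  rewrite {1}/err tauN => /le_trans; apply.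
  have s1 : \sum_(k < N m) dt m k * gamma (x (tau m k.+1)) 0 *
      `|\int[lebesgue_measure]_(s in `[0, tau m k]) psi s -
          \sum_(i < k) dt m i * c m i + noise_defect m k| <=
      \sum_(k < N m) (G * (ZS m + e) * dt m k + G / e * (dt m k * noise_defect m k ^+ 2)).
    apply: ler_sum => k _.
    apply: (@le_trans _ _ (dt m k * G * (ZS m + e + noise_defect m k ^+ 2 / e))).
      apply: ler_pM => //; first by rewrite mulr_ge0.
        by rewrite ler_wpM2l.
      by apply: D; exact: ltnW.
    by rewrite le_eqVlt; apply/orP; left; apply/eqP; ring.
  move: s1; rewrite big_split/= -!mulr_sumr dt_sum => s1.
  have := lerD (D _ (leqnn _)) s1; rewrite tauN => /le_trans; apply.
  have S0 : 0 <= \sum_(i < N m) dt m i * noise_defect m i ^+ 2.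
    by apply: sumr_ge0 => k _; rewrite mulr_ge0// sqr_ge0.
  rewrite /noise_energy.
  have y0 := sqr_ge0 (noise_defect m (N m)).
  move: S0 y0; move: (\sum_(i < N m) _) => S; move: (_ ^+ 2) => y S0 y0.
  rewrite -subr_ge0.
  have -> : (1 + G * t) * (ZS m + e) + (1 + G) * (y + S) / e -
    (ZS m + e + y / e + (G * (ZS m + e) * t + G / e * S)) = (G * y + S) / e by ring.
  by rewrite divr_ge0 ?(ltW e0)// addr_ge0// mulr_ge0.
apply/cvgrPdist_le => eps eps0.
pose e := eps / (2 * (1 + G * t)).
have Gt : 0 < 1 + G * t by rewrite ltr_wpDr// mulr_ge0.
have e0 : 0 < e by rewrite divr_gt0// mulr_gt0.
have lim : (1 + G * t) * (ZS m + e) + (1 + G) * noise_energy m / e @[m --> \oo] -->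
    (1 + G * t) * (0 + e) + (1 + G) * 0 / e.
  apply: cvgD.
    by apply: cvgMr; apply: cvgD => //; exact: cvg_cst.
  by apply: cvgMl; apply: cvgMr.
have lt : (1 + G * t) * (0 + e) + (1 + G) * 0 / e < eps.
  have -> : (1 + G * t) * (0 + e) + (1 + G) * 0 / e = eps / 2.
    by rewrite mulr0 mul0r addr0 add0r /e; field; rewrite gt_eqF.
  by rewrite ltr_pdivrMr// ltr_pMr// ltr1n.
near=> m; apply: le_trans (bound e m e0) _.
by near: m; exact: (cvgr_le _ lim _ lt).
Unshelve. all: by end_near. Qed.

End pathwise.

(** * Almost sure convergence along a subsequence *)

Section strong_convergence.
Context {disp : measure_display} {T : measurableType disp} {R : realType}.
Variables (P : probability T R) (d : nat) (Q : 'M[R]_d).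
Variables (X : R -> T -> 'I_d) (B M I : R -> T -> R).
Variables (alpha gamma sigma : 'cV[R]_d) (m0 : R).
Hypothesis mcX : is_markov_chain P Q X.
Hypothesis bmB : is_brownian_motion P B.
Hypothesis indepXB : independent P (sigma_process setT `[0, +oo[ X)
                                   (sigma_process measurable `[0, +oo[ B).
Hypothesis gamma_ge0 : forall i, 0 <= gamma i 0.
Hypothesis itoI : forall t, 0 <= t -> is_ito_integral P (joint_filtration X B) B
  (fun s w => sigma (X s w) 0) t (I t).
Hypothesis ME : {ae P, forall w,
  {within `[0, +oo[, continuous (M ^~ w)} /\
  forall t, 0 <= t -> M t w = m0
    + \int[lebesgue_measure]_(s in `[0, t]) (alpha (X s w) 0 - gamma (X s w) 0 * M s w)
    + I t w}.

Variables (tau : nat -> nat -> R) (N : nat -> nat) (mesh : nat -> R) (t : R).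
Hypothesis tau0 : forall m, tau m 0%N = 0.
Hypothesis tauS : forall m k, tau m k <= tau m k.+1.
Hypothesis tauN : forall m, tau m (N m) = t.
Hypothesis tau_mesh : forall m k, tau m k.+1 - tau m k <= mesh m.
Hypothesis mesh0 : mesh m @[m --> \oo] --> 0.
Hypothesis mesh_gamma : forall m, (\sum_i gamma i 0) * mesh m <= 1.

Let mX (s : R) i : 0 <= s -> measurable (X s @^-1` [set i]).
Proof. by case: mcX => + _ _; exact. Qed.

Let rcX w s : 0 <= s -> \forall u \near s^'+, X u w = X s w.
Proof. by case: mcX => _ + _; exact. Qed.

Let tau_ge0 m k : 0 <= tau m k.
Proof. by rewrite -(tau0 m); exact: nondecreasing_grid. Qed.

Let t_ge0 : 0 <= t. Proof. by rewrite -(tauN 0). Qed.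

Let tau_le m k : (k <= N m)%N -> tau m k <= t.
Proof. by move=> kN; rewrite -(tauN m); exact: nondecreasing_grid. Qed.

Let mI (s : R) : @measurable _ (measurableTypeR R) `[0, s]%classic.
Proof. exact: measurable_itv. Qed.

Let sX s w := sigma (X s w) 0.

Let step m n s w :=
  \sum_(i < n) sX (tau m i.+1) w * \1_(`]tau m i, tau m i.+1]%classic) s.

Let S := \sum_i `|sigma i 0|.

Let sX_le s w : `|sX s w| <= S.
Proof. by rewrite /S (bigD1 (X s w))//= lerDl sumr_ge0. Qed.

Let S_ge0 : 0 <= S. Proof. by rewrite sumr_ge0. Qed.

Let measurable_sX s : 0 <= s -> measurable_fun setT (sX s).
Proof.
move=> s0; apply: (@enlarged_measurable_fun _ _ _ P _ X B mX bmB s).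
exact: (@enlarged_measurable_chain _ _ _ _ X B _ _ (fun i => sigma i 0)).
Qed.

Let joint_sX s : 0 <= s -> joint_measurable s sX.
Proof. by move=> s0; case: (itoI s0). Qed.

Let joint_err m n s : 0 <= s -> joint_measurable s (fun u w => (step m n u w - sX u w) ^+ 2).
Proof.
move=> s0; apply: joint_measurable_sqr; apply: joint_measurableB; last exact: joint_sX.
by apply: joint_measurable_step => i; exact: measurable_sX.
Qed.

Let errF m w : \bar R :=
  (\int[lebesgue_measure]_(s in `[0%R, t]) ((step m (N m) s w - sX s w) ^+ 2)%:E)%E.

Let err_le m s w : 0 <= s -> s <= t -> `|(step m (N m) s w - sX s w) ^+ 2| <= (2 * S) ^+ 2.
Proof.
move=> s0 st; rewrite normrX lerXn2r ?nnegrE ?mulr_ge0//.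
apply: le_trans (ler_normB _ _) _; rewrite mulr_natl mulr2n lerD//.
by apply: (grid_sum_bound (c := fun i => sX (tau m i.+1) w)) => //; rewrite tauN.
Qed.

Let errF_ge0 m w : (0 <= errF m w)%E.
Proof. by apply: integral_ge0 => s _; rewrite lee_fin sqr_ge0. Qed.

Let errF_le m w : (errF m w <= ((2 * S) ^+ 2 * t)%:E)%E.
Proof.
apply: (@le_trans _ _ (\int[lebesgue_measure]_(s in `[0%R, t]) (cst ((2 * S) ^+ 2)%:E s))%E).
  apply: ge0_le_integral => //.
  - by move=> s _; rewrite lee_fin sqr_ge0.
  - by apply/measurable_EFinP;
    exact: (@joint_measurable_section _ _ _ t _ w (joint_err m (N m) t_ge0)).
  - move=> s /=; rewrite in_itv/= => /andP[s0 st]; rewrite lee_fin.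
    by apply: le_trans (err_le _ _ s0 st); exact: ler_norm.
rewrite integral_cst//.
move: ((2 * S) ^+ 2) => c; rewrite EFinM.
suff -> : (lebesgue_measure : measure (measurableTypeR R) R) `[0%R, t]%classic = t%:E by [].
transitivity (lebesgue_measure `[0%R, t]%classic); first by [].
rewrite lebesgue_measure_itv/= lte_fin; case: ltgtP t_ge0 => // [_|<-] _ //.
by rewrite sube0.
Qed.

Let errF_fin m w : errF m w \is a fin_num.
Proof. by rewrite ge0_fin_numE//; exact: le_lt_trans (errF_le m w) (ltry _). Qed.

Let errF_cvg w : errF m w @[m --> \oo] --> 0%E.
Proof.
have H := @bounded_convergence _ (measurableTypeR R) R lebesgue_measure _ (mI t)
   (lebesgue_itv0_finite t) (fun m s => (step m (N m) s w - sX s w) ^+ 2) (cst 0) ((2 * S) ^+ 2).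
rewrite -[0%E](@integral0 _ _ _ (lebesgue_measure : measure (measurableTypeR R) R) `[0%R, t]).
apply: H => //.
- by move=> m;
    exact: (@joint_measurable_section _ _ _ t _ w (joint_err m (N m) t_ge0)).
- by move=> m s /=; rewrite in_itv/= => /andP[s0 st]; exact: err_le.
- apply: ae_neq0 => s s0 /=; rewrite in_itv/= => /andP[s0' st].
  rewrite -(mulr0 0); under eq_fun do rewrite expr2.
  suff H0 : step m (N m) s w - sX s w @[m --> \oo] --> 0 by apply: cvgM.
  rewrite -(subrr (sX s w)); apply: cvgB; last exact: cvg_cst.
  apply: (step_cvg_right tau0 tauS tauN tau_mesh mesh0
    (phi := fun i => sigma i 0) (x := X ^~ w)) => //.
    by rewrite lt_neqAle eq_sym s0.
  exact: rcX.
Qed.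

Let measurable_errF m : measurable_fun setT (errF m).
Proof. by apply: joint_measurable_integral; [exact: joint_err|move=> *; exact: sqr_ge0]. Qed.

Let eta m := (\int[P]_w errF m w)%E.

Let eta_ge0 m : (0 <= eta m)%E. Proof. exact: integral_ge0. Qed.

Let eta_cvg : eta m @[m --> \oo] --> 0%E.
Proof.
have H := @bounded_convergence _ T R P _ measurableT _ (fun m w => fine (errF m w)) (cst 0)
  ((2 * S) ^+ 2 * t).
have -> : eta = (fun m => \int[P]_w (fine (errF m w))%:E)%E.
  by apply/funext => m; apply: eq_integral => w _; rewrite fineK.
rewrite -[0%E](@integral0 _ _ _ P [set: T]).
apply: H => //.
- by apply: (le_lt_trans (probability_le1 P measurableT)); rewrite ltry.
- by move=> m; apply: measurableT_comp => //; exact: measurable_errF.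
- move=> m w _; rewrite ger0_norm ?fine_ge0//.
  by rewrite -lee_fin fineK//; exact: errF_le.
- by apply: (aeW P) => w _; exact: (fine_cvg (errF_cvg w)).
Qed.

Let defect m l w := noise_defect sigma (X ^~ w) (B ^~ w) (I ^~ w) tau m l.

Let measurable_defect m l : measurable_fun setT (defect m l).
Proof.
apply: measurable_funB; first by case: (itoI (tau_ge0 m l)).
apply: measurable_sum => i; apply: measurable_funM; first exact: measurable_sX.
by case: bmB => mB _ _ _ _; apply: measurable_funB; exact: mB.
Qed.

(** Only cells up to [tau m l] matter, and the integral of a square over [0, tau l] is at most that
    over [0, t]; so one number [eta m] serves all grid times. *)
Let defect_le m l : (l <= N m)%N -> (\int[P]_w (defect m l w ^+ 2)%:E <= 4%:E * eta m)%E.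
Proof.
move=> lN.
have := @ito_integral_close _ _ _ P d X B mX bmB indepXB _ (tau m l) (I (tau m l)) 'I_l
  (fun i => tau m i) (fun i => tau m i.+1) (fun i => sX (tau m i.+1)) (itoI (tau_ge0 m l)).
move=> /(_ (fun i => tau_ge0 m i) (fun i => tauS m i)) H.
apply: le_trans (H _ _ _) _.
- by move=> i; exact: nondecreasing_grid.
- by move=> i; exact: (@enlarged_measurable_chain _ _ _ _ X B _ _ (fun i => sigma i 0)).
- by move=> i; exists S => w; exact: sX_le.
apply: lee_wpmul2l => //; apply: ge0_le_integral => //.
- by move=> w _; apply: integral_ge0 => s _; rewrite lee_fin sqr_ge0.
- apply: (@joint_measurable_integral _ _ _ (tau m l) (fun s w => (step m l s w - sX s w) ^+ 2)).
    exact: joint_err.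
  by move=> *; exact: sqr_ge0.
move=> w _.
rewrite (_ : integral _ _ _ = \int[lebesgue_measure]_(s in `[0%R, tau m l])
    ((step m (N m) s w - sX s w) ^+ 2)%:E)%E; last first.
  apply: eq_integral => s; rewrite inE/= in_itv/= => /andP[s0 sl].
  by rewrite /step (grid_sum_trunc (fun i => sX (tau m i.+1) w) lN).
apply: ge0_subset_integral => //.
- by apply/measurable_EFinP;
    exact: (@joint_measurable_section _ _ _ t _ w (joint_err m (N m) t_ge0)).
- by move=> s _; rewrite lee_fin sqr_ge0.
- by move=> s /=; rewrite !in_itv/= => /andP[-> sl] /=; exact: le_trans (tau_le lN).
Qed.

Let energy m w := noise_energy sigma (X ^~ w) (B ^~ w) (I ^~ w) tau N m.

Let dt_ge0 m k : 0 <= tau m k.+1 - tau m k. Proof. by rewrite subr_ge0. Qed.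

Let energy_ge0 m w : 0 <= energy m w.
Proof.
by rewrite addr_ge0 ?sqr_ge0// sumr_ge0// => k _; rewrite mulr_ge0 ?sqr_ge0.
Qed.

Let measurable_energy m : measurable_fun setT (energy m).
Proof.
apply: measurable_funD; first by apply: measurable_funX; exact: measurable_defect.
apply: measurable_sum => k; apply: measurable_funM => //.
by apply: measurable_funX; exact: measurable_defect.
Qed.

(** The 4 is that of [ito_integral_close]; the 1 comes from the final defect and [t] from the total
    length of the steps. *)
Let energy_le m : (\int[P]_w (energy m w)%:E <= (4 * (1 + t))%:E * eta m)%E.
Proof.
have md l : measurable_fun setT (fun w => (defect m l w ^+ 2)%:E).
  by apply/measurable_EFinP; apply: measurable_funX; exact: measurable_defect.
have E w : (energy m w)%:E = ((defect m (N m) w ^+ 2)%:E +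
   \sum_(k < N m) ((tau m k.+1 - tau m k)%:E * (defect m k w ^+ 2)%:E))%E.
  by rewrite /energy /noise_energy EFinD -sumEFin.
under eq_integral do rewrite E.
rewrite ge0_integralD//; last first.
- by apply: emeasurable_sum => k; exact: measurable_funeM.
- by move=> w _; apply: sume_ge0 => k _; rewrite mule_ge0// lee_fin ?sqr_ge0.
- by move=> w _; rewrite lee_fin sqr_ge0.
rewrite ge0_integral_sum//; last first.
- by move=> k w _; rewrite mule_ge0// lee_fin ?sqr_ge0.
- by move=> k; exact: measurable_funeM.
rewrite mulrDr mulr1 EFinD ge0_muleDl ?lee_fin ?mulr_ge0//.
apply: leeD; first exact: defect_le.
apply: (@le_trans _ _ (\sum_(k < N m) ((tau m k.+1 - tau m k)%:E * (4%:E * eta m)))%E).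
  apply: lee_sum => k _; rewrite ge0_integralZl//; last 2 first.
  - by move=> w _; rewrite lee_fin sqr_ge0.
  - by rewrite lee_fin.
  by apply: lee_wpmul2l; [rewrite lee_fin|apply: defect_le; exact: ltnW].
rewrite -ge0_sume_distrl; last by move=> k _; rewrite lee_fin.
rewrite sumEFin -(big_mkord xpredT (fun k => tau m k.+1 - tau m k)) telescope_sumr//.
rewrite tauN tau0 subr0.
by rewrite muleA (muleC t%:E).
Qed.

(** Indices are chosen so that the mean energies are summable; the energies then vanish almost
    surely and [euler_pathwise] applies to each such path. The bound [k <= phi k] is enough to carry
    limits along [phi]. *)
Lemma euler_cvg_ae : exists phi : nat -> nat, (forall k, (k <= phi k)%N) /\
  {ae P, forall w, euler X B alpha gamma sigma m0 (tau (phi k)) (N (phi k)) w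
    @[k --> \oo] --> M t w}.
Proof.
have sel k : exists m, (k <= m)%N /\
    (\int[P]_w (energy m w)%:E <= (1 / (2 ^ (k + 1))%:R)%:E)%E.
  have lim : ((4 * (1 + t))%:E * eta m)%E @[m --> \oo] --> 0%E.
    rewrite -(mule0 (4 * (1 + t))%:E); apply: cvgeZl => //; exact: eta_cvg.
  have e0 : 0 < 1 / (2 ^ (k + 1))%:R :> R by rewrite divr_gt0// ltr0n expn_gt0.
  have /fine_cvgP[fin fc] := lim.
  near \oo => m; exists m; split; first by near: m; exact: nbhs_infty_ge.
  apply: le_trans (energy_le m) _.
  have fm : ((4 * (1 + t))%:E * eta m)%E \is a fin_num by near: m; exact: fin.
  rewrite -[leLHS]fineK// lee_fin.
  by near: m; exact: (cvgr_le _ fc _ e0).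
have [phi phiP] := choice sel.
exists phi; split; first by move=> k; have [] := phiP k.
have W0 : {ae P, forall w, energy (phi k) w @[k --> \oo] --> 0}.
  apply: (summable_cvg_ae (W := fun k => energy (phi k))).
  - by move=> k; exact: measurable_energy.
  - by move=> k w; exact: energy_ge0.
  - by move=> k; have [] := phiP k.
apply: filterS2 ME W0 => w [cM MEw] W0.
have phioo : phi k @[k --> \oo] --> \oo.
  apply/cvgnyPge => A; near=> k; apply: leq_trans (proj1 (phiP k)).
  by near: k; exact: nbhs_infty_ge.
apply: (@euler_pathwise _ _ alpha gamma sigma m0 (X ^~ w) (B ^~ w) (M ^~ w) (I ^~ w)
  gamma_ge0 (rcX w) cM MEw (fun k => tau (phi k)) (fun k => N (phi k)) (fun k => mesh (phi k)) t
  _ _ _ _ _ _ (fun k l => euler X B alpha gamma sigma m0 (tau (phi k)) l w)) => //.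
exact: (cvg_comp phi mesh phioo mesh0).
Unshelve. all: by end_near. Qed.

End strong_convergence.

(** * Passage to the limit *)

Section laplace_convergence.
Context {disp : measure_display} {T : measurableType disp} {R : realType}.
Variables (P : probability T R) (d : nat) (Q : 'M[R]_d).
Variables (X : R -> T -> 'I_d) (B M : R -> T -> R).
Variables (alpha gamma sigma : 'cV[R]_d) (m0 : R).
Hypothesis mcX : is_markov_chain P Q X.
Hypothesis gamma_ge0 : forall i, 0 <= gamma i 0.

Lemma normr_fine_prob_le1 (A : set T) : measurable A -> `|fine (P A)| <= 1.
Proof.
move=> mA; rewrite ger0_norm ?fine_ge0//.
by rewrite -lee_fin fineK ?fin_num_measure// probability_le1.
Qed.

Lemma euler_laplace_bound K : 0 <= K -> exists2 C : R, 0 <= C & exists2 N0 : R, 0 <= N0 &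
  forall tau, tau 0%N = 0 -> (forall k, 0 <= tau k.+1 - tau k <= 1) ->
  (forall k, (\sum_i gamma i 0) * (tau k.+1 - tau k) <= 1) ->
  forall k, supb K (N0 * expR (C * tau k)) (euler_laplace P Q X alpha gamma sigma m0 tau k) /\
    lipb K (N0 * expR (C * tau k)) (euler_laplace P Q X alpha gamma sigma m0 tau k).
Proof.
move=> K0; have [C C0 HC] := euler_op_stable Q alpha sigma gamma_ge0 K0.
have mX0 j : measurable (X 0 @^-1` [set j]) by case: mcX => + _ _; exact.
pose c := K * `|m0|.
have c0 : 0 <= c by rewrite mulr_ge0.
(* The two summands are the bound and the Lipschitz constant of the initial transform on the
   window. *)
exists C => //; exists (expR c + expR (3 * c) * `|m0|).
  by rewrite addr_ge0 ?mulr_ge0 ?expR_ge0.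
set N0 := _ + _; have N00 : 0 <= N0 by rewrite addr_ge0 ?mulr_ge0 ?expR_ge0.
move=> tau tau0 tauS tauG; elim => [|k [IH1 IH2]].
  rewrite tau0 mulr0 expR0 mulr1 /=; split => [j x xK|j x y xK yK]; rewrite ?tau0.
    rewrite normrM -[leRHS]mulr1 ler_pM ?normr_fine_prob_le1//.
    rewrite ger0_norm ?expR_ge0// /N0 -[leLHS]addr0 lerD ?mulr_ge0 ?expR_ge0// ler_expR.
    by apply: le_trans (ler_norm _) _; rewrite normrN normrM ler_wpM2r.
  rewrite -mulrBl normrM -[leRHS]mulr1 ler_pM ?normr_fine_prob_le1//.
  apply: le_trans (expR_lip (c := c) _ _) _; rewrite ?normrN ?normrM ?ler_wpM2r//.
  have -> : - (x * m0) - - (y * m0) = - ((x - y) * m0) by ring.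
  by rewrite normrN normrM mulrCA mulrC ler_wpM2r// /N0 lerDr expR_ge0.
have /andP[h0 h1] := tauS k.
have [H1 H2] := HC _ _ _ h0 h1 (tauG k) (mulr_ge0 N00 (expR_ge0 _)) IH1.
have le : N0 * expR (C * tau k) * (1 + C * (tau k.+1 - tau k)) <= N0 * expR (C * tau k.+1).
  have -> : C * tau k.+1 = C * tau k + C * (tau k.+1 - tau k) by ring.
  by rewrite -mulrA expRD ler_wpM2l// ler_wpM2l ?expR_ge0// expR_ge1Dx.
split => [j x xK|j x y xK yK] /=; first exact: le_trans (H1 j x xK) le.
by apply: le_trans (H2 IH2 j x y xK yK) _; rewrite ler_wpM2r.
Qed.

Hypothesis bmB : is_brownian_motion P B.
Hypothesis indepXB : independent P (sigma_process setT `[0, +oo[ X)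
                                   (sigma_process measurable `[0, +oo[ B).
Hypothesis mmouM : is_mmou P alpha gamma sigma m0 X B M.

Variables (tau : nat -> nat -> R) (N : nat -> nat) (mesh : nat -> R) (t : R).
Hypothesis tau0 : forall m, tau m 0%N = 0.
Hypothesis tauS : forall m k, tau m k <= tau m k.+1.
Hypothesis tauN : forall m, tau m (N m) = t.
Hypothesis tau_mesh : forall m k, tau m k.+1 - tau m k <= mesh m.
Hypothesis mesh0 : mesh m @[m --> \oo] --> 0.
Hypothesis mesh1 : forall m, mesh m <= 1.
Hypothesis mesh_gamma : forall m, (\sum_i gamma i 0) * mesh m <= 1.

(** The subsequence comes from paths alone, hence serves all [theta] and [j]. The squared integrand
    at [theta] is the integrand at [2 * theta], so the mesh-free bound on the window [|2 * theta|]
    is the second moment bound of [vitali_sqr]. *)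
Lemma euler_laplace_cvg : exists phi : nat -> nat, (forall k, (k <= phi k)%N) /\
  forall theta j, P.-integrable setT (EFin \o laplace_integrand X M theta t j) /\
    euler_laplace P Q X alpha gamma sigma m0 (tau (phi k)) (N (phi k)) j theta
      @[k --> \oo] --> laplace_vec P X M theta t j 0.
Proof.
have [mM [I [itoI ME]]] := mmouM.
have t0 : 0 <= t by rewrite -(tauN 0) -(tau0 0); exact: nondecreasing_grid.
have [phi [phik ae]] := euler_cvg_ae mcX bmB indepXB gamma_ge0 itoI ME
  tau0 tauS tauN tau_mesh mesh0 mesh_gamma.
exists phi; split => // theta j.
have [C C0 [N0 N00 bound]] := euler_laplace_bound (normr_ge0 (2 * theta)).
have mX : measurable (X t @^-1` [set j]) by case: mcX => + _ _; exact.
have indE w : (X t w == j)%:R = \1_(X t @^-1` [set j]) w :> R.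
  by rewrite indicE; case: eqP => ?; [rewrite mem_set|rewrite memNset].
pose f k w := expR (- (theta * euler X B alpha gamma sigma m0 (tau (phi k)) (N (phi k)) w)) *
  \1_(X t @^-1` [set j]) w.
have fE k th : P.-integrable setT (fun w =>
      (expR (- (th * euler X B alpha gamma sigma m0 (tau (phi k)) (N (phi k)) w)) *
        \1_(X t @^-1` [set j]) w)%:E) /\
    \int[P]_w (expR (- (th * euler X B alpha gamma sigma m0 (tau (phi k)) (N (phi k)) w)) *
        \1_(X t @^-1` [set j]) w) =
    euler_laplace P Q X alpha gamma sigma m0 (tau (phi k)) (N (phi k)) j th.
  have := euler_laplaceE alpha gamma sigma m0 mcX bmB indepXB (tau0 (phi k)) (tauS (phi k))
    (N (phi k)) th j.
  rewrite tauN; under eq_fun do rewrite indE.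
  by move=> [h <-]; split => //; apply: eq_Rintegral => w _; rewrite indE.
have [] := @vitali_sqr _ _ _ P f (laplace_integrand X M theta t j) (N0 * expR (C * t)).
- by move=> k; apply/measurable_EFinP; exact: (measurable_int _ (proj1 (fE k theta))).
- by move=> k w; rewrite mulr_ge0 ?expR_ge0.
- apply: filterS ae => w H; apply: cvgM; last exact: cvg_cst.
  apply: continuous_cvg; first exact: continuous_expR.
  by apply: cvgN; apply: cvgM => //; exact: cvg_cst.
- apply: measurable_funM => //.
  apply: measurableT_comp => //; apply: measurableT_comp => //.
  by apply: measurable_funM => //; exact: mM.
- by move=> w; rewrite mulr_ge0 ?expR_ge0.
- move=> k; have [h hE] := fE k (2 * theta).
  rewrite (_ : (\int[P]_w (f k w ^+ 2)%:E)%E = (\int[P]_w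
      (expR (- ((2 * theta) * euler X B alpha gamma sigma m0 (tau (phi k)) (N (phi k)) w)) *
        \1_(X t @^-1` [set j]) w)%:E)%E); last first.
    apply: eq_integral => w _; rewrite /f exprMn -expRM_natl; congr (expR _ * _)%:E; first by ring.
    by rewrite indicE; case: (_ \in _); rewrite ?expr1n ?expr0n.
  rewrite -[leLHS]fineK ?integrable_fin_num// lee_fin.
  move: hE; rewrite /Rintegral => ->.
  apply: le_trans (ler_norm _) _.
  have [] := bound (tau (phi k)) (tau0 _) _ _ (N (phi k)).
  + move=> l; rewrite subr_ge0 tauS/=; exact: le_trans (tau_mesh _ _) (mesh1 _).
  + move=> l; apply: le_trans (mesh_gamma (phi k)); rewrite ler_wpM2l//.
    by rewrite sumr_ge0.
  + by rewrite tauN => + _; apply.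
move=> ig fg; split=> //.
have -> : laplace_vec P X M theta t j 0 = \int[P]_w laplace_integrand X M theta t j w.
  by rewrite mxE unlock.
rewrite (_ : (fun k => _) = (fun k => \int[P]_w f k w))//.
by apply/funext => k; rewrite -(proj2 (fE k theta)).
Qed.

End laplace_convergence.

Section two_piece_grid.
Context {R : realType}.
Implicit Types (t h : R) (m k : nat).

(** First [m] steps of length t / m, then steps of length h / m from index [m] on; it is defined for
    every index, as the scheme requires. *)
Definition two_piece_grid t h m k : R :=
  (minn k m)%:R * (t / m%:R) + (k - m)%:R * (h / m%:R).

Lemma two_piece_grid0 t h m : two_piece_grid t h m 0 = 0.
Proof. by rewrite /two_piece_grid min0n sub0n !mul0r addr0. Qed.

Lemma two_piece_grid_mid t h m : (0 < m)%N -> two_piece_grid t h m m = t.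
Proof.
move=> m0; rewrite /two_piece_grid minnn subnn mul0r addr0.
by rewrite mulrC divfK// pnatr_eq0 -lt0n.
Qed.

Lemma two_piece_grid_end t h m : (0 < m)%N -> two_piece_grid t h m (m + m) = t + h.
Proof.
move=> m0; rewrite /two_piece_grid (minn_idPr _) ?leq_addr// addnK.
by rewrite ![m%:R * _]mulrC !divfK// pnatr_eq0 -lt0n.
Qed.

Lemma two_piece_grid_step t h m k : two_piece_grid t h m k.+1 - two_piece_grid t h m k =
  (if (k < m)%N then t else h) / m%:R.
Proof.
rewrite /two_piece_grid; case: ltnP => km.
  rewrite ?(minn_idPl km) ?(minn_idPl (ltnW km)) ?(minn_idPl (km : (k.+1 <= m)%N)).
  have -> : (k.+1 - m = 0)%N by apply/eqP.
  have -> : (k - m = 0)%N by apply/eqP; exact: ltnW.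
  by rewrite -natr1; ring.
by rewrite ?(minn_idPr km) (minn_idPr (leqW km)) subSn// -natr1; ring.
Qed.

End two_piece_grid.

Section laplace_semigroup.
Context {disp : measure_display} {T : measurableType disp} {R : realType}.
Variables (P : probability T R) (d : nat) (Q : 'M[R]_d).
Variables (X : R -> T -> 'I_d) (B M : R -> T -> R).
Variables (alpha gamma sigma : 'cV[R]_d) (m0 : R).
Hypothesis mcX : is_markov_chain P Q X.
Hypothesis gamma_ge0 : forall i, 0 <= gamma i 0.
Hypothesis bmB : is_brownian_motion P B.
Hypothesis indepXB : independent P (sigma_process setT `[0, +oo[ X)
                                   (sigma_process measurable `[0, +oo[ B).
Hypothesis mmouM : is_mmou P alpha gamma sigma m0 X B M.

Let g t (j : 'I_d) (theta : R) := laplace_vec P X M theta t j 0.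
Let A h f := euler_op Q alpha gamma sigma h f.
Let G := \sum_i gamma i 0.
Let G_ge0 : 0 <= G. Proof. by rewrite sumr_ge0. Qed.

(* Both limits are taken along the same grids of [0, t + h], which have [t] among their
   nodes: the second sequence comes from the first by iterating the one-step operator. *)
Lemma laplace_approx t h : 0 <= t -> 0 <= h ->
  exists (n : nat -> nat), [/\
   forall k, (0 < n k)%N /\ (t + h) * (1 + G) <= (n k)%:R,
   forall theta j, P.-integrable setT (EFin \o laplace_integrand X M theta (t + h) j),
   forall theta j, euler_laplace P Q X alpha gamma sigma m0 (two_piece_grid t h (n k)) (n k) j theta
      @[k --> \oo] --> g t j theta &
   forall theta j, iter (n k) (A (h / (n k)%:R))
       (euler_laplace P Q X alpha gamma sigma m0 (two_piece_grid t h (n k)) (n k)) j theta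
      @[k --> \oo] --> g (t + h) j theta].
Proof.
move=> t0 h0.
have th0 : 0 <= t + h by rewrite addr_ge0.
have thG0 : 0 <= (t + h) * (1 + G) by rewrite mulr_ge0// addr_ge0.
pose b := Num.Def.archi_bound ((t + h) * (1 + G)).
(* The shift by [b] makes the mesh small enough from the start for all the conditions on step
   lengths. *)
pose n m := (m + b).+1.
have nb m : (t + h) * (1 + G) <= (n m)%:R.
  by apply: le_trans (ltW (archi_boundP thG0)) _; rewrite ler_nat /n -addSn leq_addl.
pose mesh m := (t + h) * harmonic (m + b)%N : R.
have meshE m : mesh m = (t + h) / (n m)%:R by [].
have mesh0 : mesh m @[m --> \oo] --> 0.
  rewrite -(mulr0 (t + h)); apply: cvgM; first exact: cvg_cst.
  exact: (cvg_comp _ _ (@cvg_addnr b) cvg_harmonic).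
have meshG m : (1 + G) * mesh m <= 1.
  by rewrite meshE mulrA ler_pdivrMr ?ltr0n// mul1r mulrC.
have mesh_ge0 m : 0 <= mesh m by rewrite meshE divr_ge0.
have mesh1 m : mesh m <= 1.
  by apply: le_trans (meshG m); rewrite mulrDl mul1r lerDl mulr_ge0.
have mesh_gamma m : G * mesh m <= 1.
  by apply: le_trans (meshG m); rewrite mulrDl mul1r lerDr.
pose tau m := two_piece_grid t h (n m).
have tau0 m : tau m 0%N = 0 by exact: two_piece_grid0.
have tauS m k : tau m k <= tau m k.+1.
  by rewrite -subr_ge0 two_piece_grid_step divr_ge0//; case: ifP.
have tau_mesh m k : tau m k.+1 - tau m k <= mesh m.
  by rewrite two_piece_grid_step meshE ler_wpM2r ?invr_ge0//; case: ifP => _; lra.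
have [phi1 [phi1k c1]] := euler_laplace_cvg mcX gamma_ge0 bmB indepXB mmouM tau0 tauS
  (fun m => two_piece_grid_mid t h (ltn0Sn _)) tau_mesh mesh0 mesh1 mesh_gamma.
have cvg_sub (phi : nat -> nat) : (forall k, (k <= phi k)%N) -> phi k @[k --> \oo] --> \oo.
  move=> phik; apply/cvgnyPge => a; near=> k; apply: leq_trans (phik k).
  by near: k; exact: nbhs_infty_ge.
(* The second subsequence is extracted from the first, so both limits hold along [phi1] composed
   with [phi2]. *)
have [phi2 [phi2k c2]] := euler_laplace_cvg mcX gamma_ge0 bmB indepXB mmouM
  (fun m => tau0 (phi1 m)) (fun m => tauS (phi1 m))
  (fun m => two_piece_grid_end t h (ltn0Sn _)) (fun m => tau_mesh (phi1 m))
  (cvg_comp phi1 mesh (cvg_sub _ phi1k) mesh0)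
  (fun m => mesh1 (phi1 m)) (fun m => mesh_gamma (phi1 m)).
exists (fun k => n (phi1 (phi2 k))); split => //.
- by move=> theta j; have [] := c2 theta j.
- move=> theta j; have [_ c] := c1 theta j.
  exact: (cvg_comp phi2 _ (cvg_sub _ phi2k) c).
move=> theta j; have [_ c] := c2 theta j.
rewrite (_ : (fun k => _) = (fun k => euler_laplace P Q X alpha gamma sigma m0
  (tau (phi1 (phi2 k))) (n (phi1 (phi2 k)) + n (phi1 (phi2 k)))%N j theta))//.
apply/funext => k; move: (phi1 (phi2 k)) => m.
suff H l : euler_laplace P Q X alpha gamma sigma m0 (tau m) (n m + l)%N =
    iter l (A (h / (n m)%:R)) (euler_laplace P Q X alpha gamma sigma m0 (tau m) (n m)) by rewrite H.
elim: l => [|l IH]; first by rewrite addn0.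
by rewrite addnS iterS -IH /= two_piece_grid_step ltnNge leq_addr.
Unshelve. all: by end_near. Qed.

(** The bounds on the scheme depend on the elapsed time only and pass to the limit; grids of [0, t]
    are obtained from [laplace_approx] with [h = 0]. *)
Lemma laplace_bound K : 0 <= K -> exists2 C : R, 0 <= C & exists2 N0 : R, 0 <= N0 &
  forall t, 0 <= t -> supb K (N0 * expR (C * t)) (g t) /\ lipb K (N0 * expR (C * t)) (g t).
Proof.
move=> K0; have [C C0 [N0 N00 H]] := euler_laplace_bound alpha sigma m0 mcX gamma_ge0 K0.
exists C => //; exists N0 => // t t0.
have [n [n0 _ c1 _]] := laplace_approx t0 (lexx 0).
have {}H k : supb K (N0 * expR (C * t))
     (euler_laplace P Q X alpha gamma sigma m0 (two_piece_grid t 0 (n k)) (n k)) /\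
   lipb K (N0 * expR (C * t))
     (euler_laplace P Q X alpha gamma sigma m0 (two_piece_grid t 0 (n k)) (n k)).
  have [nk0 nkG] := n0 k; rewrite addr0 in nkG.
  have nk0' : 0 < (n k)%:R :> R by rewrite ltr0n.
  rewrite -{1 3}(two_piece_grid_mid t 0 nk0); apply: H; first exact: two_piece_grid0.
    move=> l; rewrite two_piece_grid_step; case: ifP => _.
      rewrite divr_ge0//= ler_pdivrMr// mul1r; apply: le_trans nkG.
      by rewrite mulrDr mulr1 lerDl mulr_ge0.
    by rewrite mul0r lexx ler01.
  move=> l; rewrite two_piece_grid_step; case: ifP => _; last by rewrite mul0r mulr0.
  rewrite mulrA ler_pdivrMr// mul1r; apply: le_trans nkG.
  by rewrite mulrDr mulr1 mulrC lerDr.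
split=> [j x xK|j x y xK yK].
  apply: (cvgr_to_le (cvg_norm (c1 x j))).
  by near=> k; have [+ _] := H k; apply.
apply: (cvgr_to_le (cvg_norm (cvgB (c1 x j) (c1 y j)))).
by near=> k; have [_] := H k; apply.
Unshelve. all: by end_near. Qed.

Let euler_op_cvg (F : nat -> 'I_d -> R -> R) f h j x :
  (forall i y, F k i y @[k --> \oo] --> f i y) -> A h (F k) j x @[k --> \oo] --> A h f j x.
Proof.
move=> Ff; apply: cvgM; first exact: cvg_cst.
by apply: cvg_big => [|i _]; [exact: add_continuous|apply: cvgM; [exact: cvg_cst|exact: Ff]].
Qed.

(** [euler_op_iter] is applied to the transforms of the scheme at time [t]; its error involves the
    [n k] steps only through their total length [h]. Pointwise convergence suffices in the limit,
    since [A h] evaluates its argument at finitely many points. *)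
Lemma laplace_semigroup K : 0 <= K -> exists2 C : R, 0 <= C & exists2 C1 : R, 0 <= C1 &
  forall t h, 0 <= t -> 0 <= h -> h <= 1 -> forall j x, `|x| <= K ->
    `|g (t + h) j x - A h (g t) j x| <= C * expR (C1 * t) * h ^+ 2.
Proof.
move=> K0.
have K20 : 0 <= K * (1 + G) ^+ 2 by rewrite mulr_ge0// sqr_ge0.
have [C C0 H] := euler_op_iter Q alpha sigma gamma_ge0 K0.
have [C1 C10 [N0 N00 bound]] := euler_laplace_bound alpha sigma m0 mcX gamma_ge0 K20.
exists (C * N0); first exact: mulr_ge0.
exists C1 => // t h t0 h0 h1 j x xK.
have [n [n0 _ c1 c2]] := laplace_approx t0 h0.
pose F k := euler_laplace P Q X alpha gamma sigma m0 (two_piece_grid t h (n k)) (n k).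
have c3 : A h (F k) j x @[k --> \oo] --> A h (g t) j x by apply: euler_op_cvg => i y; exact: c1.
apply: (cvgr_to_le (cvg_norm (cvgB (c2 x j) c3))).
near=> k.
have [nk0 nkG] := n0 k.
have nk0' : 0 < (n k)%:R :> R by rewrite ltr0n.
have nh : (n k)%:R * (h / (n k)%:R) = h by rewrite mulrC divfK// gt_eqF.
have small l : 0 <= l -> l <= t + h -> 0 <= l / (n k)%:R <= 1 /\ G * (l / (n k)%:R) <= 1.
  move=> l0 lth; have lG : l * (1 + G) <= (n k)%:R.
    by apply: le_trans nkG; rewrite ler_wpM2r// addr_ge0.
  rewrite divr_ge0//= ler_pdivrMr// mul1r mulrA ler_pdivrMr// mul1r.
  have : 0 <= G * l by rewrite mulr_ge0.
  by move: lG; rewrite mulrDr mulr1 (mulrC l); split; lra.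
have step l : 0 <= two_piece_grid t h (n k) l.+1 - two_piece_grid t h (n k) l <= 1 /\
    G * (two_piece_grid t h (n k) l.+1 - two_piece_grid t h (n k) l) <= 1.
  by rewrite two_piece_grid_step; case: ifP => _; apply: small; lra.
have [F1 F2] := bound _ (two_piece_grid0 t h (n k)) (fun l => proj1 (step l))
  (fun l => proj2 (step l)) (n k).
rewrite two_piece_grid_mid// in F1 F2.
have := H (n k) (h / (n k)%:R) _ (F k) _ _ _ _ F1 F2 j x xK.
rewrite nh mulrA; apply => //.
- by rewrite divr_ge0.
- by have [] := small h h0 _; rewrite ?lerDr.
- by rewrite mulr_ge0 ?expR_ge0.
Unshelve. all: by end_near. Qed.

End laplace_semigroup.

Lemma cvg_within_quadratic {R : realType} (D : set R) (f F : R -> R) (t l C delta : R) :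
  0 < delta -> F 0 = f t -> is_derive (0 : R) 1 F l ->
  (forall y, D y -> `|y - t| <= delta -> `|f y - F (y - t)| <= C * (y - t) ^+ 2) ->
  (y - t)^-1 * (f y - f t) @[y --> within D t^'] --> l.
Proof.
move=> delta0 F0 [dF <-] H.
have C0 : 0 <= `|C| + 1 by rewrite addr_ge0.
have /cvgrPdist_le dFl := dF : (h^-1 *: (F (h *: 1 + 0) - F 0)) @[h --> 0^'] --> 'D_1 F 0.
apply/cvgrPdist_le => e e0.
have e20 : 0 < e / 2 by rewrite divr_gt0.
have [r /= r0 Hr] := dFl _ e20.
pose q := Num.min r (Num.min delta (e / 2 / (`|C| + 1))).
have q0 : 0 < q by rewrite !lt_min r0 delta0 divr_gt0// ltr_wpDl.
exists q => //= y /= yq yt Dy.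
have hn0 : y - t != 0 by rewrite subr_eq0.
move: yq; rewrite distrC !lt_min => /and3P[yr yd ye].
have := Hr (y - t); rewrite /= sub0r normrN => /(_ yr hn0).
rewrite [_ *: 1]mulr1 addr0 -[X in `|_ - X|]/((y - t)^-1 * (F (y - t) - F 0)) F0.
have := H y Dy (ltW yd).
set z := y - t in hn0 yr yd ye *; set a := 'D_1 F 0 => fyF dFz.
have -> : a - z^-1 * (f y - f t) =
    (a - z^-1 * (F z - f t)) - z^-1 * (f y - F z) by ring.
apply: le_trans (ler_normB _ _) _.
have -> : e = e / 2 + e / 2 by lra.
apply: lerD => //; rewrite normrM normfV.
rewrite mulrC ler_pdivrMr ?normr_gt0//; apply: le_trans fyF _.
rewrite -(real_normK (num_real z)) expr2 mulrA ler_wpM2r//.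
apply: (@le_trans _ _ ((`|C| + 1) * `|z|)).
  by rewrite ler_wpM2r//; apply: le_trans (ler_norm C) _; rewrite lerDl.
by rewrite mulrC -ler_pdivlMr ?ltr_wpDl// ltW.
Qed.

Section laplace_derivatives.
Context {disp : measure_display} {T : measurableType disp} {R : realType}.
Variables (P : probability T R) (d : nat) (Q : 'M[R]_d).
Variables (X : R -> T -> 'I_d) (B M : R -> T -> R).
Variables (alpha gamma sigma : 'cV[R]_d) (m0 : R).
Hypothesis mcX : is_markov_chain P Q X.
Hypothesis gamma_ge0 : forall i, 0 <= gamma i 0.
Hypothesis bmB : is_brownian_motion P B.
Hypothesis indepXB : independent P (sigma_process setT `[0, +oo[ X)
                                   (sigma_process measurable `[0, +oo[ B).
Hypothesis mmouM : is_mmou P alpha gamma sigma m0 X B M.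

Let g (t : R) (j : 'I_d) (theta : R) : R := laplace_vec P X M theta t j 0.
Let A h f := euler_op Q alpha gamma sigma h f.
Let G := \sum_i gamma i 0.
Let G_ge0 : 0 <= G. Proof. by rewrite sumr_ge0. Qed.

Let gamma_le i : gamma i 0 <= G.
Proof. by rewrite /G (bigD1 i)//= lerDl sumr_ge0. Qed.

(* For a negative step [- u], [A (- u)] is applied to [g t = A u (g (t - u)) + O(u^2)]. *)
Lemma laplace_expansion (t : R) j (x : R) : 0 <= t ->
  exists C : R, forall h : R, `|h| <= 2^-1 -> 0 <= t + h ->
  `|g (t + h) j x - A h (g t) j x| <= C * h ^+ 2.
Proof.
move=> t0; pose K : R := `|x|; have xK : `|x| <= K by []; have K0 : 0 <= K by rewrite normr_ge0.
have G1 : 0 <= 1 + G by rewrite addr_ge0.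

have K20 : 0 <= K * (1 + G) by rewrite mulr_ge0.
have K30 : 0 <= K * (1 + G) ^+ 2 by rewrite mulr_ge0// sqr_ge0.
have [C1 C10 [c1 c10 H1]] := laplace_semigroup mcX gamma_ge0 bmB indepXB mmouM K20.
have [C2 C20 H2] := euler_op_local_error Q alpha sigma gamma_ge0 K0.
have [C3 C30 [N0 N00 H3]] := laplace_bound mcX gamma_ge0 bmB indepXB mmouM K30.
have [cq cq0 Hq] := symbol_bound alpha sigma K0.
have [cp cp0 Hp] := expmx_col_sum Q.
pose D1 := C1 * expR (c1 * t).
have D10 : 0 <= D1 by rewrite mulr_ge0// expR_ge0.
have D1E : C1 * expR (c1 * t) = D1 by [].
clearbody D1.
pose D2 := 2 * (C2 * (N0 * expR (C3 * t))).
have D20 : 0 <= D2 by rewrite !mulr_ge0// expR_ge0.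
pose D3 := expR cq * ((1 + cp) * D1).
have D30 : 0 <= D3 by rewrite !mulr_ge0 ?expR_ge0// addr_ge0.
exists (D1 + D2 + D3) => h h12 th0.
have h1 : `|h| <= 1 by apply: le_trans h12 _; rewrite invf_le1// ler1n.
have h20 := sqr_ge0 h.
have [h0|/ltW h0] := leP 0 h.
  apply: (@le_trans _ _ (D1 * h ^+ 2)); last by rewrite ler_wpM2r//; lra.
  rewrite -D1E; apply: H1 => //; first by rewrite ger0_norm in h1.
  by rewrite ler_peMr// lerDl.
pose u := - h; have u0 : 0 <= u by rewrite oppr_ge0.
have uh : `|h| = u by rewrite ler0_norm.
pose s := t + h; have su : t = s + u by rewrite /s /u addrK.
have st : s <= t by rewrite /s gerDl.
have u1 : u <= 1 by rewrite -uh.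
(* The remainder of the forward expansion from [s = t - u] to [t]. It is needed on the larger window
   [K * (1 + G)] because the backward step may stretch the argument. *)
pose r i y := g t i y - A u (g s) i y.
have rb : supb (K * (1 + G)) (D1 * u ^+ 2) r.
  move=> i y yK; rewrite /r {1}su; apply: le_trans (H1 s u th0 u0 u1 i y yK) _.
  by rewrite ler_wpM2r ?sqr_ge0// -D1E ler_wpM2l// ler_expR ler_wpM2l.
have e1 : `|A h r j x| <= D3 * h ^+ 2.
  rewrite /A /euler_op normrM ger0_norm ?expR_ge0// /D3 -!mulrA.
  have y1 : `|(1 - gamma j 0 * h) * x| <= K * (1 + G).
    rewrite normrM mulrC -/K ler_wpM2l//; apply: le_trans (ler_normB _ _) _.
    rewrite normr1 lerD2l normrM (ger0_norm (gamma_ge0 j)) -[leRHS]mulr1; apply: ler_pM => //.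
  have := wsum_bound (mulr_ge0 D10 (sqr_ge0 u)) rb y1 (Hp h j h1) => Hw.
  apply: ler_pM => //.
    rewrite ler_expR; apply: le_trans (ler_norm _) _; rewrite normrM.
    by have [Hqj _] := Hq j; rewrite -[leRHS]mul1r; apply: ler_pM => //; exact: Hqj.
  apply: le_trans Hw _; rewrite /u sqrrN (ler_wpM2r (mulr_ge0 D10 h20))//.
  by rewrite lerD2l ler_piMr.
have [s1 s2] := H3 s th0.
(* The two steps have total length 0, where [euler_op] is the identity. The hypothesis [|h| <= 2^-1]
   ensures [|u| + |h| <= 1]. *)
have e2 : `|A h (A u (g s)) j x - g s j x| <= D2 * h ^+ 2.
  have := H2 u h _ (g s) _ (mulr_ge0 N00 (expR_ge0 (C3 * s))) s1 s2 j x (lexx _).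
  rewrite {2}/u addNr euler_op0 => H.
  apply: le_trans (H _) _; first by rewrite (ger0_norm u0) uh; move: h12; rewrite uh; lra.
  rewrite (ger0_norm u0) uh (_ : h ^+ 2 = u ^+ 2); last by rewrite /u sqrrN.
  rewrite (_ : _ * u * (u + u) = 2 * (C2 * (N0 * expR (C3 * s))) * u ^+ 2); last by ring.
  rewrite ler_wpM2r ?sqr_ge0// /D2 ler_wpM2l// ler_wpM2l// ler_wpM2l// ler_expR ler_wpM2l//.
have -> : g (t + h) j x - A h (g t) j x =
    - (A h (A u (g s)) j x - g s j x) - A h r j x.
  by rewrite /A /r euler_opB; ring.
apply: le_trans (ler_normB _ _) _; rewrite normrN.
apply: le_trans (lerD e2 e1) _.
by rewrite -mulrDl ler_wpM2r// -addrA lerDr.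
Qed.

Lemma laplace_integrable (theta t : R) j : 0 <= t ->
  P.-integrable setT (EFin \o laplace_integrand X M theta t j).
Proof.
move=> t0; have [n [_ + _ _]] := laplace_approx mcX gamma_ge0 bmB indepXB mmouM t0 (lexx 0).
by rewrite addr0; apply.
Qed.

Lemma laplace_is_derive (theta t : R) j : 0 <= t -> exists df : R, is_derive theta 1 (g t j) df.
Proof.
move=> t0; pose U w : R := \1_(X t @^-1` [set j]) w.
have E th w : laplace_integrand X M th t j w = U w * expR (th * - M t w).
  by rewrite /laplace_integrand mulrC mulrN.
have iU th : P.-integrable setT (fun w => (U w * expR (th * - M t w))%:E).
  by under eq_fun do rewrite -E; exact: laplace_integrable.
have -> : g t j = (fun th => \int[P]_w (U w * expR (th * - M t w))).
  apply/funext => th; rewrite /g mxE unlock.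
  by congr fine; apply: eq_integral => w _; rewrite E.
eexists; exact: (is_derive_mgf iU).
Qed.

(** The convergence theorem is used with zero steps on the constant grid 0: the approximating
    sequence is then constant and equal to the initial transform. *)
Lemma laplace_initial (theta : R) j :
  g 0 j theta = expR (- (theta * m0)) * fine (P (X 0 @^-1` [set j])).
Proof.
have [phi [_ H]] := @euler_laplace_cvg _ _ _ P d Q X B M alpha gamma sigma m0 mcX gamma_ge0 bmB
  indepXB mmouM (fun _ _ => 0) (fun=> 0%N) (fun=> 0) 0 (fun=> erefl) (fun _ _ => lexx 0)
  (fun=> erefl) (fun _ _ => ltac:(by rewrite subrr)) (cvg_cst 0) (fun=> ler01)
  (fun=> ltac:(by rewrite mulr0)).
have [_ c] := H theta j.
exact: (cvg_unique _ c (cvg_cst _)).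
Qed.

End laplace_derivatives.

Theorem theorem4p1 (R : realType) (disp : measure_display)
    (T : measurableType disp) (P : probability T R) (d : nat)
    (Q : 'M[R]_d) (X : R -> T -> 'I_d) (B M : R -> T -> R)
    (alpha gamma sigma : 'cV[R]_d) (m0 : R)
    (genQ : is_generator Q)
    (mcX : is_markov_chain P Q X)
    (bmB : is_brownian_motion P B)
    (indepXB : independent P (sigma_process setT `[0, +oo[ X)
                             (sigma_process measurable `[0, +oo[ B))
    (gamma_gt0 : forall i, 0 < gamma i 0)
    (mmouM : is_mmou P alpha gamma sigma m0 X B M) :
  let g := laplace_vec P X M in
  let sigma2 := map_mx (fun x => x ^+ 2) sigma in
  [/\ (* the expectations defining g exist and are finite *)
      forall theta t i, 0 <= t ->
        P.-integrable setT (EFin \o laplace_integrand X M theta t i),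
      forall theta t, 0 <= t ->
        derivable (fun u => g u t) theta 1 /\
        is_derive_within `[0, +oo[ (fun s => g theta s) t
          (Q^T *m g theta t
           - (theta *: diag_mx alpha^T - (2^-1 * theta ^+ 2) *: diag_mx sigma2^T)
               *m g theta t
           - (theta *: diag_mx gamma^T) *m derive1 (fun u => g u t) theta),
      forall t, 0 <= t -> g 0 t = prob_vec P X t &
      forall theta, g theta 0 = expR (- (theta * m0)) *: prob_vec P X 0].
Proof.
move=> g sigma2; have gamma_ge0 i : 0 <= gamma i 0 by exact: ltW.
have gE th t i (j : 'I_1) : g th t i j = g th t i 0 by rewrite ord1.
split.
- by move=> th t i t0; exact: (laplace_integrable mcX gamma_ge0 bmB indepXB mmouM).
- move=> th t t0.
  have dg j : exists df : R, is_derive th 1 (fun u => g u t j 0) df.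
    exact: (laplace_is_derive mcX gamma_ge0 bmB indepXB mmouM).
  have der : derivable (fun u => g u t) th 1.
    apply/derivable_mxP => i j; have [df [dfi _]] := dg i.
    by rewrite (_ : (fun _ => _) = (fun u => g u t i 0))//; apply/funext => u; rewrite gE.
  split=> //; apply: cvg_mx_coord => j j0.
  have [df dfi] := choice dg.
  have dE i : derive1 (fun u => g u t) th i 0 = df i.
    by rewrite derive1E derive_mx// mxE (@derive_val _ _ _ _ _ _ _ (dfi i)).
  rewrite (_ : (fun _ => _) = (fun s => (s - t)^-1 * (g th s j 0 - g th t j 0))); last first.
    by apply/funext => s; rewrite ord1 !mxE.
  have := @is_derive_euler_op R d Q alpha gamma sigma (fun i u => g u t i 0) df j th dfi.
  have [C HC] := laplace_expansion mcX gamma_ge0 bmB indepXB mmouM j th t0.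
  set l := (_ - _ : R) => dA.
  (* Read entrywise, the matrix right-hand side is the derivative of [euler_op] at [h = 0]; the
     transpose of [Q] appears because [euler_op] sums over the first index of the transition
     matrix. *)
  have -> : (Q^T *m g th t
           - (th *: diag_mx alpha^T - (2^-1 * th ^+ 2) *: diag_mx sigma2^T) *m g th t
           - (th *: diag_mx gamma^T) *m derive1 (fun u => g u t) th) j j0 = l.
    rewrite ord1 mulmxBl -!scalemxAl !mul_diag_mx !mxE dE /l /symbol.
    under eq_bigr do rewrite mxE.
    have -> : fine 'E_P[laplace_integrand X M th t j] = g th t j 0 by rewrite mxE.
    by ring.
  have A0 : euler_op Q alpha gamma sigma 0 (fun i u => g u t i 0) j th = g th t j 0.
    by rewrite euler_op0.
  have quad y : `[0, +oo[%classic y -> `|y - t| <= 2^-1 ->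
      `|g th y j 0 - euler_op Q alpha gamma sigma (y - t) (fun i u => g u t i 0) j th| <=
      C * (y - t) ^+ 2.
    rewrite /= in_itv/= andbT => y0 yt.
    by have := HC (y - t) yt; rewrite addrC subrK => /(_ y0); exact.
  have half_gt0 : 0 < 2^-1 :> R by rewrite invr_gt0.
  exact: (cvg_within_quadratic half_gt0 A0 dA quad).
- move=> t t0; apply/matrixP => i j; rewrite !mxE unlock; congr fine.
  rewrite (_ : (fun _ => _) = (fun w => (\1_(X t @^-1` [set i]) w)%:E)).
    rewrite integral_indic//; first by rewrite setIT.
    by case: mcX => + _ _; exact.
  by apply/funext => w; rewrite /laplace_integrand mul0r oppr0 expR0 mul1r.
- move=> th; apply/matrixP => i j; rewrite ord1 [RHS]mxE [X in _ * X]mxE.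
  exact: (laplace_initial mcX gamma_ge0 bmB indepXB mmouM).
Qed.
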